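(* Let $n\ge 1$, let $\mathcal W=(\omega_1,\dots,\omega_n)$ be a multi-weight sequence and let $T=(T_1,\dots,T_n)$ be an $n$-tuple of commuting contractions on a Hilbert space $\mathcal H$. Then $T$ is a part of the multi-shift $(M_{z_1},\dots,M_{z_n})$ on $A^2_{\mathcal W}(\mathcal E)$ for some Hilbert space $\mathcal E$ if and only if $T$ is a pure $\mathcal W$-hypercontraction.
   Context: All Hilbert spaces are complex; $\mathbb D$ is the open unit disc and $\mathbb Z_+=\{0,1,2,\dots\}$. Weight sequences. A weight sequence is a decreasing (i.e. non-increasing) sequence $\omega=\{\omega_k\}_{k\ge0}$ of positive numbers with $\omega_0=1$, $\liminf_{k\to\infty}\omega_k^{1/k}=1$, such that the analytic function $k_\omega(z)=\sum_{k\ge0}\frac1{\omega_k}z^k$ has no zeros on $\mathbb D$ and, with $k_{\omega,r}(z)=k_\omega(rz)$: (P1) for every $0<r<1$, the function $k_\omega/k_{\omega,r}$ has non-negative Taylor coefficients at $0$; (P2) the Taylor coefficients of the quotients $k_{\omega,r}/k_\omega$, $0<r<1$, are uniformly bounded. The constant sequence $1$ is a weight sequence, denoted $\mathds 1$. A multi-weight sequence is a tuple $\mathcal W=(\omega_1,\dots,\omega_n)$ of weight sequences $\omega_i=\{\omega^{(i)}_m\}_{m\ge0}$. Its associated function is $k_{\mathcal W}(\boldsymbol z)=\prod_{i=1}^n k_{\omega_i}(z_i)$ on $\mathbb D^n$ (non-vanishing), and $\frac1{k_{\mathcal W}(\boldsymbol z)}=\sum_{\alpha\in\mathbb Z_+^n}c_\alpha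 \boldsymbol z^\alpha$. Space. For a Hilbert space $\mathcal E$, $A^2_{\mathcal W}(\mathcal E)$ is the Hilbert space of analytic $f:\mathbb D^n\to\mathcal E$, $f(\boldsymbol z)=\sum_{\alpha}a_\alpha \boldsymbol z^\alpha$, with $\|f\|^2=\sum_\alpha\|a_\alpha\|^2\omega^{(1)}_{\alpha_1}\cdots\omega^{(n)}_{\alpha_n}<\infty$ (the reproducing kernel space with kernel $\sum_\alpha \frac{(\boldsymbol z\bar{\boldsymbol w})^\alpha}{\omega^{(1)}_{\alpha_1}\cdots\omega^{(n)}_{\alpha_n}}I_{\mathcal E}$). $M_{z_i}$ is multiplication by the $i$-th coordinate function. Hypercontractions. For an $n$-tuple $T$ of commuting contractions on $\mathcal H$ and $\mathbf r\in(0,1)^n$, $D_{\mathcal W,T}(\mathbf r)=\sum_{\alpha\in\mathbb Z_+^n}c_\alpha\mathbf r^\alpha T^\alpha T^{*\alpha}$, where $T^\alpha=T_1^{\alpha_1}\cdots T_n^{\alpha_n}$. Let $S(\mathcal W)=\{(\omega_1',\dots,\omega_n'):\omega_i'\in\{\omega_i,\mathds 1\},\ i=1,\dots,n\}$. $T$ is a $\mathcal W$-hypercontraction if $D_{\mathcal W',T}(\mathbf r)\ge0$ for all $\mathcal W'\in S(\mathcal W)$ and all $\mathbf r\in(0,1)^n$. It is a pure $\mathcal W$-hypercontraction if moreover each $T_i$ is pure, i.e. $T_i^{*k}\to0$ in the strong operator topology as $k\to\infty$. Part. $T$ is a part of $(M_{z_1},\dots,M_{z_n})$ on $A^2_{\mathcal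 W}(\mathcal E)$ if there is a closed subspace $\mathcal Q\subseteq A^2_{\mathcal W}(\mathcal E)$, invariant under every $M_{z_i}^*$, and a single unitary $\mathcal H\to\mathcal Q$ that intertwines $T_i$ with $P_{\mathcal Q}M_{z_i}|_{\mathcal Q}$ for all $i=1,\dots,n$. *)

(* Defs.v *)
From HB Require Import structures.
From mathcomp Require Import all_boot all_order all_algebra.
From mathcomp Require Import sesquilinear complex.
From mathcomp Require Import all_classical all_reals all_analysis.
From mathcomp.analysis.showcase Require Import summability.

Set Implicit Arguments.
Unset Strict Implicit.
Unset Printing Implicit Defensive.

Import Order.TTheory GRing.Theory Num.Theory numFieldNormedType.Exports.

Local Open Scope complex_scope.
Local Open Scope classical_set_scope.
Local Open Scope ring_scope.

(* Convention: [hdot] is linear in its first argument and conjugate-linear in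
   the second. *)
Record hilbertType (R : realType) := Hilbert {
  hcarrier :> completeNormedModType R[i];
  hdot : {dot hcarrier for (@Num.conj R[i])};
  hdotE : forall x : hcarrier, `|x| ^+ 2 = hdot x x }.

(* Operators on a Hilbert space presented as a linear subspace D of an
   lmodType V with an inner product ip, meaningful on D only.  [adjoint] and
   [orthoproj] are the usual objects whenever these exist, and 0 otherwise. *)
Section operators.
Context {R : realType} {V : lmodType R[i]}.
Variables (D : set V) (ip : V -> V -> R[i]).

Definition adjoint (S : V -> V) (y : V) : V :=
  xget 0 [set z | D z /\ forall x, D x -> ip (S x) y = ip x z].

Definition orthoproj (Q : set V) (x : V) : V :=
  xget 0 [set q | Q q /\ forall p, Q p -> ip (x - q) p = 0].

Definition closed_subspace (Q : set V) : Prop :=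
  [/\ Q `<=` D,
      Q 0,
      forall (a : R[i]) x y, Q x -> Q y -> Q (a *: x + y) &
      forall (q : nat -> V) x, (forall k, Q (q k)) -> D x ->
        (fun k => ip (q k - x) (q k - x) : R[i]^o) @ \oo --> (0 : R[i]^o) ->
        Q x].

(* The tuple T on H is unitarily equivalent to the compression of the tuple S
   to a closed subspace that is invariant under the adjoints of S. *)
Definition is_part (n : nat) (H : hilbertType R)
    (T : 'I_n -> H -> H) (S : 'I_n -> V -> V) : Prop :=
  exists Q : set V,
    [/\ closed_subspace Q,
        forall i q, Q q -> Q (adjoint (S i) q) &
        exists U : {linear H -> V},
          [/\ range U = Q,
              forall x y, ip (U x) (U y) = hdot H x y &
              forall i x, U (T i x) = orthoproj Q (S i (U x))]].

End operators.

Definition hadjoint (R : realType) (H : hilbertType R) (T : H -> H) : H -> H :=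
  adjoint [set: H] (hdot H) T.

Definition mindex (n : nat) := {ffun 'I_n -> nat}.

Definition mpow (n : nat) (V : Type) (S : 'I_n -> V -> V) (al : mindex n) :
    V -> V :=
  \big[@comp V V V/id]_(i < n) iter (al i) (S i).

Definition polydisc (R : realType) (n : nat) :=
  {z : 'rV[R[i]]_n | [forall i, `|z 0 i| < 1]}.

Section power_series.
Context {R : realType}.

(* [a] is the sequence of Taylor coefficients at 0 of [f], which need only be
   analytic near 0. *)
Definition has_taylor1 (f : R[i] -> R[i]) (a : nat -> R[i]) : Prop :=
  exists2 rho : R, 0 < rho & forall z : R[i], `|z| < rho%:C ->
    series (fun k => a k * z ^+ k : R[i]^o) @ \oo --> (f z : R[i]^o).

Definition taylor1 (f : R[i] -> R[i]) : nat -> R[i] :=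
  xget (fun=> 0) [set a | has_taylor1 f a].

(* Multiple series are unordered sums (limits along finite sets of indices),
   i.e. for power series on the polydisc, absolutely convergent ones. *)
Definition has_taylor (n : nat) (E : normedModType R[i])
    (f : polydisc R n -> E) (a : mindex n -> E) : Prop :=
  forall z : polydisc R n,
    partial_sum (fun al : mindex n => (\prod_(i < n) val z 0 i ^+ al i) *: a al)
      @ totally --> f z.

Definition taylor (n : nat) (E : normedModType R[i])
    (f : polydisc R n -> E) : mindex n -> E :=
  xget (fun=> 0) [set a | has_taylor f a].

Definition analytic (n : nat) (E : normedModType R[i])
    (f : polydisc R n -> E) : Prop :=
  exists a, has_taylor f a.

End power_series.

Section weights.
Context {R : realType}.

Definition kfun (w : nat -> R) (z : R[i]) : R[i] :=
  limn (series (fun k => (w k)^-1%:C * z ^+ k : R[i]^o)).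

Record weight_sequence (w : nat -> R) : Prop := WeightSequence {
  weight_nonincreasing : nonincreasing_seq w;
  weight_gt0 : forall k, 0 < w k;
  weight0 : w 0%N = 1;
  weight_liminf : limn_einf (fun k => (w k `^ k%:R^-1)%:E) = 1%E;
  kfun_neq0 : forall z, `|z| < 1 -> kfun w z != 0;
  weight_P1 : forall r : R, 0 < r < 1 -> forall m,
    0 <= taylor1 (fun z => kfun w z / kfun w (r%:C * z)) m;
  weight_P2 : exists M : R, forall r : R, 0 < r < 1 -> forall m,
    `|taylor1 (fun z => kfun w (r%:C * z) / kfun w z) m| <= M%:C }.

Context {n : nat}.
Implicit Types W : 'I_n -> nat -> R.

Definition mkfun W (z : polydisc R n) : R[i] :=
  \prod_(i < n) kfun (W i) (val z 0 i).

Definition inv_coef W : mindex n -> R[i] :=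
  taylor (fun z => (mkfun W z)^-1 : R[i]^o).

Definition mweight W (al : mindex n) : R := \prod_(i < n) W i (al i).

Definition S_weights W : set ('I_n -> nat -> R) :=
  [set W' | forall i, W' i = W i \/ W' i = (fun=> 1)].

End weights.

Section A2.
Context {R : realType} {n : nat} (W : 'I_n -> nat -> R) (E : hilbertType R).

Definition A2 : set (polydisc R n -> E) :=
  [set f | analytic f /\
    (\esum_(al in [set: mindex n])
       (complex.Re `|taylor f al| ^+ 2 * mweight W al)%:E < +oo)%E].

Definition A2dot (f g : polydisc R n -> E) : R[i] :=
  summability.sum (fun al : mindex n =>
    (mweight W al)%:C * hdot E (taylor f al) (taylor g al) : R[i]^o).

Definition mul_coord (i : 'I_n) (f : polydisc R n -> E) : polydisc R n -> E :=
  fun z => val z 0 i *: f z.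

End A2.

Arguments A2 {R n} W E _.
Arguments A2dot {R n} W E f g.
Arguments mul_coord {R n} E i f _.

Section hypercontractions.
Context {R : realType} {n : nat} (H : hilbertType R).
Implicit Types (W : 'I_n -> nat -> R) (T : 'I_n -> H -> H).

(* The sum converges in operator norm for commuting contractions; here it is
   taken pointwise on H. *)
Definition defect W T (r : 'I_n -> R) (x : H) : H :=
  summability.sum (fun al : mindex n =>
    (inv_coef W al * \prod_(i < n) (r i)%:C ^+ al i) *:
      mpow T al (mpow (fun i => hadjoint (T i)) al x)).

Definition contractive (T : H -> H) : Prop := forall x, `|T x| <= `|x|.

Definition hypercontraction W T : Prop :=
  forall W', S_weights W W' ->
  forall r : 'I_n -> R, (forall i, 0 < r i < 1) ->
  forall x, 0 <= hdot H (defect W' T r x) x.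

Definition pure_operator (T : H -> H) : Prop :=
  forall x, (fun k => iter k (hadjoint T) x) @ \oo --> (0 : H).

Definition pure_hypercontraction W T : Prop :=
  hypercontraction W T /\ forall i, pure_operator (T i).

End hypercontractions.

(* Main.v *)
Require Import Defs.
From HB Require Import structures.
From mathcomp Require Import all_boot all_order all_algebra.
From mathcomp Require Import sesquilinear complex.
From mathcomp Require Import all_classical all_reals all_analysis.
From mathcomp Require Import finmap.
From mathcomp.analysis.showcase Require Import summability.
From mathcomp Require Import ring lra zify.

(** Write [S = T^*] and [q x = |x|^2].  If [T] is a pure hypercontraction, then in
one variable the defects [f_r = sum_m c_m r^m q (S^m x)] decrease, by (P1), to a
quadratic form [d] as [r -> 1], and (P2) lets one pass to the limit to obtain
[q x = sum_m d (S^m x) / w_m]; purity kills the [S]-invariant remainder.  Applying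
this one variable at a time, the positivity of the defects for all weights in
[S(W)] being what keeps the induction going, gives
[|x|^2 = sum_al d (S^al x) / w_al].  As [0 <= d <= |.|^2], Riesz' theorem and the
power series of [sqrt (1 - z)] give [d x = |L x|^2] with [L] linear, and
[x |-> sum_al (L S^al x / w_al) z^al] is an isometry that intertwines [S] with the
backward shifts.

Conversely, for a part of the shift [S] is the restriction of the backward shifts,
so that, with [a] the Taylor coefficients of [x] multiplied by the weights,
[|S^al x|^2 = sum_be |a_(al+be)|^2 / w_be].  Hence the defect of [x] at [r] is
[sum_ga |a_ga|^2 prod_i (k_i / k_(i,r_i))_(ga_i)], which is non-negative by (P1) (for the
constant weights, by monotonicity). *)

Set Implicit Arguments.
Unset Strict Implicit.
Unset Printing Implicit Defensive.

Import Order.TTheory GRing.Theory Num.Theory numFieldNormedType.Exports.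

Local Open Scope complex_scope.
Local Open Scope classical_set_scope.
Local Open Scope ring_scope.

(** * Unordered sums *)

#[local] Existing Instance totally_filter.

(** The limit arguments are carried out for real-valued forms [q] on a set with commuting self-maps;
    operators reappear only when a form is finally written as the square of a norm. Monotone limits
    of operators thus become limits of real sequences, and linearity is not lost because being a
    quadratic form is stable under pointwise limits. The obstacle is that 1/k may have coefficients
    of both signs, so nothing is monotone term by term as r -> 1. (P1) turns the comparison of two
    radii into a series with non-negative coefficients, but (P2) only bounds the coefficients of k_r
    / k and gives no decay. The missing summability comes from the constant weight: its defect at r
    -> 1 gives q (S x) <= q x, and by purity the differences q (S^m x) - q (S^(m+1) x) telescope to
    q x. This is why (P2) is applied to q - q o S rather than to q. Mixed choices in S(W) let the
    limit form of one variable inherit this monotonicity in the remaining ones. In the model the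
    coefficient space is H itself, since L can be taken to be a linear map from H to H. *)

Definition has_sum (I : choiceType) (K : numFieldType) (E : normedModType K)
  (x : I -> E) (s : E) : Prop := partial_sum x @ totally --> s.

Lemma partial_sumE (I : choiceType) (E : zmodType) (x : I -> E) (A : {fset I}) :
  partial_sum x A = \sum_(i <- A) x i.
Proof. by rewrite /partial_sum big_seq_fsetE. Qed.

Section basics.
Context {I : choiceType} {K : numFieldType} {E : normedModType K}.
Implicit Types (x y : I -> E) (s : E) (A B : {fset I}).

Lemma has_sumP x s : has_sum x s <->
  forall e : K, 0 < e -> exists A, forall B, (A `<=` B)%fset ->
    `|s - \sum_(i <- B) x i| < e.
Proof.
split => [/cvgrPdist_lt h e e0|h].
  have [A _ hA] := h e e0; exists A => B AB.
  by rewrite -partial_sumE; exact: hA.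
apply/cvgrPdist_lt => e /h[A hA]; exists A => // B AB.
by rewrite partial_sumE; exact: hA.
Qed.

Lemma has_sum_unique x s s' : has_sum x s -> has_sum x s' -> s = s'.
Proof. exact: norm_cvg_unique. Qed.

Lemma eq_has_sum x y s : x =1 y -> has_sum x s -> has_sum y s.
Proof. by move=> /funext ->. Qed.

Lemma has_sumE x s : has_sum x s -> summability.sum x = s.
Proof. by move=> h; exact/cvg_lim. Qed.

Lemma has_sumD x y s t : has_sum x s -> has_sum y t ->
  has_sum (fun i => x i + y i) (s + t).
Proof.
move=> h1 h2; rewrite /has_sum.
have -> : partial_sum (fun i => x i + y i) = fun A => partial_sum x A + partial_sum y A.
  by apply/funext => A; rewrite /partial_sum big_split.
exact: cvgD.
Qed.

Lemma has_sum0 : has_sum (fun _ : I => 0 : E) 0.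
Proof.
rewrite /has_sum (_ : partial_sum _ = fun=> 0); first exact: cvg_cst.
by apply/funext => A; rewrite /partial_sum big1.
Qed.

Lemma has_sum_finite x A : (forall i, i \notin A -> x i = 0) ->
  has_sum x (\sum_(i <- A) x i).
Proof.
move=> h; apply/has_sumP => e e0; exists A => B AB.
rewrite (big_fset_incl _ AB) ?subrr ?normr0// => i _ iA; exact: h.
Qed.

Lemma has_sum1 (i0 : I) (a : E) : has_sum (fun i => if i == i0 then a else 0) a.
Proof.
rewrite -[X in has_sum _ X](_ : \sum_(i <- [fset i0]%fset) (if i == i0 then a else 0) = a).
  by apply: has_sum_finite => i; rewrite inE => /negPf ->.
by rewrite big_seq_fset1 eqxx.
Qed.

Lemma has_sum_sum (J : Type) (r : seq J) (x : J -> I -> E) (s : J -> E) :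
  (forall j, has_sum (x j) (s j)) ->
  has_sum (fun i => \sum_(j <- r) x j i) (\sum_(j <- r) s j).
Proof.
move=> h; elim: r => [|j r ih].
  by rewrite big_nil; apply: eq_has_sum has_sum0 => i; rewrite big_nil.
rewrite big_cons; apply: eq_has_sum (has_sumD (h j) ih) => i.
by rewrite big_cons.
Qed.

Lemma has_sum_le_dist x s a (M : K) : has_sum x s ->
  (exists A, forall B, (A `<=` B)%fset -> `|\sum_(i <- B) x i - a| <= M) ->
  `|s - a| <= M.
Proof.
move=> h [A hA].
(* The order of [K] is only partial; [M] is comparable with [|s - a|] because it bounds a norm and
   is therefore real. *)
have MR : M \is Num.real by apply: ger0_real; apply: le_trans (hA A _).
rewrite real_leNgt//; apply/negP; rewrite -subr_gt0 => e0.
have [A' hA'] := (has_sumP _ _).1 h _ e0.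
have := hA (A `|` A')%fset (fsubsetUl _ _).
have := hA' (A `|` A')%fset (fsubsetUr _ _).
set t := \sum_(_ <- _) _ => h1 h2.
suff : `|s - a| < `|s - a| by rewrite ltxx.
have {1}-> : s - a = (s - t) + (t - a) by rewrite addrA subrK.
apply: (le_lt_trans (ler_normD _ _)).
by rewrite -[ltRHS](subrK M); apply: ltr_leD.
Qed.

End basics.

Lemma has_sum_image (I : choiceType) (K : numFieldType) (E F : normedModType K)
    (x : I -> E) (s : E) (f : E -> F) :
  f 0 = 0 -> (forall a b, f (a + b) = f a + f b) -> {for s, continuous f} ->
  has_sum x s -> has_sum (fun i => f (x i)) (f s).
Proof.
move=> f0 fD fc h; rewrite /has_sum.
have -> : partial_sum (fun i => f (x i)) = f \o partial_sum x.
  apply/funext => A; rewrite /partial_sum /=.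
  by elim/big_rec2: _ => // i y1 y2 _ ->; rewrite fD.
exact: cvg_comp h fc.
Qed.

Lemma has_sumZ (I : choiceType) (K : numFieldType) (E : normedModType K)
    (x : I -> E) (s : E) (a : K) :
  has_sum x s -> has_sum (fun i => a *: x i) (a *: s).
Proof.
apply: (has_sum_image (f := fun v : E => a *: v)); first by rewrite scaler0.
  by move=> *; rewrite scalerDr.
exact: scaler_continuous.
Qed.

Lemma has_sumN (I : choiceType) (K : numFieldType) (E : normedModType K)
    (x : I -> E) (s : E) : has_sum x s -> has_sum (fun i => - x i) (- s).
Proof. by move=> h; move: (has_sumZ (a := -1) h); rewrite scaleN1r; apply: eq_has_sum => i; rewrite scaleN1r. Qed.

Lemma has_sumB (I : choiceType) (K : numFieldType) (E : normedModType K)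
    (x y : I -> E) (s t : E) : has_sum x s -> has_sum y t ->
  has_sum (fun i => x i - y i) (s - t).
Proof. by move=> h1 /has_sumN; exact: has_sumD. Qed.

Lemma has_sum_reindex (I J : choiceType) (K : numFieldType) (E : normedModType K)
    (g : J -> I) (x : I -> E) (s : E) :
  injective g -> (forall i, x i != 0 -> exists j, g j = i) ->
  has_sum (x \o g) s <-> has_sum x s.
Proof.
move=> ginj gsurj.
have sumg (A : {fset J}) : \sum_(i <- [fset g j | j in A]%fset) x i = \sum_(j <- A) (x \o g) j.
  by rewrite big_imfset //= => i j _ _; exact: ginj.
have pre (A : {fset I}) : exists A' : {fset J}, forall j, (j \in A') = (g j \in A).
  have finA : finite_set (g @^-1` [set` A]).
    apply: finite_preimage; last exact: finite_fset.
    by move=> ? ? _ _; exact: ginj.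
  exists (fset_set (g @^-1` [set` A])) => j.
  by rewrite in_fset_set//; apply/idP/idP; [move/set_mem|move=> ?; exact/mem_set].
split=> /has_sumP h; apply/has_sumP => e /h[A hA].
  exists [fset g j | j in A]%fset => B AB.
  have [B' hB'] := pre B.
  have -> : \sum_(i <- B) x i = \sum_(i <- B') (x \o g) i.
    rewrite -sumg; symmetry; apply: big_fset_incl.
      by apply/fsubsetP => i /imfsetP[j /= jB ->]; rewrite -hB'.
    move=> i iB iB'; apply/eqP/negPn/negP => /gsurj[j ji]; move/negP: iB'; apply.
    by apply/imfsetP; exists j => //=; rewrite hB' ji.
  apply: hA; apply/fsubsetP => j jA; rewrite hB'.
  by apply: (fsubsetP AB); apply/imfsetP; exists j.
have [A' hA'] := pre A; exists A' => B AB.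
rewrite -sumg -(_ : \sum_(i <- (A `|` [fset g j | j in B])%fset) x i = \sum_(i <- [fset g j | j in B]%fset) x i).
  apply: hA; exact: fsubsetUl.
symmetry; apply: big_fset_incl; first exact: fsubsetUr.
move=> i /fsetUP[iA iB|iC /negP//]; apply/eqP/negPn/negP => /gsurj[j ji].
move/negP: iB; apply; apply/imfsetP; exists j => //=; apply: (fsubsetP AB).
by rewrite hA' ji.
Qed.

(** In a [numFieldType] non-negativity includes being real, so an argument by closed half-lines does
    not apply. The limit [l] is fixed by the norm, by uniqueness of limits, and this is equivalent
    to [0 <= l]. *)
Lemma cvg_ge0 (T : Type) (K : numFieldType) (F : set_system T) {FF : ProperFilter F}
    (f : T -> K^o) (l : K^o) :
  (\forall t \near F, 0 <= f t) -> f @ F --> l -> 0 <= l.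
Proof.
move=> f0 fl; have fl' : (fun t => `|f t|) @ F --> (`|l| : K^o) by exact: cvg_norm.
apply/normr_idP; apply: (@norm_cvg_unique K K^o (f @ F)) => //.
apply: cvg_trans fl'; apply: near_eq_cvg; near=> t; rewrite ger0_norm//.
by near: t.
Unshelve. all: by end_near. Qed.

Lemma has_sum_ge0 (I : choiceType) (K : numFieldType) (x : I -> K^o) (s : K^o) :
  (forall i, 0 <= x i) -> has_sum x s -> 0 <= s.
Proof.
move=> x0; apply: cvg_ge0; near=> A.
by rewrite partial_sumE; apply: sumr_ge0 => i _; exact: x0.
Unshelve. all: by end_near. Qed.

Lemma has_sum_le (I : choiceType) (K : numFieldType) (x y : I -> K^o) (s t : K^o) :
  (forall i, x i <= y i) -> has_sum x s -> has_sum y t -> s <= t.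
Proof.
move=> xy hx hy; rewrite -subr_ge0; apply: has_sum_ge0 (has_sumB hy hx) => i.
by rewrite subr_ge0.
Qed.

Lemma has_sum_tail (I : choiceType) (K : numFieldType) (E : normedModType K)
    (x : I -> E) (s : E) (A : {fset I}) :
  has_sum x s -> has_sum (fun i => if i \in A then 0 else x i) (s - \sum_(i <- A) x i).
Proof.
move=> h.
have h' := @has_sum_finite I K E (fun i => if i \in A then x i else 0) A.
have {}h' : has_sum (fun i => if i \in A then x i else 0) (\sum_(i <- A) x i).
  rewrite (_ : \sum_(i <- A) _ = \sum_(i <- A) (if i \in A then x i else 0)).
    by apply: h' => i /negPf ->.
  by apply: eq_big_seq => i ->.
apply: eq_has_sum (has_sumB h h') => i /=.
by case: ifP; rewrite ?subrr ?subr0.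
Qed.

Lemma has_sum_norm_le (I : choiceType) (K : numFieldType) (E : normedModType K)
    (x : I -> E) (y : I -> K^o) (s : E) (t : K^o) :
  (forall i, `|x i| <= y i) -> has_sum x s -> has_sum y t -> `|s| <= t.
Proof.
move=> xy hx hy; rewrite -[s]subr0; apply: (has_sum_le_dist hx); exists fset0 => B _.
rewrite subr0.
apply: (le_trans (ler_norm_sum _ _ _)).
apply: (le_trans (ler_sum _ (fun i _ => xy i))).
rewrite -subr_ge0; apply: (has_sum_ge0 _ (has_sum_tail (A := B) hy)) => i.
by case: ifP => // _; apply: le_trans (xy i).
Qed.

(** A partial sum of [g] over [B] is a limit of sums of [f] over rectangles with base [B]; once the
    rectangle contains the finite set [A] given by the summability of [f], its sum is within [e / 2]
    of [s]. *)
Lemma has_sum_fubini (I J : choiceType) (K : numFieldType) (E : normedModType K)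
    (f : I * J -> E) (g : I -> E) (s : E) :
  has_sum f s -> (forall i, has_sum (fun j => f (i, j)) (g i)) -> has_sum g s.
Proof.
move=> /has_sumP hf hg; apply/has_sumP => e e0.
have e20 : 0 < e / 2 by rewrite divr_gt0.
have [A hA] := hf _ e20.
exists [fset p.1 | p in A]%fset => B AB.
have hs : has_sum (fun j => \sum_(i <- B) f (i, j)) (\sum_(i <- B) g i).
  by apply: has_sum_sum => i; exact: hg.
apply: (@le_lt_trans _ _ (e / 2)); last by rewrite ltr_pdivrMr// mulr_natr mulr2n ltrDl.
rewrite distrC; apply: (has_sum_le_dist hs).
exists [fset p.2 | p in A]%fset => C AC.
rewrite exchange_big /= pair_big_dep_cond.
set P := Imfset.imfset2 _ _ _ _.
rewrite (eq_bigr f) => [|[i j] _ //]; rewrite distrC ltW// hA//.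
apply/fsubsetP => -[i j] pA; apply/imfset2P; exists i.
  by rewrite !inE andbT; apply: (fsubsetP AB); apply/imfsetP; exists (i, j).
exists j => //.
by rewrite !inE andbT; apply: (fsubsetP AC); apply/imfsetP; exists (i, j).
Qed.

Lemma has_sum_swap (I J : choiceType) (K : numFieldType) (E : normedModType K)
    (f : I * J -> E) (s : E) :
  has_sum f s -> has_sum (fun p : J * I => f (p.2, p.1)) s.
Proof.
move=> h; apply/(has_sum_reindex (g := fun p : J * I => (p.2, p.1)) (x := f)) => //.
  by move=> [a b] [c d] [-> ->].
by move=> [i j] _; exists (j, i).
Qed.

(** Cauchy criterion: two partial sums of [x] over supersets of [A] differ from the one over [A] by
    at most the tail of [y] outside [A]. *)
Lemma has_sum_dominated (I : choiceType) (K : numFieldType)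
    (E : completeNormedModType K) (x : I -> E) (y : I -> K^o) (t : K^o) :
  (forall i, `|x i| <= y i) -> has_sum y t -> exists s, has_sum x s.
Proof.
move=> xy hy; apply/cvg_ex/cauchy_cvgP/cauchy_ballP => e e0.
have e20 : 0 < e / 2 by rewrite divr_gt0.
have [A hA] := (has_sumP _ _).1 hy _ e20.
have key B : (A `<=` B)%fset -> `|partial_sum x A - partial_sum x B| < e / 2.
  move=> AB; apply: le_lt_trans (hA A (fsubset_refl _)).
  rewrite !partial_sumE.
  have hB := has_sum_finite (x := fun i => if i \in B then x i else 0) (A := B).
  have {}hB : has_sum (fun i => if i \in B then x i else 0) (\sum_(i <- B) x i).
    rewrite (_ : \sum_(i <- B) _ = \sum_(i <- B) (if i \in B then x i else 0)).
      by apply: hB => i /negPf ->.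
    by apply: eq_big_seq => i ->.
  have hy' := has_sum_tail (A := A) hy.
  have hx' := has_sum_tail (A := A) hB.
  rewrite distrC ger0_norm; last first.
    apply: has_sum_ge0 hy' => i; case: ifP => // _; exact: le_trans (xy i).
  rewrite (_ : \sum_(i <- A) x i = \sum_(i <- A) (if i \in B then x i else 0)).
    apply: has_sum_norm_le hx' hy' => i.
    case: ifP; first by rewrite normr0.
    case: ifP => // _ _; rewrite normr0; exact: le_trans (xy i).
  by apply: eq_big_seq => i /(fsubsetP AB) ->.
exists (partial_sum x @` [set B | (A `<=` B)%fset], partial_sum x @` [set B | (A `<=` B)%fset]).
  by split; exists A => // B AB /=; exists B.
move=> [_ _] [[B AB <-] [C AC <-]] /=; rewrite -ball_normE /=.
rewrite -(subrK (partial_sum x A) (partial_sum x B)) -addrA [e]splitr.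
apply: (le_lt_trans (ler_normD _ _)); apply: ltrD; last exact: key.
by rewrite distrC; exact: key.
Qed.

Lemma cvg_finite_sum (I : Type) (K : numFieldType) (E : normedModType K)
    (T : Type) (F : set_system T) {FF : Filter F} (r : seq I)
    (f : T -> I -> E) (g : I -> E) :
  (forall i, (fun n => f n i) @ F --> g i) ->
  (fun n => \sum_(i <- r) f n i) @ F --> \sum_(i <- r) g i.
Proof.
move=> fg; elim: r => [|i r ih].
  rewrite big_nil (_ : (fun n => _) = fun=> 0); first exact: cvg_cst.
  by apply/funext => n; rewrite big_nil.
rewrite big_cons (_ : (fun n => _) = fun n => f n i + \sum_(j <- r) f n j).
  exact: cvgD (fg i) ih.
by apply/funext => n; rewrite big_cons.
Qed.

(** Dominated convergence for series. The tails of all [f n] and of [g] outside one finite set [A]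
    are bounded by the tail of [y], and on [A] there are only finitely many limits. *)
Lemma dominated_cvg_has_sum (I : choiceType) (K : numFieldType) (E : normedModType K)
    (T : Type) (F : set_system T) {FF : ProperFilter F}
    (f : T -> I -> E) (g : I -> E) (y : I -> K^o) (s : T -> E) (s' : E) (t : K^o) :
  has_sum y t -> (\forall n \near F, forall i, `|f n i| <= y i) ->
  (forall i, (fun n => f n i) @ F --> g i) ->
  (\forall n \near F, has_sum (f n) (s n)) -> has_sum g s' -> s @ F --> s'.
Proof.
move=> hy fy fg hs hg.
have gy i : `|g i| <= y i.
  rewrite -subr_ge0; apply: (@cvg_ge0 _ K F FF (fun n => y i - `|f n i|)).
    by near=> n; rewrite subr_ge0; near: n; apply: filterS fy => n; exact.
  have h1 : (fun _ : T => y i) @ F --> (y i : K^o) by exact: cvg_cst.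
  have h2 := @cvg_norm _ _ _ F _ _ _ (fg i).
  exact: cvgB h1 (h2 _).
apply/cvgrPdist_lt => e e0.
have e30 : 0 < e / 3%:R by rewrite divr_gt0.
have [A hA] := (has_sumP _ _).1 hy _ e30.
have tail (h : I -> E) r : (forall i, `|h i| <= y i) -> has_sum h r ->
    `|r - \sum_(i <- A) h i| < e / 3%:R.
  move=> hhy hh; apply: le_lt_trans (hA A (fsubset_refl _)).
  have hy' := has_sum_tail (A := A) hy.
  rewrite [leRHS]ger0_norm; last first.
    apply: has_sum_ge0 hy' => i; case: ifP => // _; exact: le_trans (hhy i).
  apply: has_sum_norm_le (has_sum_tail (A := A) hh) hy' => i.
  by case: ifP => // _; rewrite normr0.
have cA : (fun n => \sum_(i <- A) f n i) @ F --> \sum_(i <- A) g i.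
  by apply: cvg_finite_sum.
near=> n.
have -> : s' - s n = (s' - \sum_(i <- A) g i) + (\sum_(i <- A) g i - \sum_(i <- A) f n i)
   + (\sum_(i <- A) f n i - s n) by rewrite !addrA !subrK.
have -> : e = e / 3%:R + e / 3%:R + e / 3%:R by field.
apply: (le_lt_trans (ler_normD _ _)); apply: ltrD; last first.
  by rewrite distrC; apply: tail; near: n.
apply: (le_lt_trans (ler_normD _ _)); apply: ltrD; first exact: tail.
near: n; by move/cvgrPdist_lt: cA; apply.
Unshelve. all: by end_near. Qed.

Lemma has_sum_nat (K : numFieldType) (E : normedModType K) (x : nat -> E) (s : E) :
  has_sum x s -> series x @ \oo --> s.
Proof.
move=> /has_sumP h; apply/cvgrPdist_lt => e /h[A hA].
(* The sum of the elements of [A] is an upper bound of each of them. *)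
exists (\sum_(i <- A) i).+1 => // n /= An.
have -> : series x n = \sum_(i <- [fset i | i in iota 0 n]%fset) x i.
  rewrite /series /= big_imfset//= /index_iota subn0.
  by rewrite undup_id ?iota_uniq.
apply: hA; apply/fsubsetP => i iA; apply/imfsetP; exists i => //=.
rewrite mem_iota /= add0n; apply: leq_trans An; rewrite ltnS.
by rewrite (big_fsetD1 i)//= leq_addr.
Qed.

(** * Families of non-negative reals *)

Section real_sums.
Context {R : realType}.

Lemma has_sum_bounded (I : choiceType) (x : I -> R^o) (M : R) :
  (forall i, 0 <= x i) -> (forall A : {fset I}, \sum_(i <- A) x i <= M) ->
  exists s : R, has_sum x s /\ s <= M.
Proof.
move=> x0 xM.
pose S := [set \sum_(i <- A) x i | A in [set: {fset I}]].
have Ssup : has_sup S.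
  split; first by exists (\sum_(i <- fset0) x i); exists fset0.
  by exists M => _ [A _ <-].
exists (sup S); split; last by apply: ge_sup; [exact: Ssup.1|move=> _ [A _ <-]].
apply/has_sumP => e e0; have [_ [A _ <-] hA] := sup_adherent e0 Ssup.
exists A => B AB; rewrite ger0_norm; last first.
  by rewrite subr_ge0; apply: ub_le_sup; [exact: Ssup.2|exists B].
rewrite ltrBlDl -ltrBlDr; apply: (lt_le_trans hA).
have := has_sum_tail (A := A) (has_sum_finite (x := fun i => if i \in B then x i else 0) (A := B) _).
move=> /(_ (fun i (h : i \notin B) => ifN _ _ h))/has_sum_ge0.
rewrite subr_ge0 (eq_big_seq x); last by move=> i /(fsubsetP AB) ->.
rewrite [X in _ -> _ <= X](eq_big_seq (fun i => if i \in B then x i else 0)); last by move=> i ->.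
by apply=> i; case: ifP => // _; case: ifP.
Qed.

(** Every finite set of pairs lies in a rectangle, whose sum is at most [s]; so [f] has some sum,
    and [has_sum_fubini] identifies it with [s]. *)
Lemma has_sum_tonelli (I J : choiceType) (f : I * J -> R^o) (g : I -> R^o) (s : R^o) :
  (forall p, 0 <= f p) -> (forall i, has_sum (fun j => f (i, j)) (g i)) ->
  has_sum g s -> has_sum f s.
Proof.
move=> f0 fg gs.
have [t [ft _]] : exists t : R, has_sum f t /\ t <= s.
  apply: has_sum_bounded => // A.
  pose B := [fset p.1 | p in A]%fset; pose C := [fset p.2 | p in A]%fset.
  have h : \sum_(i <- B) \sum_(j <- C) f (i, j) <= s.
    apply: (@le_trans _ _ (\sum_(i <- B) g i)).
      apply: ler_sum => i _; rewrite -subr_ge0.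
      by apply: has_sum_ge0 (has_sum_tail (A := C) (fg i)) => j; case: ifP.
    rewrite -subr_ge0; apply: has_sum_ge0 (has_sum_tail (A := B) gs) => i.
    by case: ifP => // _; apply: has_sum_ge0 (fg i).
  apply: le_trans h; rewrite pair_big_dep_cond /=.
  set P := Imfset.imfset2 _ _ _ _; rewrite (eq_bigr f) => [|[i j] _ //].
  have AP : (A `<=` P)%fset.
    apply/fsubsetP => -[i j] pA; apply/imfset2P; exists i.
      by rewrite !inE andbT; apply/imfsetP; exists (i, j).
    exists j => //.
    by rewrite !inE andbT; apply/imfsetP; exists (i, j).
  rewrite (big_fsetID _ (mem A) P) /=.
  rewrite [X in _ <= X + _](_ : _ = \sum_(i <- A) f i) ?lerDl ?sumr_ge0//.
  have -> : [fset p | p in P & p \in A]%fset = A.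
    apply/fsetP => p; rewrite !inE /= andbC.
    case: (boolP (p \in A)) => //= pA; move: (fsubsetP AP _ pA).
    by rewrite !inE.
  by apply: eq_bigr => -[].
by rewrite (has_sum_unique gs (has_sum_fubini ft fg)).
Qed.

Lemma has_sum_series (x : nat -> R^o) (s : R) :
  (forall i, 0 <= x i) -> series x @ \oo --> s -> has_sum x s.
Proof.
move=> x0 xs.
have nd : nondecreasing_seq (series x).
  by apply: nondecreasing_series => i _ _; exact: x0.
have [t [ht _]] : exists t : R, has_sum x t /\ t <= s.
  apply: has_sum_bounded => // A.
  pose n := (\sum_(i <- A) i).+1.
  have An i : i \in A -> (i < n)%N by move=> iA; rewrite ltnS (big_fsetD1 i)//= leq_addr.
  clearbody n; have <- : limn (series x) = s by exact/cvg_lim.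
  apply: le_trans (nondecreasing_cvgn_le nd _ n); last by apply/cvg_ex; exists s.
  rewrite /series /= /index_iota subn0.
  rewrite -[X in _ <= \sum_(i <- X) _](undup_id (iota_uniq 0 n)).
  have -> : \sum_(i <- undup (iota 0 n)) x i = \sum_(i <- [fset i | i in iota 0 n]%fset) x i.
    by rewrite big_imfset.
  rewrite (big_fsetID _ (mem A) [fset i | i in iota 0 n]%fset) /=.
  rewrite [X in _ <= X + _](_ : _ = \sum_(i <- A) x i) ?lerDl ?sumr_ge0//.
  suff -> : [fset i | i in [fset i | i in iota 0 n] & i \in A]%fset = A by [].
  apply/fsetP => i; rewrite !inE /= mem_iota add0n /= andbC.
  by case: (boolP (i \in A)) => //= /An ->.
by have -> : s = t by apply: norm_cvg_unique xs (has_sum_nat ht).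
Qed.

Lemma has_sum_geometric (t : R) : 0 <= t < 1 ->
  has_sum (fun k => t ^+ k : R^o) (1 - t)^-1.
Proof.
move=> /andP[t0 t1]; apply: has_sum_series => [i|]; first exact: exprn_ge0.
have := @cvg_geometric_series R 1 t; rewrite ger0_norm// mul1r => /(_ t1).
by rewrite (_ : geometric 1 t = fun k => t ^+ k)//; apply/funext => k /=; rewrite mul1r.
Qed.

Lemma has_sum_real_complex (I : choiceType) (x : I -> R^o) (s : R) :
  has_sum (fun i => (x i)%:C : R[i]^o) (s%:C : R[i]^o) <-> has_sum x s.
Proof.
have eqn (A : {fset I}) : `|s%:C - \sum_(i <- A) (x i)%:C| = `|s - \sum_(i <- A) x i|%:C.
  by rewrite -rmorph_sum -rmorphB normc_def /= expr0n addr0 sqrtr_sqr.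
split=> /has_sumP h; apply/has_sumP => e e0.
  have [|A hA] := h e%:C; first by rewrite ltcR.
  by exists A => B /hA; rewrite eqn ltcR.
have [|A hA] := h (complex.Re e); first by move: e0; rewrite ltcE => /andP[].
exists A => B /hA; rewrite eqn -ltcR => /lt_le_trans; apply.
by rewrite RRe_real// gtr0_real.
Qed.

End real_sums.

(** * Completeness of the complex field *)

Section complex_complete.
Context {R : realType}.

Lemma norm_real_complex (a : R) : `|a%:C| = `|a|%:C.
Proof. by rewrite normc_def /= expr0n addr0 sqrtr_sqr. Qed.

Lemma normc_ge_Im (z : R[i]) : `|complex.Im z|%:C <= `|z|.
Proof.
rewrite normc_def lecR -sqrtr_sqr ler_sqrt ?addr_ge0 ?sqr_ge0//.
by rewrite lerDr sqr_ge0.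
Qed.

Lemma normc_le_ReIm (z : R[i]) : `|z| <= (`|complex.Re z| + `|complex.Im z|)%:C.
Proof.
case: z => a b /=; rewrite -[Complex a b]/(a +i* b).
have -> : a +i* b = a%:C + 'i * b%:C by rewrite {1}(complexE (a +i* b)).
rewrite (le_trans (ler_normD _ _))// normrM rmorphD /= !norm_real_complex.
by rewrite (normc_def 'i) /= expr0n add0r expr1n sqrtr1 mul1r.
Qed.

Lemma complex_cauchy_cvg (F : set_system R[i]^o) : ProperFilter F ->
  cauchy F -> cvg F.
Proof.
move=> FF /cauchy_ballP Fc.
have image (f : R[i]^o -> R^o) : (forall x y, f (x - y) = f x - f y) ->
    (forall z, `|f z|%:C <= `|z|) -> cvg (f @ F).
  move=> fB fz; apply/cauchy_cvgP/cauchy_ballP => e e0.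
  have e0C : 0 < (e%:C : R[i]) by rewrite ltcR.
  have [[A B] [FA FB] AB] := Fc _ e0C.
  exists (f @` A, f @` B).
    by split => /=; [move: FA|move: FB]; apply: filterS => x xA; exists x.
  move=> [_ _] [[x xA <-] [y yB <-]] /=.
  have /= := AB (x, y) (conj xA yB); rewrite -!ball_normE /= => h.
  by rewrite -ltcR; apply: le_lt_trans h; rewrite -fB.
have /cvg_ex[a ha] := image (@complex.Re R) (raddfB _) (@normc_ge_Re R).
have /cvg_ex[b hb] := image (@complex.Im R) (raddfB _) normc_ge_Im.
apply/cvg_ex; exists (a +i* b); apply/cvgrPdist_lt => e e0.
have eR : e = (complex.Re e)%:C by rewrite RRe_real// gtr0_real.
have e20 : 0 < complex.Re e / 2 by rewrite divr_gt0// -ltcR -eR.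
near=> z; apply: (le_lt_trans (normc_le_ReIm _)); rewrite eR ltcR !raddfB /=.
rewrite [ltRHS]splitr; apply: ltrD; near: z.
  by move/cvgrPdist_lt: ha; apply.
by move/cvgrPdist_lt: hb; apply.
Unshelve. all: by end_near. Qed.

End complex_complete.

(* [R[i]^o] itself cannot be given this structure: the instances on [R^o] for
   [R : realType] already use the key [GRing.regular]. *)
Definition complex_field (R : realType) : Type := R[i]^o.

HB.instance Definition _ (R : realType) :=
  NormedModule.copy (complex_field R) R[i]^o.
HB.instance Definition _ (R : realType) :=
  Uniform_isComplete.Build (complex_field R) (@complex_cauchy_cvg R).

Lemma complex_has_sum_dominated (R : realType) (I : choiceType)
    (x y : I -> R[i]^o) (t : R[i]^o) :
  (forall i, `|x i| <= y i) -> has_sum y t -> exists s : R[i]^o, has_sum x s.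
Proof. exact: (@has_sum_dominated I R[i] (complex_field R)). Qed.

(** * Sums over multi-indices *)

Section esum_has_sum.
Context {R : realType} {I : choiceType}.

Lemma esum_lty_has_sum (x : I -> R) : (forall i, 0 <= x i) ->
  (\esum_(i in [set: I]) (x i)%:E < +oo)%E <-> exists s : R, has_sum (x : I -> R^o) s.
Proof.
move=> x0.
have fsE (A : {fset I}) : (\sum_(i \in [set` A]) (x i)%:E = (\sum_(i <- A) x i)%:E)%E.
  by rewrite fsbig_finite//= set_fsetK sumEFin.
split=> [xoo|[s xs]].
  have xfin : \esum_(i in [set: I]) (x i)%:E \is a fin_num.
    by rewrite ge0_fin_numE// esum_ge0// => i _; rewrite lee_fin.
  have [//||s [xs _]] := @has_sum_bounded R I x (fine (\esum_(i in [set: I]) (x i)%:E)).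
    move=> A; rewrite -lee_fin fineK// -fsE; apply: ereal_sup_ubound.
    by exists [set` A] => //; split => //; exact: finite_fset.
  by exists s.
apply: (@le_lt_trans _ _ s%:E); last exact: ltry.
apply: ge_ereal_sup => _ [A [finA _] <-].
rewrite -(fset_setK finA) fsE lee_fin -subr_ge0.
by apply: has_sum_ge0 (has_sum_tail (A := fset_set A) xs) => i; case: ifP.
Qed.

End esum_has_sum.

Section multi_index.

Definition mcons (n : nat) (m : nat) (al : mindex n) : mindex n.+1 :=
  [ffun i => if unlift ord0 i is Some j then al j else m].

Lemma mcons_ord0 n m (al : mindex n) : mcons m al ord0 = m.
Proof. by rewrite ffunE unlift_none. Qed.

Lemma mcons_lift n m (al : mindex n) i : mcons m al (lift ord0 i) = al i.
Proof. by rewrite ffunE liftK. Qed.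

Lemma mcons_eta n (al : mindex n.+1) : mcons (al ord0) [ffun j => al (lift ord0 j)] = al.
Proof.
by apply/ffunP => i; rewrite ffunE; case: unliftP => [j ->|->//]; rewrite ffunE.
Qed.

Lemma has_sum_mcons (K : numFieldType) (E : normedModType K) (n : nat)
    (x : mindex n.+1 -> E) (s : E) :
  has_sum (fun p : nat * mindex n => x (mcons p.1 p.2)) s <-> has_sum x s.
Proof.
apply: (has_sum_reindex (g := fun p : nat * mindex n => mcons p.1 p.2) (x := x)).
  move=> [m al] [m' al'] /= e; congr (_, _).
    by rewrite -(mcons_ord0 m al) e mcons_ord0.
  by apply/ffunP => i; rewrite -(mcons_lift m) e mcons_lift.
move=> al _; exists (al ord0, [ffun j => al (lift ord0 j)]); apply/ffunP => i /=.
by rewrite ffunE; case: unliftP => [j ->|->//]; rewrite ffunE.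
Qed.

Lemma mindex0P (al be : mindex 0) : al = be.
Proof. by apply/ffunP => -[]. Qed.

Lemma has_sum_mindex0 (K : numFieldType) (E : normedModType K)
    (x : mindex 0 -> E) (al : mindex 0) : has_sum x (x al).
Proof.
rewrite [X in has_sum X](_ : x = fun be => if be == al then x al else 0).
  exact: has_sum1.
by apply/funext => be; rewrite (mindex0P be al) eqxx.
Qed.

Lemma has_sum_prod_ge0 (R : realType) (n : nat) (u : 'I_n -> nat -> R^o)
    (s : 'I_n -> R) :
  (forall i m, 0 <= u i m) -> (forall i, has_sum (u i) (s i)) ->
  has_sum (fun al : mindex n => \prod_(i < n) u i (al i) : R^o) (\prod_(i < n) s i).
Proof.
elim: n u s => [|n ih] u s u0 us.
  rewrite big_ord0; have -> : (fun al : mindex 0 => \prod_(i < 0) u i (al i)) = fun=> 1 : R^o.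
    by apply/funext => al; rewrite big_ord0.
  exact: (@has_sum_mindex0 R R^o (fun=> 1) [ffun=> 0%N]).
apply/has_sum_mcons/(has_sum_tonelli (g := fun m => u ord0 m * \prod_(i < n) s (lift ord0 i))).
- by move=> p; apply: prodr_ge0 => i _; exact: u0.
- move=> m /=; have := ih _ _ (fun i => u0 (lift ord0 i)) (fun i => us (lift ord0 i)).
  move=> /(has_sumZ (a := u ord0 m)); apply: eq_has_sum => al.
  rewrite big_ord_recl mcons_ord0; congr (_ * _).
  by apply: eq_bigr => i _; rewrite mcons_lift.
rewrite big_ord_recl mulrC.
by move: (has_sumZ (a := \prod_(i < n) s (lift ord0 i)) (us ord0)); apply: eq_has_sum => m; rewrite mulrC.
Qed.

Lemma has_sum_prod (R : realType) (n : nat) (u : 'I_n -> nat -> R[i]^o)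
    (s : 'I_n -> R[i]^o) (y : 'I_n -> nat -> R^o) (t : 'I_n -> R) :
  (forall i m, `|u i m| <= (y i m)%:C) -> (forall i, has_sum (y i) (t i)) ->
  (forall i, has_sum (u i) (s i)) ->
  has_sum (fun al : mindex n => \prod_(i < n) u i (al i) : R[i]^o) (\prod_(i < n) s i).
Proof.
elim: n u s y t => [|n ih] u s y t uy yt us.
  rewrite big_ord0; have -> : (fun al : mindex 0 => \prod_(i < 0) u i (al i)) = fun=> 1 : R[i]^o.
    by apply/funext => al; rewrite big_ord0.
  exact: (@has_sum_mindex0 R[i] R[i]^o (fun=> 1) [ffun=> 0%N]).
have y0 i m : 0 <= y i m by rewrite -lecR; exact: le_trans (normr_ge0 _) (uy i m).
(* Domination by the product of the [y i] gives the existence of the sum; its value then follows by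
   summing out all variables but the first. *)
have [S hS] : exists S : R[i]^o,
    has_sum (fun al : mindex n.+1 => \prod_(i < n.+1) u i (al i) : R[i]^o) S.
  apply: (complex_has_sum_dominated
    (y := fun al : mindex n.+1 => (\prod_(i < n.+1) y i (al i))%:C : R[i]^o)).
    by move=> al; rewrite normr_prod rmorph_prod; apply: ler_prod => i _; rewrite normr_ge0 uy.
  apply/has_sum_real_complex; exact: has_sum_prod_ge0 yt.
suff -> : \prod_(i < n.+1) s i = S by [].
have := has_sum_fubini ((has_sum_mcons _ _).2 hS).
move=> /(_ (fun m => u ord0 m * \prod_(i < n) s (lift ord0 i))) h.
apply: (@has_sum_unique _ _ _ _ _ S _ (h _)).
  rewrite big_ord_recl mulrC.
  by move: (has_sumZ (a := \prod_(i < n) s (lift ord0 i)) (us ord0)); apply: eq_has_sum => m; rewrite mulrC.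
move=> m /=.
have := ih _ _ _ _ (fun i => uy (lift ord0 i)) (fun i => yt (lift ord0 i)) (fun i => us (lift ord0 i)).
move=> /(has_sumZ (a := u ord0 m)); apply: eq_has_sum => al.
rewrite big_ord_recl mcons_ord0; congr (_ * _).
by apply: eq_bigr => i _; rewrite mcons_lift.
Qed.

End multi_index.

(** * Cauchy products *)

Section convolution.

Definition conv (K : pzSemiRingType) (u v : nat -> K) (N : nat) : K :=
  \sum_(m < N.+1) u (N - m)%N * v m.

Lemma has_sum_ord (K : numFieldType) (E : normedModType K) (x : nat -> E) N :
  (forall m, (N <= m)%N -> x m = 0) -> has_sum x (\sum_(m < N) x m).
Proof.
move=> x0.
have -> : \sum_(m < N) x m = \sum_(m <- [fset i | i in iota 0 N]%fset) x m.
  by rewrite big_imfset//= -(big_mkord predT x) /index_iota subn0 undup_id ?iota_uniq.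
apply: has_sum_finite => m; rewrite in_fset /= mem_iota add0n /= -leqNgt; exact: x0.
Qed.

Lemma has_sum_diagonal (K : numFieldType) (E : normedModType K)
    (F : nat * nat -> E) (s : E) :
  has_sum F s -> has_sum (fun N => \sum_(m < N.+1) F ((N - m)%N, nat_of_ord m)) s.
Proof.
move=> Fs.
(* [G] is [F] in the coordinates [(j + m, m)], extended by 0; its rows are the antidiagonals of
   [F]. *)
pose G (p : nat * nat) := if (p.2 <= p.1)%N then F ((p.1 - p.2)%N, p.2) else 0.
have : has_sum G s.
  apply/(has_sum_reindex (g := fun p => ((p.1 + p.2)%N, p.2)) (x := G)); last first.
  - by apply: eq_has_sum Fs => -[j m]; rewrite /G /= leq_addl addnK.
  - move=> [N m]; rewrite /G /=; case: ifP => [mN _|]; last by rewrite eqxx.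
    by exists ((N - m)%N, m) => /=; rewrite subnK.
  - by move=> [j m] [j' m'] /= [/[swap] -> /eqP]; rewrite eqn_add2r => /eqP ->.
move=> hG; apply: (has_sum_fubini hG) => N.
have := @has_sum_ord K E (fun m => G (N, m)) N.+1.
rewrite (eq_bigr (fun m : 'I_N.+1 => F ((N - m)%N, nat_of_ord m))).
  by apply => m Nm; rewrite /G /= leqNgt Nm.
by move=> m _; rewrite /G /= -ltnS ltn_ord.
Qed.

End convolution.

(** * Defects in one and several variables *)

Lemma has_sum_ge_term (I : choiceType) (K : numFieldType) (x : I -> K^o) (s : K^o) (A : {fset I}) :
  (forall i, 0 <= x i) -> has_sum x s -> \sum_(i <- A) x i <= s.
Proof.
move=> x0 /(has_sum_tail (A := A)) h; rewrite -subr_ge0.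
by apply: has_sum_ge0 h => i; case: ifP.
Qed.

Lemma cvg_exp (R : realType) (u : nat -> R^o) (l : R^o) m :
  u @ \oo --> l -> (fun n => u n ^+ m : R^o) @ \oo --> (l ^+ m : R^o).
Proof.
move=> ul; elim: m => [|m ih]; first by under eq_fun do rewrite expr0; exact: cvg_cst.
by under eq_fun do rewrite exprS; rewrite exprS; exact: cvgM.
Qed.

Section shift_action.
Context {R : realType} {X : Type} (sigma : X -> X).
Implicit Types (u v : nat -> R) (q B : X -> R).

Definition abs_summable u := exists S : R, has_sum (fun m => `|u m| : R^o) S.

(** For [sigma] the adjoint of an operator T and [q] the squared norm, this is the quadratic form of
    the hereditary series with terms u_m T^m sigma^m. *)
Definition act u q (x : X) : R :=
  summability.sum (fun m => u m * q (iter m sigma x) : R^o).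

(** A majorant of [q] that does not increase along orbits bounds all the values [q (iter m sigma x)]
    by [B x], so that every absolutely summable sequence can act on [q]. *)
Definition orbit_bound B q :=
  (forall x, B (sigma x) <= B x) /\ forall x, `|q x| <= B x.

Lemma orbit_bound_iter B q x m : orbit_bound B q -> `|q (iter m sigma x)| <= B x.
Proof.
move=> [Bs qB]; apply: le_trans (qB _) _.
by elim: m => //= m; apply: le_trans.
Qed.

Lemma act_has_sum u q B x : abs_summable u -> orbit_bound B q ->
  has_sum (fun m => u m * q (iter m sigma x) : R^o) (act u q x).
Proof.
move=> [S uS] qB.
have [s hs] : exists s : R^o, has_sum (fun m => u m * q (iter m sigma x) : R^o) s.
  apply: (has_sum_dominated (y := fun m => B x * `|u m| : R^o) (t := B x * S)).
    by move=> m; rewrite normrM mulrC ler_wpM2r// (orbit_bound_iter _ _ qB).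
  exact: has_sumZ uS.
by rewrite /act (has_sumE hs).
Qed.

Lemma act_orbit_bound u q B S : has_sum (fun m => `|u m| : R^o) S ->
  orbit_bound B q -> orbit_bound (fun x => B x * S) (act u q).
Proof.
move=> uS qB.
have S0 : 0 <= S by apply: has_sum_ge0 uS.
split=> [x|x]; first by rewrite ler_wpM2r// qB.1.
have h := act_has_sum (x := x) (ex_intro _ S uS) qB.
apply: (has_sum_norm_le _ h (has_sumZ (a := B x) uS)) => m.
by rewrite normrM mulrC ler_wpM2r// (orbit_bound_iter _ _ qB).
Qed.

Lemma has_sum_mul u v (s t : R) : (forall m, 0 <= u m) -> (forall m, 0 <= v m) ->
  has_sum (u : nat -> R^o) s -> has_sum (v : nat -> R^o) t ->
  has_sum (fun p : nat * nat => u p.1 * v p.2 : R^o) (s * t).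
Proof.
move=> u0 v0 us vt; apply: (has_sum_tonelli (g := fun j => u j * t)).
- by move=> p; rewrite mulr_ge0.
- by move=> j /=; exact: has_sumZ vt.
- by rewrite mulrC; move: (has_sumZ (a := t) us); apply: eq_has_sum => j; rewrite mulrC.
Qed.

Lemma abs_summable_conv u v : abs_summable u -> abs_summable v ->
  abs_summable (conv u v).
Proof.
move=> [s us] [t vt].
have := has_sum_diagonal (has_sum_mul (fun m => normr_ge0 _) (fun m => normr_ge0 _) us vt).
move=> h; apply: (has_sum_dominated _ h) => N; rewrite normr_id /conv.
apply: le_trans (ler_norm_sum _ _ _) _.
by apply: ler_sum => m _; rewrite normrM.
Qed.

(** Actions compose as power series multiply: both sides sum the double family [F], once by rows and
    once by antidiagonals. *)
Lemma act_act u v q B x : abs_summable u -> abs_summable v -> orbit_bound B q ->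
  act u (act v q) x = act (conv u v) q x.
Proof.
move=> us vs qB; have [S uS] := us; have [t vt] := vs.
pose F (p : nat * nat) : R^o := u p.1 * v p.2 * q (iter (p.1 + p.2) sigma x).
have [s hF] : exists s : R^o, has_sum F s.
  have h := has_sum_mul (fun m => normr_ge0 _) (fun m => normr_ge0 _) uS vt.
  apply: (has_sum_dominated _ (has_sumZ (a := B x) h)) => p.
  by rewrite !normrM mulrC ler_wpM2r ?mulr_ge0// (orbit_bound_iter _ _ qB).
have h1 : has_sum (fun j => u j * act v q (iter j sigma x) : R^o) s.
  apply: (has_sum_fubini hF) => j.
  have := has_sumZ (a := u j) (act_has_sum (x := iter j sigma x) vs qB).
  by apply: eq_has_sum => m; rewrite /F /= addnC iterD -mulrA.
have h2 := has_sum_diagonal hF.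
rewrite /act (has_sumE h1); symmetry; apply: has_sumE; apply: eq_has_sum h2 => N.
rewrite /conv big_distrl; apply: eq_bigr => m _; rewrite /F /= subnK//.
by rewrite -ltnS ltn_ord.
Qed.

End shift_action.

(** * Coefficients of a weight kernel and of its reciprocal *)

Section weight_pairs.
Context {R : realType}.
Implicit Types (k c u v : nat -> R).

(** The coefficients of the dilated series u(r z). *)
Definition scal (r : R) u (m : nat) : R := r ^+ m * u m.

(* [k] are the reciprocals of a weight and [c] the Taylor coefficients of the
   reciprocal of its power series; the last two fields are (P1) and (P2). *)
Record weight_pair k c : Prop := WeightPair {
  pair_gt0 : forall m, 0 < k m;
  pair_k0 : k 0%N = 1;
  pair_summable : forall t, 0 <= t < 1 -> abs_summable (scal t k);
  pair_inv : forall N, conv k c N = (N == 0%N)%:R;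
  pair_bound : exists M, forall m, `|c m| <= M;
  pair_P1 : forall r, 0 < r < 1 -> forall m, 0 <= conv k (scal r c) m;
  pair_P2 : exists M, forall r, 0 < r < 1 -> forall m, `|conv (scal r k) c m| <= M }.

Lemma conv_scal r u v N : conv (scal r u) (scal r v) N = r ^+ N * conv u v N.
Proof.
rewrite /conv big_distrr; apply: eq_bigr => m _.
have mN : (m <= N)%N by rewrite -ltnS.
by rewrite /scal mulrACA -exprD subnK.
Qed.

Lemma convC u v N : conv u v N = conv v u N.
Proof.
rewrite /conv (reindex_inj rev_ord_inj) /=; apply: eq_bigr => m _.
have mN : (m <= N)%N by rewrite -ltnS.
by rewrite subSS subKn// mulrC.
Qed.

Lemma conv_ext u u' v v' N : u =1 u' -> v =1 v' -> conv u v N = conv u' v' N.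
Proof. by move=> e1 e2; apply: eq_bigr => m _; rewrite e1 e2. Qed.

Lemma scal_scal r s u : scal r (scal s u) =1 scal (r * s) u.
Proof. by move=> m; rewrite /scal mulrA exprMn. Qed.

Lemma scal_bounded_summable r c M : 0 <= r < 1 -> (forall m, `|c m| <= M) ->
  abs_summable (scal r c).
Proof.
move=> r01 cM; have /andP[r0 _] := r01.
apply: (has_sum_dominated _ (has_sumZ (a := M) (has_sum_geometric r01))) => m.
by rewrite normr_id normrM normrX (ger0_norm r0) mulrC ler_wpM2r// exprn_ge0.
Qed.

(** A strictly increasing sequence of radii tending to 1; the shift by 2 keeps the first one
    positive. *)
Definition rseq (N : nat) : R := 1 - N.+2%:R^-1.

Lemma rseq01 N : 0 < rseq N < 1.
Proof.
rewrite /rseq subr_gt0 invf_lt1// ltr1n /= ltrBlDr ltrDl invr_gt0//.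
Qed.

Lemma rseq_itv N : 0 <= rseq N < 1.
Proof. by case/andP: (rseq01 N) => /ltW -> ->. Qed.

Lemma rseq_cvg : rseq @ \oo --> (1 : R^o).
Proof.
rewrite -[X in _ --> X]subr0; apply: cvgB; first exact: cvg_cst.
have := @cvg_harmonic R; rewrite -(cvg_shiftS); exact.
Qed.

Lemma rseqX_cvg m : (fun N => rseq N ^+ m : R^o) @ \oo --> (1 : R^o).
Proof. by rewrite -(expr1n _ m); apply: cvg_exp; exact: rseq_cvg. Qed.

End weight_pairs.

Lemma subr_exchange (R : comRingType) (a b c d : R) : a - b = c - d -> c - a = d - b.
Proof. by move=> e; rewrite -(subrK d c) -e; ring. Qed.

Lemma act_delta (R : realType) (X : Type) (sigma : X -> X) (u : nat -> R) (q : X -> R) x :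
  (forall N, u N = (N == 0%N)%:R) -> act sigma u q x = q x.
Proof.
move=> u0; apply: has_sumE.
apply: eq_has_sum (@has_sum1 _ R R^o 0%N (q x)) => m /=.
by rewrite u0; case: m => [|m] /=; rewrite ?mul1r ?mul0r.
Qed.

Section one_variable.
Context {R : realType} {X : Type} (sigma : X -> X).
Variables (k c : nat -> R) (q B : X -> R).
Hypothesis kc : weight_pair k c.
Hypothesis qB : orbit_bound sigma B q.
Hypothesis q_dec : forall x, q (sigma x) <= q x.
Hypothesis q_pure : forall x, (fun m => q (iter m sigma x)) @ \oo --> (0 : R^o).
Hypothesis q_defect : forall r x, 0 < r < 1 -> 0 <= act sigma (scal r c) q x.

Local Notation f r := (act sigma (scal r c) q).

Let c_summable r : 0 <= r < 1 -> abs_summable (scal r c).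
Proof. by move=> r01; have [M cM] := pair_bound kc; exact: scal_bounded_summable cM. Qed.

Let k_ge0 m : 0 <= k m. Proof. exact/ltW/(pair_gt0 kc). Qed.

Let c0 : c 0%N = 1.
Proof.
have := pair_inv kc 0.
by rewrite /conv big_ord1 subnn (pair_k0 kc) mul1r.
Qed.

Let fB r : 0 <= r < 1 -> exists B', orbit_bound sigma B' (f r).
Proof.
move=> r01; have [S hS] := c_summable r01.
by exists (fun x => B x * S); exact: act_orbit_bound.
Qed.

(** The dilates of the two mutually inverse series are again inverse, so the action of k_r undoes
    the defect. *)
Let k_f r x : 0 < r < 1 -> act sigma (scal r k) (f r) x = q x.
Proof.
move=> /andP[r0 r1]; have r01 : 0 <= r < 1 by rewrite ltW.
rewrite (act_act _ (pair_summable kc r01) (c_summable r01) qB).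
apply: act_delta => N; rewrite conv_scal (pair_inv kc).
by case: N => [|N]; rewrite ?expr0 ?mul1r ?mulr0.
Qed.

(** By [k_f], [q x] is a sum of non-negative terms whose zeroth one is [f r x]. *)
Let f_le_q r x : 0 < r < 1 -> f r x <= q x.
Proof.
move=> r01; have r01' : 0 <= r < 1 by case/andP: r01 => /ltW -> ->.
have [B' fB'] := fB r01'.
have := act_has_sum (x := x) (pair_summable kc r01') fB'; rewrite k_f//.
move=> /(@has_sum_ge_term _ _ _ _ [fset 0%N]%fset); rewrite big_seq_fset1 /= /scal.
rewrite expr0 mul1r (pair_k0 kc) mul1r; apply=> i.
by rewrite mulr_ge0 ?q_defect// mulr_ge0// exprn_ge0//; case/andP: r01'.
Qed.

(* [f r] is the action on [f s >= 0] of the series [c_r k_s], whose coefficients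
   are non-negative by (P1). *)
Let f_dec r s x : 0 < r -> r < s -> s < 1 -> f s x <= f r x.
Proof.
move=> r0 rs s1; have s0 := lt_trans r0 rs.
have s01 : 0 < s < 1 by rewrite s0.
have r01' : 0 <= r < 1 by rewrite ltW//= (lt_trans rs).
have s01' : 0 <= s < 1 by rewrite ltW.
have [B' fB'] := fB s01'.
have rE y : f r y = act sigma (conv (scal r c) (scal s k)) (f s) y.
  rewrite -(act_act y (c_summable r01') (pair_summable kc s01') fB').
  by have -> : act sigma (scal s k) (f s) = q by apply/funext => z; exact: k_f.
have sum_p := abs_summable_conv (c_summable r01') (pair_summable kc s01').
have := act_has_sum (x := x) sum_p fB'; rewrite -rE.
have pE m : conv (scal r c) (scal s k) m = s ^+ m * conv k (scal (r / s) c) m.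
  rewrite -conv_scal convC; apply: conv_ext => // j.
  by rewrite scal_scal mulrC divfK// gt_eqF.
have rs01 : 0 < r / s < 1 by rewrite divr_gt0//= ltr_pdivrMr// mul1r.
move=> /(@has_sum_ge_term _ _ _ _ [fset 0%N]%fset); rewrite big_seq_fset1 /=.
have -> : conv (scal r c) (scal s k) 0 = 1.
  by rewrite pE expr0 mul1r /conv big_ord1 subnn /scal expr0 mul1r c0 mulr1 (pair_k0 kc).
rewrite mul1r; apply=> i; rewrite mulr_ge0 ?q_defect// pE mulr_ge0 ?exprn_ge0//; first exact: ltW.
exact: (pair_P1 kc).
Qed.

Let fseq_cvg x : cvg ((fun N => f (rseq N) x : R^o) @ \oo).
Proof.
apply: nonincreasing_is_cvgn.
  apply/nonincreasing_seqP => N.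
  have /andP[r0 _] := @rseq01 R N; have /andP[_ s1] := @rseq01 R N.+1.
  apply: f_dec => //.
  by rewrite /rseq ltrD2l ltrN2 ltf_pV2 ?posrE// ltr_nat.
by exists 0 => _ [N _ <-]; exact: q_defect (rseq01 N).
Qed.

Let d x : R := limn (fun N => f (rseq N) x : R^o).

Let d_cvg x : (fun N => f (rseq N) x : R^o) @ \oo --> (d x : R^o).
Proof. exact: fseq_cvg. Qed.

Let d_ge0 x : 0 <= d x.
Proof.
apply: (cvg_ge0 _ (d_cvg (x := x))); apply: nearW => N; exact: q_defect (rseq01 N).
Qed.

Let d_le_q x : d x <= q x.
Proof.
apply: (limr_le (fseq_cvg (x := x))); apply: nearW => N; exact: f_le_q (rseq01 N).
Qed.

Let d_bound : orbit_bound sigma q d.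
Proof. by split=> // x; rewrite ger0_norm. Qed.

(** A Fatou argument: each finite sum is the limit of finite sums with [f (rseq N)] in place of [d],
    and these are at most [q x] by [k_f]. *)
Let Q_exists x : exists s : R, has_sum (fun m => k m * d (iter m sigma x) : R^o) s /\ s <= q x.
Proof.
apply: has_sum_bounded => [m|A]; first by rewrite mulr_ge0.
have hc : (fun N => \sum_(m <- A) scal (rseq N) k m * f (rseq N) (iter m sigma x) : R^o) @ \oo
    --> (\sum_(m <- A) k m * d (iter m sigma x) : R^o).
  apply: cvg_finite_sum => m; apply: cvgM; last exact: d_cvg.
  rewrite -[X in _ --> X]mul1r; apply: cvgM; last exact: cvg_cst.
  exact: rseqX_cvg.
rewrite -(cvg_lim _ hc)//; apply: limr_le; first by apply/cvg_ex; eexists; exact: hc.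
apply: nearW => N; have r01 := @rseq01 R N.
have r01' := @rseq_itv R N.
rewrite -(k_f x r01); have [B' fB'] := fB r01'.
apply: has_sum_ge_term (act_has_sum (x := x) (pair_summable kc r01') fB') => m.
rewrite mulr_ge0 ?q_defect// mulr_ge0// exprn_ge0//; by case/andP: r01'.
Qed.

Let Q x : R := summability.sum (fun m => k m * d (iter m sigma x) : R^o).

Let Q_sum x : has_sum (fun m => k m * d (iter m sigma x) : R^o) (Q x).
Proof. by have [s [hs _]] := Q_exists x; rewrite /Q (has_sumE hs). Qed.

Let Q_le x : Q x <= q x.
Proof. by have [s [hs sq]] := Q_exists x; rewrite /Q (has_sumE hs). Qed.

Let g x := q x - q (sigma x).

Let g_ge0 x : 0 <= g x. Proof. by rewrite subr_ge0. Qed.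

(** The series telescopes, and purity removes the last term. This summable family is the majorant
    that lets the bound of (P2) be used under a limit. *)
Let g_sum x : has_sum (fun m => g (iter m sigma x) : R^o) (q x).
Proof.
apply: has_sum_series => [m|]; first exact: g_ge0.
have -> : series (fun m => g (iter m sigma x)) = fun n => q x - q (iter n sigma x).
  apply/funext => n; rewrite /series /= (eq_bigr (fun m => - (q (iter m.+1 sigma x) - q (iter m sigma x)))).
    by rewrite sumrN telescope_sumr// opprB.
  by move=> m _; rewrite opprB.
rewrite -[X in _ --> X]subr0; apply: cvgB; [exact: cvg_cst|exact: q_pure].
Qed.

(* The action of [k_rho c_s] on the summable [g] tends to that of [k_rho] on
   [d - d \o sigma] as [s -> 1], then to [Q - Q \o sigma] as [rho -> 1]; both limits
   are dominated thanks to (P2), and [k_rho c] tends to [1]. *)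
Let Q_diff x : Q x - Q (sigma x) = g x.
Proof.
have [M eM] := pair_P2 kc.
have M0 : 0 <= M by apply: le_trans (eM (rseq 0) (rseq01 0) 0%N).
have gM := has_sumZ (a := M) (g_sum (x := x)).
pose dQ r := act sigma (scal r k) d x - act sigma (scal r k) d (sigma x).
have approx P : has_sum (fun m => conv (scal (rseq P) k) c m * g (iter m sigma x) : R^o)
    (dQ (rseq P)).
  have r01 := @rseq01 R P; set r := rseq P in r01 *.
  have r01' : 0 <= r < 1 by case/andP: r01 => /ltW -> ->.
  have [s hs] : exists s : R^o, has_sum (fun m => conv (scal r k) c m * g (iter m sigma x) : R^o) s.
    apply: (has_sum_dominated _ gM) => m.
    by rewrite normrM (ger0_norm (g_ge0 _)) ler_wpM2r// eM.
  suff <- : s = dQ r by [].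
  pose dF N : R := act sigma (scal r k) (f (rseq N)) x - act sigma (scal r k) (f (rseq N)) (sigma x).
  have lim1 : dF @ \oo --> (s : R^o).
    apply: (dominated_cvg_has_sum (f := fun N m =>
        conv (scal r k) (scal (rseq N) c) m * g (iter m sigma x)) gM _ _ _ hs).
    (* For [N > P] the ratio [r / rseq N] is below 1. Pulling out the dilation by [rseq N] leaves a
       coefficient of k_(r / rseq N) / k, which (P2) bounds by [M]. *)
    - exists P.+1 => // N /= PN m.
      rewrite normrM (ger0_norm (g_ge0 _)) ler_wpM2r//.
      have /andP[s0 s1] := @rseq01 R N.
      have rsN : r < rseq N by rewrite /r /rseq ltrD2l ltrN2 ltf_pV2 ?posrE// ltr_nat !ltnS.
      have rs01 : 0 < r / rseq N < 1.
        by rewrite divr_gt0//=; [rewrite ltr_pdivrMr// mul1r|case/andP: r01].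
      rewrite (conv_ext _ (u' := scal (rseq N) (scal (r / rseq N) k)) (v' := scal (rseq N) c))//; last first.
        by move=> j; rewrite scal_scal mulrC divfK// gt_eqF.
      rewrite conv_scal normrM -[leRHS]mul1r; apply: ler_pM => //; last exact: eM.
      by rewrite normrX (ger0_norm (ltW s0)) exprn_ile1// ltW.
    - move=> m; apply: cvgM; last exact: cvg_cst.
      apply: cvg_finite_sum => j; apply: cvgM; first exact: cvg_cst.
      rewrite -[X in _ --> X]mul1r; apply: cvgM; last exact: cvg_cst.
      exact: rseqX_cvg.
    - apply: nearW => N; have s01 := @rseq_itv R N.
      have ks := pair_summable kc r01'; have cs := c_summable s01.
      have kcs := abs_summable_conv ks cs.
      rewrite /dF !(act_act _ ks cs qB).
      apply: eq_has_sum (has_sumB (act_has_sum (x := x) kcs qB)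
        (act_has_sum (x := sigma x) kcs qB)) => m.
      by rewrite -mulrBr /g -iterS -iterSr.
  have lim2 : dF @ \oo --> (dQ r : R^o).
    have act_cvg y : (fun N => act sigma (scal r k) (f (rseq N)) y : R^o) @ \oo -->
        (act sigma (scal r k) d y : R^o).
      have [S hS] := pair_summable kc r01'.
      apply: (dominated_cvg_has_sum (f := fun N m => scal r k m * f (rseq N) (iter m sigma y))
        (has_sumZ (a := q y) hS) _ _ _ (act_has_sum (x := y) (pair_summable kc r01') d_bound)).
      - apply: nearW => N m; rewrite normrM mulrC ler_wpM2r//.
        rewrite ger0_norm ?q_defect ?rseq01//.
        apply: le_trans (f_le_q _ (rseq01 N)) _.
        by elim: m => //= m; apply: le_trans.
      - by move=> m; apply: cvgM; [exact: cvg_cst|exact: d_cvg].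
      - apply: nearW => N; have s01 := @rseq_itv R N.
        have [B' fB'] := fB s01.
        exact: (act_has_sum (x := y) (pair_summable kc r01') fB').
    by apply: cvgB; exact: act_cvg.
  exact: norm_cvg_unique lim1 lim2.
have lim1 : (fun P => dQ (rseq P) : R^o) @ \oo --> (g x : R^o).
  apply: (dominated_cvg_has_sum (f := fun P m => conv (scal (rseq P) k) c m * g (iter m sigma x))
    (g := fun m => if m == 0%N then g x else 0) gM _ _ _ (@has_sum1 _ R R^o 0%N (g x))).
  - apply: nearW => P m.
    by rewrite normrM (ger0_norm (g_ge0 _)) ler_wpM2r// eM// rseq01.
  - move=> m; have -> : (if m == 0%N then g x else 0) = conv k c m * g (iter m sigma x).
      by rewrite (pair_inv kc); case: m => [|m]; rewrite ?mul1r ?mul0r.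
    apply: cvgM; last exact: cvg_cst.
    apply: cvg_finite_sum => j; apply: cvgM; last exact: cvg_cst.
    rewrite -[X in _ --> X]mul1r; apply: cvgM; last exact: cvg_cst.
    exact: rseqX_cvg.
  - exact: nearW.
have lim2 : (fun P => dQ (rseq P) : R^o) @ \oo --> (Q x - Q (sigma x) : R^o).
  have Q_cvg y : (fun P => act sigma (scal (rseq P) k) d y : R^o) @ \oo --> (Q y : R^o).
    apply: (dominated_cvg_has_sum (f := fun P m => scal (rseq P) k m * d (iter m sigma y))
      (Q_sum (x := y)) _ _ _ (Q_sum (x := y))).
    - apply: nearW => P m; rewrite ger0_norm; last first.
        by rewrite mulr_ge0// mulr_ge0// exprn_ge0//; case/andP: (@rseq01 R P) => /ltW.
      rewrite ler_wpM2r// /scal -[leRHS]mul1r ler_wpM2r//.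
      by case/andP: (@rseq01 R P) => r0 r1; rewrite exprn_ile1// ltW.
    - move=> m; apply: cvgM; last exact: cvg_cst.
      rewrite -[X in _ --> X]mul1r; apply: cvgM; last exact: cvg_cst.
      exact: rseqX_cvg.
    - apply: nearW => P; have r01 := @rseq_itv R P.
      exact: (act_has_sum (x := y) (pair_summable kc r01) d_bound).
  by apply: cvgB; exact: Q_cvg.
exact: norm_cvg_unique lim2 lim1.
Qed.

Lemma one_variable_defect : exists d : X -> R,
  [/\ forall x, 0 <= d x <= q x,
      forall N x, 0 <= act sigma (scal (rseq N) c) q x <= q x,
      forall x, (fun N => act sigma (scal (rseq N) c) q x : R^o) @ \oo --> (d x : R^o) &
      forall x, has_sum (fun m => k m * d (iter m sigma x) : R^o) (q x)].
Proof.
exists d; split=> [x|N x|x|x].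
- by rewrite d_ge0 d_le_q.
- by rewrite q_defect ?f_le_q// rseq01.
- exact: d_cvg.
suff <- : Q x = q x by exact: Q_sum.
apply/eqP; rewrite eq_le Q_le /= -subr_le0.
have inv1 y : q y - Q y = q (sigma y) - Q (sigma y).
  exact/subr_exchange/Q_diff.
(* [q - Q] is [sigma]-invariant and bounded by [q], which vanishes along orbits. *)
have inv m : q x - Q x = q (iter m sigma x) - Q (iter m sigma x).
  by elim: m => [|m ih]; [exact: erefl|exact: (etrans ih (inv1 (iter m sigma x)))].
have Q0 y : 0 <= Q y by apply: has_sum_ge0 (Q_sum (x := y)) => m; rewrite mulr_ge0.
have hc := q_pure x; rewrite -(cvg_lim _ hc)//; apply: limr_ge.
  by apply/cvg_ex; eexists; exact: hc.
by apply: nearW => m; rewrite (inv m) lerBlDr lerDl.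
Qed.

End one_variable.

(** * Iteration over the variables *)

Section several_variables.
Context {R : realType}.

Lemma mpow_mcons (n : nat) (X : Type) (sigma : 'I_n.+1 -> X -> X) m (al : mindex n) x :
  mpow sigma (mcons m al) x =
  iter m (sigma ord0) (mpow (fun i => sigma (lift ord0 i)) al x).
Proof.
rewrite /mpow big_ord_recl mcons_ord0 /=; congr (iter m _ _).
by congr (_ x); apply: eq_bigr => i _; rewrite mcons_lift.
Qed.

Lemma mpow0 (X : Type) (sigma : 'I_0 -> X -> X) (al : mindex 0) x : mpow sigma al x = x.
Proof. by rewrite /mpow big_ord0. Qed.

Lemma iter_comm (X : Type) (f g : X -> X) m x :
  (forall x, f (g x) = g (f x)) -> iter m f (g x) = g (iter m f x).
Proof. by move=> fg; elim: m => //= m ->; rewrite fg. Qed.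

Lemma mpow_comm (n : nat) (X : Type) (sigma : 'I_n -> X -> X) (f : X -> X) (al : mindex n) x :
  (forall i x, sigma i (f x) = f (sigma i x)) -> mpow sigma al (f x) = f (mpow sigma al x).
Proof.
elim: n sigma al x => [|n ih] sigma al x fc; first by rewrite !mpow0.
have -> : al = mcons (al ord0) [ffun j => al (lift ord0 j)].
  by apply/ffunP => i; rewrite ffunE; case: unliftP => [j ->|->//]; rewrite ffunE.
by rewrite !mpow_mcons ih// iter_comm.
Qed.

(** The analogue of [act] for a series in several variables whose coefficients are products, as
    those of 1/k_W are. *)
Definition msum (n : nat) (X : Type) (sigma : 'I_n -> X -> X) (u : 'I_n -> nat -> R)
    (q : X -> R) (x : X) : R :=
  summability.sum (fun al : mindex n => (\prod_(i < n) u i (al i)) * q (mpow sigma al x) : R^o).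

Definition multi_bound (n : nat) (X : Type) (sigma : 'I_n -> X -> X) (B q : X -> R) :=
  (forall i x, B (sigma i x) <= B x) /\ forall x, `|q x| <= B x.

Lemma multi_bound_mpow n (X : Type) (sigma : 'I_n -> X -> X) B q (al : mindex n) x :
  multi_bound sigma B q -> `|q (mpow sigma al x)| <= B x.
Proof.
move=> [sB qB]; apply: le_trans (qB _) _.
elim: n sigma al {q qB} x sB => [|n ih] sigma al x sB; first by rewrite mpow0.
have -> : al = mcons (al ord0) [ffun j => al (lift ord0 j)].
  by apply/ffunP => i; rewrite ffunE; case: unliftP => [j ->|->//]; rewrite ffunE.
rewrite mpow_mcons; apply: le_trans (ih (fun i => sigma (lift ord0 i)) _ x _) => //.
by elim: (al ord0) => //= m; apply: le_trans.
Qed.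

Lemma prod_summable n (u : 'I_n -> nat -> R) : (forall i, abs_summable (u i)) ->
  exists S : R, has_sum (fun al : mindex n => \prod_(i < n) `|u i (al i)| : R^o) S.
Proof.
move=> us; have [S hS] : exists S : 'I_n -> R, forall i, has_sum (fun m => `|u i m| : R^o) (S i).
  exists (fun i => summability.sum (fun m => `|u i m| : R^o)) => i.
  by have [s hs] := us i; rewrite (has_sumE hs).
by exists (\prod_(i < n) S i); exact: (has_sum_prod_ge0 (u := fun i m => `|u i m|)).
Qed.

Lemma msum_has_sum n (X : Type) (sigma : 'I_n -> X -> X) u B q x :
  (forall i, abs_summable (u i)) -> multi_bound sigma B q ->
  has_sum (fun al : mindex n => (\prod_(i < n) u i (al i)) * q (mpow sigma al x) : R^o)
    (msum sigma u q x).
Proof.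
move=> us qB; have [S hS] := prod_summable us.
have [s hs] : exists s : R^o, has_sum
    (fun al : mindex n => (\prod_(i < n) u i (al i)) * q (mpow sigma al x) : R^o) s.
  apply: (has_sum_dominated _ (has_sumZ (a := B x) hS)) => al.
  rewrite normrM normr_prod mulrC ler_wpM2r ?prodr_ge0//.
  exact: multi_bound_mpow.
by rewrite /msum (has_sumE hs).
Qed.

Lemma multi_orbit_bound n (X : Type) (sigma : 'I_n -> X -> X) B q i :
  multi_bound sigma B q -> orbit_bound (sigma i) B q.
Proof. by case=> sB qB; split=> // x; exact: sB. Qed.

Lemma msum_mcons n (X : Type) (sigma : 'I_n.+1 -> X -> X) u B q x :
  (forall i, abs_summable (u i)) -> multi_bound sigma B q ->
  msum sigma u q x = msum (fun i => sigma (lift ord0 i)) (fun i => u (lift ord0 i))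
    (act (sigma ord0) (u ord0) q) x.
Proof.
move=> us qB; have h := (has_sum_mcons _ _).2 (msum_has_sum (x := x) us qB).
symmetry; apply: has_sumE; apply: (has_sum_fubini (has_sum_swap h)) => al /=.
have := act_has_sum (x := mpow (fun i => sigma (lift ord0 i)) al x) (us ord0)
  (multi_orbit_bound ord0 qB).
move=> /(has_sumZ (a := \prod_(i < n) u (lift ord0 i) (al i))).
apply: eq_has_sum => m; rewrite mpow_mcons big_ord_recl mcons_ord0.
rewrite [_ *: _]mulrA [X in X * _]mulrC; congr (_ * _ * _).
by apply: eq_bigr => i _; rewrite mcons_lift.
Qed.

Lemma msum_delta n (X : Type) (sigma : 'I_n -> X -> X) u B q x :
  (forall i, abs_summable (u i)) -> multi_bound sigma B q ->
  (forall i N, u i N = (N == 0%N)%:R) -> msum sigma u q x = q x.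
Proof.
elim: n sigma u => [|n ih] sigma u us qB u0.
  apply: has_sumE; rewrite [X in has_sum X](_ : _ = fun=> q x : R^o).
    exact: (@has_sum_mindex0 R R^o (fun=> q x) [ffun=> 0%N]).
  by apply/funext => al; rewrite big_ord0 mul1r mpow0.
rewrite (msum_mcons x us qB).
have -> : act (sigma ord0) (u ord0) q = q by apply/funext => y; exact: act_delta.
by apply: ih => //; split=> [i y|]; [exact: qB.1|exact: qB.2].
Qed.

(* The Taylor coefficients of [1 - z], the reciprocal of the Szego kernel. *)
Definition szego_inv (m : nat) : R :=
  if m == 0%N then 1 else if m == 1%N then -1 else 0.

Lemma szego_inv_bound m : `|szego_inv m| <= 1.
Proof. by case: m => [|[|m]]; rewrite /szego_inv /= ?normrN ?normr1 ?normr0. Qed.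

Lemma act_szego (X : Type) (sigma : X -> X) (q : X -> R) r x :
  act sigma (scal r szego_inv) q x = q x - r * q (sigma x).
Proof.
apply: has_sumE.
have := @has_sum_ord R R^o (fun m => scal r szego_inv m * q (iter m sigma x)) 2.
rewrite !big_ord_recl big_ord0 /scal /szego_inv /= expr0 expr1 !mul1r mulrN1 mulNr addr0.
by apply=> -[|[|m]] // _; rewrite mulr0 mul0r.
Qed.

(* [P] will be the class of quadratic forms. *)
Lemma multi_defect (n : nat) (X : Type) (sigma : 'I_n -> X -> X)
    (k c : 'I_n -> nat -> R) (q B : X -> R) (P : (X -> R) -> Prop) :
  (forall i, weight_pair (k i) (c i)) ->
  (forall i j x, sigma i (sigma j x) = sigma j (sigma i x)) ->
  multi_bound sigma B q ->
  (forall i x, (fun m => B (iter m (sigma i) x)) @ \oo --> (0 : R^o)) ->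
  (forall c' : 'I_n -> nat -> R, (forall i, c' i = c i \/ c' i = szego_inv) ->
   forall r : 'I_n -> R, (forall i, 0 <= r i < 1) ->
   forall x, 0 <= msum sigma (fun i => scal (r i) (c' i)) q x) ->
  (forall a f g, P f -> P g -> P (fun x => a * f x + g x)) -> P (fun=> 0) ->
  (forall i f, P f -> P (f \o sigma i)) ->
  (forall (f : nat -> X -> R) g, (forall N, P (f N)) ->
    (forall x, (fun N => f N x) @ \oo --> (g x : R^o)) -> P g) ->
  P q ->
  exists d : X -> R,
  [/\ P d, forall x, 0 <= d x <= q x &
      forall x, has_sum (fun al : mindex n =>
        (\prod_(i < n) k i (al i)) * d (mpow sigma al x) : R^o) (q x)].
Proof.
elim: n sigma k c q => [|n ih] sigma k c q kc sC qB Bpure defect Plin P0 Psig Pcvg Pq.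
  exists q; split=> // x; last first.
    rewrite [X in has_sum X](_ : _ = fun=> q x : R^o).
      exact: (@has_sum_mindex0 R R^o (fun=> q x) [ffun=> 0%N]).
    by apply/funext => al; rewrite big_ord0 mul1r mpow0.
  (* Without variables the sum [msum] is [q] itself, so the positivity hypothesis says that [q] is
     non-negative. *)
  have := defect c (fun i => or_introl erefl) (fun=> 0) (fun=> _) x.
  by rewrite (msum_delta x _ qB); [rewrite lexx andbT; apply; rewrite lexx ltr01|case|case].
have szs r : 0 <= r < 1 -> abs_summable (scal r szego_inv).
  by move=> r01; exact: scal_bounded_summable r01 szego_inv_bound.
have cs i r : 0 <= r < 1 -> abs_summable (scal r (c i)).
  by move=> r01; have [M cM] := pair_bound (kc i); exact: scal_bounded_summable cM.
have c's (c' : 'I_n.+1 -> nat -> R) (r : 'I_n.+1 -> R) :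
    (forall i, c' i = c i \/ c' i = szego_inv) -> (forall i, 0 <= r i < 1) ->
    forall i, abs_summable (scal (r i) (c' i)).
  by move=> hc' r01 i; case: (hc' i) => ->; [exact: cs|exact: szs].
have c0 i : c i 0%N = 1.
  by have := pair_inv (kc i) 0; rewrite /conv big_ord1 subnn (pair_k0 (kc i)) mul1r.
pose s0 := sigma ord0; pose s' i := sigma (lift ord0 i).
have scal0 i N : scal 0 (c i) N = (N == 0%N)%:R :> R.
  by rewrite /scal expr0n; case: N => [|N]; rewrite /= ?mul1r ?c0 ?mul0r.
have actB i r (c' : nat -> R) : 0 <= r < 1 -> c' = c i \/ c' = szego_inv ->
    exists B', multi_bound sigma B' (act s0 (scal r c') q).
  move=> r01 hc'.
  have [S hS] : abs_summable (scal r c') by case: hc' => ->; [exact: cs|exact: szs].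
  have [h1 h2] := act_orbit_bound hS (multi_orbit_bound ord0 qB).
  exists (fun x => B x * S); split=> // j x; rewrite ler_wpM2r ?qB.1//.
  by apply: has_sum_ge0 hS.
(* At radius 0 a dilated series reduces to its constant term 1. Setting all radii but the first to 0
   turns the joint defect into that of the first variable alone; for this the hypothesis admits zero
   radii. *)
have act_ge0 r c' x : 0 <= r < 1 -> c' = c ord0 \/ c' = szego_inv ->
    0 <= act s0 (scal r c') q x.
  move=> r01 hc'.
  pose C i := if i == ord0 then c' else c i.
  pose Rr (i : 'I_n.+1) : R := if i == ord0 then r else 0.
  have hC i : C i = c i \/ C i = szego_inv.
    by rewrite /C; case: eqP => [->//|_]; left.
  have hR i : 0 <= Rr i < 1 by rewrite /Rr; case: ifP => // _; rewrite lexx ltr01.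
  have := defect C hC Rr hR x.
  rewrite (msum_mcons x (c's _ _ hC hR) qB) /=.
  have [B' hB'] := actB ord0 r c' r01 hc'.
  have {}hB' : multi_bound s' B' (act s0 (scal r c') q) by case: hB' => h1 h2; split=> // i y; exact: h1.
  have -> : act (sigma ord0) (scal (Rr ord0) (C ord0)) q = act s0 (scal r c') q.
    by rewrite /Rr /C eqxx.
  rewrite (msum_delta x _ hB')// => i; first exact: c's.
  by move=> N; rewrite /Rr /C /=; exact: scal0.
have q_ge0 x : 0 <= q x.
  have := act_ge0 0 (c ord0) x; rewrite lexx ltr01 => /(_ isT (or_introl erefl)).
  by rewrite (act_delta _ _ _ (scal0 ord0)).
(* Here the constant weight is chosen in the first variable, and the radius tends to 1. *)
have q_dec x : q (s0 x) <= q x.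
  have hc : (fun N => q x - rseq N * q (s0 x) : R^o) @ \oo --> (q x - 1 * q (s0 x) : R^o).
    by apply: cvgB; [exact: cvg_cst|apply: cvgM; [exact: rseq_cvg|exact: cvg_cst]].
  rewrite -subr_ge0 -[X in _ - X]mul1r; apply: (cvg_ge0 _ hc); apply: nearW => N.
  rewrite -act_szego; apply: act_ge0; [exact: rseq_itv|by right].
have q_pure x : (fun m => q (iter m s0 x)) @ \oo --> (0 : R^o).
  apply: (squeeze_cvgr _ (cvg_cst 0) (Bpure ord0 x)); apply: nearW => m.
  by rewrite q_ge0 /= -[leLHS]ger0_norm ?qB.2.
have defect0 r x : 0 < r < 1 -> 0 <= act s0 (scal r (c ord0)) q x.
  by move=> /andP[r0 r1]; apply: act_ge0; [rewrite ltW|left].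
have [d1 [d1q fq d1cvg d1sum]] := one_variable_defect (kc ord0)
  (multi_orbit_bound ord0 qB) q_dec q_pure defect0.
(* The defect is a pointwise limit of its partial sums, which are finite combinations of [q]
   composed with powers of [s0]. *)
have Pf N : P (act s0 (scal (rseq N) (c ord0)) q).
  pose g J x := \sum_(m < J) scal (rseq N) (c ord0) m * q (iter m s0 x).
  apply: (Pcvg g) => [J|x].
    elim: J => [|J ihJ]; first by rewrite /g (_ : (fun x => _) = fun=> 0)//; apply/funext => x; rewrite big_ord0.
    rewrite (_ : g J.+1 = fun x => scal (rseq N) (c ord0) J * q (iter J s0 x) + g J x).
      apply: Plin => //; elim: J {ihJ} => [|J ihJ]; first exact: Pq.
      rewrite (_ : (fun x => _) = (fun x => q (iter J s0 x)) \o s0); first exact: Psig.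
      by apply/funext => x /=; rewrite -iterSr.
    by apply/funext => x; rewrite /g big_ord_recr /= addrC.
  have := act_has_sum (x := x) (cs ord0 _ (rseq_itv N)) (multi_orbit_bound ord0 qB).
  move=> /has_sum_nat; rewrite (_ : series _ = fun J => g J x)//.
  by apply/funext => J; rewrite /g /series /= big_mkord.
have Pd1 : P d1 by apply: Pcvg Pf d1cvg.
have d1B : multi_bound s' B d1.
  split=> [i x|x]; first exact: qB.1.
  have /andP[h0 h1] := d1q x; rewrite ger0_norm//; apply: le_trans h1 _.
  by rewrite -[leLHS]ger0_norm ?qB.2.
have [] := ih s' (fun i => k (lift ord0 i)) (fun i => c (lift ord0 i)) d1.
- by move=> i; exact: kc.
- by move=> i j x; exact: sC.
- exact: d1B.
- by move=> i x; exact: Bpure.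
(* Positivity is inherited by [d1]: its defects in the remaining variables are limits of joint
   defects of [q], with the weight itself and radius [rseq N] in the first variable. *)
- move=> c' hc' r r01 x.
  have us : forall i, abs_summable (scal (r i) (c' i)).
    by move=> i; case: (hc' i) => ->; [exact: cs|exact: szs].
  have [S hS] := prod_summable us.
  have lim : (fun N => msum s' (fun i => scal (r i) (c' i)) (act s0 (scal (rseq N) (c ord0)) q) x : R^o)
      @ \oo --> (msum s' (fun i => scal (r i) (c' i)) d1 x : R^o).
    have fB N : multi_bound s' B (act s0 (scal (rseq N) (c ord0)) q).
      split=> [i y|y]; first exact: qB.1.
      have /andP[h0 h1] := fq N y; rewrite ger0_norm//; apply: le_trans h1 _.
      by rewrite -[leLHS]ger0_norm ?qB.2.
    apply: (dominated_cvg_has_sum (f := fun N (al : mindex n) =>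
      (\prod_(i < n) scal (r i) (c' i) (al i)) * act s0 (scal (rseq N) (c ord0)) q (mpow s' al x))
      (has_sumZ (a := B x) hS) _ _ _ (msum_has_sum (x := x) us d1B)).
    + apply: nearW => N al; rewrite normrM normr_prod mulrC ler_wpM2r ?prodr_ge0//.
      exact: multi_bound_mpow.
    + by move=> al; apply: cvgM; [exact: cvg_cst|exact: d1cvg].
    + by apply: nearW => N; exact: msum_has_sum (fB N).
  apply: (cvg_ge0 _ lim); apply: nearW => N.
  pose C i := if unlift ord0 i is Some j then c' j else c ord0.
  pose Rr i : R := if unlift ord0 i is Some j then r j else rseq N.
  have hC i : C i = c i \/ C i = szego_inv.
    by rewrite /C; case: unliftP => [j ->|->]; [exact: hc'|left].
  have hR i : 0 <= Rr i < 1.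
    by rewrite /Rr; case: unliftP => [j _|_]; [exact: r01|exact: rseq_itv].
  have := defect C hC Rr hR x.
  rewrite (msum_mcons x (c's _ _ hC hR) qB) /=.
  have -> : act (sigma ord0) (scal (Rr ord0) (C ord0)) q = act s0 (scal (rseq N) (c ord0)) q.
    by rewrite /Rr /C unlift_none.
  rewrite (_ : (fun i => scal (Rr (lift ord0 i)) (C (lift ord0 i))) = fun i => scal (r i) (c' i))//.
  by apply/funext => i; rewrite /Rr /C liftK.
- exact: Plin.
- exact: P0.
- by move=> i f; exact: Psig.
- exact: Pcvg.
- exact: Pd1.
move=> d [Pd dd1 dsum]; exists d; split=> // [x|x].
  have /andP[-> h] := dd1 x; have /andP[_ h1] := d1q x; exact: le_trans h1.
apply/has_sum_mcons/(has_sum_tonelli (g := fun m => k ord0 m * d1 (iter m s0 x))).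
- move=> p; apply: mulr_ge0; last by case/andP: (dd1 (mpow sigma (mcons p.1 p.2) x)).
  by apply: prodr_ge0 => i _; exact/ltW/(pair_gt0 (kc i)).
- move=> m; have := has_sumZ (a := k ord0 m) (dsum (iter m s0 x)).
  apply: eq_has_sum => al /=; rewrite big_ord_recl mcons_ord0 mpow_mcons.
  rewrite [_ *: _]mulrA; congr (_ * _ * _).
    by apply: eq_bigr => i _; rewrite mcons_lift.
  (* [mpow_mcons] applies the powers of [s0] last, while the expansion of [d1] starts from
     [iter m s0 x]; commutation reconciles them. *)
  congr (d _); apply: mpow_comm => i y; rewrite iter_comm// => z; exact: sC.
- exact: d1sum.
Qed.

End several_variables.

(** * Power series and weight sequences *)

Section taylor_uniqueness.
Context {R : realType}.

Lemma has_sum_terms_bounded (I : choiceType) (E : normedModType R[i]) (x : I -> E) (s : E) :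
  has_sum x s -> exists C : R, forall i, `|x i| <= C%:C.
Proof.
move=> /has_sumP h; have [A hA] := h 1 ltr01.
(* A term outside [A] is the difference of two partial sums at distance less than 1 from [s], hence
   at most 2; a term in [A] is bounded by the finite sum. *)
exists (complex.Re (2 + \sum_(i <- A) `|x i|)) => i.
rewrite RRe_real; last by rewrite ger0_real// addr_ge0// sumr_ge0.
have [iA|iA] := boolP (i \in A).
  by rewrite (big_fsetD1 i)//= addrCA lerDl addr_ge0// sumr_ge0.
have h1 := hA A (fsubset_refl _); have h2 := hA (i |` A)%fset (fsubsetUr _ _).
rewrite big_fsetU1//= in h2.
apply: (@le_trans _ _ 2); last by rewrite lerDl sumr_ge0.
rewrite (_ : x i = (s - \sum_(i <- A) x i) - (s - (x i + \sum_(i <- A) x i))); last first.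
  by rewrite opprB addrC addrA subrK addrK.
apply: (le_trans (ler_normB _ _)); rewrite (_ : 2 = 1 + 1 :> R[i])//.
by apply: lerD; exact: ltW.
Qed.

Lemma norm_exp_real (t : R) m : 0 <= t -> `|(t%:C : R[i]) ^+ m| = (t ^+ m)%:C.
Proof. by move=> t0; rewrite normrX norm_real_complex ger0_norm// rmorphXn. Qed.

Lemma real_complex_cvg (T : Type) (F : set_system T) {FF : Filter F} (f : T -> R^o) (l : R) :
  f @ F --> (l : R^o) -> (fun n => (f n)%:C : R[i]^o) @ F --> (l%:C : R[i]^o).
Proof.
move=> /cvgrPdist_lt fl; apply/cvgrPdist_lt => e e0.
have eR : e = (complex.Re e)%:C by rewrite RRe_real// gtr0_real.
have e0R : 0 < complex.Re e by rewrite -ltcR -eR.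
near=> n; rewrite -rmorphB norm_real_complex eR ltcR; near: n.
exact: fl.
Unshelve. all: by end_near. Qed.

(** Strong induction: once the coefficients before [m] vanish, divide by t^m and let t tend to 0.
    Summability at t = 1 bounds the coefficients by some C, and since t is at most 1/2 the quotient
    series is dominated by C 2^m 2^(-j). *)
Lemma power_series_unique_unit (E : normedModType R[i]) (v : nat -> E) :
  (forall t, 0 < t <= 1 -> has_sum (fun m => (t%:C) ^+ m *: v m) 0) ->
  forall m, v m = 0.
Proof.
move=> hv m; have [N] := ubnP m; elim: N m => // N ih m mN.
have {}ih j : (j < m)%N -> v j = 0 by move=> jm; apply: ih; apply: leq_trans jm _.
have h11 : 0 < (1 : R) <= 1 by rewrite ltr01 lexx.
have [C hC] := has_sum_terms_bounded (hv 1 h11).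
have {}hC j : `|v j| <= C%:C.
  by have := hC j; rewrite normrZ norm_exp_real ?ler01// expr1n mul1r.
have C0 : 0 <= C by rewrite -lecR; apply: le_trans (normr_ge0 _) (hC 0%N).
pose t (n : nat) : R := n.+2%:R^-1.
have t0 n : 0 < t n by rewrite invr_gt0.
have t1 n : t n <= 2^-1 by rewrite lef_pV2 ?posrE// ler_nat.
pose f n j : E := if (j < m)%N then 0 else (t n)%:C ^+ (j - m) *: v j.
have hf n : has_sum (f n) 0.
  have tn : 0 < t n <= 1 by rewrite t0 (le_trans (t1 n))// invf_le1// ler1n.
  have := has_sumZ (a := ((t n)%:C ^+ m)^-1) (hv (t n) tn).
  rewrite scaler0; apply: eq_has_sum => j.
  rewrite /f; case: ltnP => jm; first by rewrite ih// !scaler0.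
  rewrite scalerA -{1}(subnK jm) exprD mulrCA mulVf ?mulr1//.
  by rewrite expf_neq0// gt_eqF// ltcR.
have hy : has_sum (fun j => (C * 2 ^+ m * (2^-1) ^+ j)%:C : R[i]^o)
    ((C * 2 ^+ m * (1 - 2^-1)^-1)%:C : R[i]^o).
  apply/has_sum_real_complex; apply: has_sumZ; apply: has_sum_geometric.
  by rewrite invr_ge0 ler0n invf_lt1 ?ltr1n.
have lim : (fun _ : nat => 0 : E) @ \oo --> v m.
  apply: (dominated_cvg_has_sum (f := f) (g := fun j => if j == m then v m else 0)
    (s := fun=> 0) hy _ _ _ (@has_sum1 _ _ E m (v m))).
  - apply: nearW => n j; rewrite /f; case: ltnP => jm.
      by rewrite normr0 lecR !mulr_ge0 ?invr_ge0 ?exprn_ge0 ?ler0n.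
    rewrite normrZ (norm_exp_real _ (ltW (t0 n))) -mulrA mulrC rmorphM /=.
    apply: ler_pM => //; first by rewrite lecR exprn_ge0// ltW.
    rewrite lecR -{2}(subnK jm) exprD mulrCA -exprMn mulfV ?expr1n ?mulr1 ?pnatr_eq0//.
    by rewrite lerXn2r ?nnegrE ?invr_ge0 ?ler0n// ltW.
  - move=> j; rewrite /f; case: ltngtP => jm; [exact: cvg_cst| |].
      rewrite -[X in _ --> X](scale0r (v j)); apply: cvgZ; last exact: cvg_cst.
      have -> : (0 : R[i]) = (0 ^+ (j - m))%:C by rewrite expr0n subn_eq0 leqNgt jm.
      under eq_fun do rewrite -rmorphXn.
      apply: real_complex_cvg; apply: cvg_exp.
      by have := @cvg_harmonic R; rewrite -(cvg_shiftS); exact.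
    by rewrite jm subnn; under eq_fun do rewrite expr0 scale1r; exact: cvg_cst.
  - by apply: nearW => n; exact: hf.
have lim0 : (fun _ : nat => 0 : E) @ \oo --> (0 : E) by exact: cvg_cst.
exact: norm_cvg_unique lim lim0.
Qed.

Lemma power_series_unique (E : normedModType R[i]) (g : nat -> E) (rho : R) :
  0 < rho -> (forall t, 0 < t < rho -> has_sum (fun m => (t%:C) ^+ m *: g m) 0) ->
  forall m, g m = 0.
Proof.
move=> rho0 hg m; pose t1 := rho / 2.
have t10 : 0 < t1 by rewrite divr_gt0.
have t1m : (t1%:C : R[i]) ^+ m != 0 by rewrite expf_neq0// gt_eqF// ltcR.
suff /eqP : t1%:C ^+ m *: g m = 0 by rewrite scaler_eq0 (negPf t1m) => /eqP.
apply: (power_series_unique_unit (v := fun m => t1%:C ^+ m *: g m)) => t /andP[t0 tl1].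
have := hg (t * t1); rewrite mulr_gt0//= => h.
apply: eq_has_sum (h _) => [j|]; first by rewrite scalerA -exprMn rmorphM.
apply: (@le_lt_trans _ _ t1); first by rewrite ler_piMl// ltW.
by rewrite ltr_pdivrMr// ltr_pMr// ltr1n.
Qed.

Lemma complex_field_has_sum_dominated (I : choiceType) (E : completeNormedModType R[i])
    (x : I -> E) (y : I -> R^o) (t : R) :
  (forall i, `|x i| <= (y i)%:C) -> has_sum y t -> exists s, has_sum x s.
Proof.
move=> xy /has_sum_real_complex hy.
exact: (has_sum_dominated (y := fun i => (y i)%:C : R[i]^o) xy hy).
Qed.

Lemma multi_power_series_unique (n : nat) (E : completeNormedModType R[i])
    (a : mindex n -> E) :
  (forall r : 'I_n -> R, (forall i, 0 < r i < 1) ->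
    has_sum (fun al : mindex n => (\prod_(i < n) (r i)%:C ^+ al i) *: a al) 0) ->
  forall al, a al = 0.
Proof.
elim: n a => [|n ih] a ha al.
  have := ha (fun=> 0) (fun i => _); rewrite (_ : (fun _ => _) = a) => [h|].
    have {}h : has_sum a 0 by apply: h => -[].
    exact: has_sum_unique (@has_sum_mindex0 _ _ a al) h.
  by apply/funext => be; rewrite big_ord0 scale1r.
have -> : al = mcons (al ord0) [ffun j => al (lift ord0 j)].
  by apply/ffunP => i; rewrite ffunE; case: unliftP => [j ->|->//]; rewrite ffunE.
move: (al ord0) [ffun j => _] => m be {al}.
pose b m (be : mindex n) := a (mcons m be).
suff : b m be = 0 by [].
move: be; apply: (ih (b m)) => r r01.
have [G hG] : exists G : nat -> E, forall m,
    has_sum (fun be : mindex n => (\prod_(i < n) (r i)%:C ^+ be i) *: b m be) (G m).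
  exists (fun m => summability.sum (fun be : mindex n => (\prod_(i < n) (r i)%:C ^+ be i) *: b m be)).
  move=> {}m; suff [s hs] : exists s, has_sum
    (fun be : mindex n => (\prod_(i < n) (r i)%:C ^+ be i) *: b m be) s by rewrite (has_sumE hs).
  (* To sum over the remaining variables at [r], the terms are bounded at a larger polyradius: the
     midpoint of [r j] and 1, with 1/2 in the first variable. The ratios [p j] are then below 1 and
     give a geometric majorant. *)
  pose rho i : R := if unlift ord0 i is Some j then (1 + r j) / 2 else 2^-1.
  have rho01 i : 0 < rho i < 1.
    rewrite /rho; case: unliftP => [j _|_].
      by have /andP[h0 h1] := r01 j; rewrite divr_gt0 ?addr_gt0//= ltr_pdivrMr// mul1r -[ltRHS]/(1 + 1) ltrD2l.
    by rewrite invr_gt0 ltr0n /= invf_lt1 ?ltr1n.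
  have [C hC] := has_sum_terms_bounded (ha rho rho01).
  pose p j : R := r j / ((1 + r j) / 2).
  have p01 j : 0 <= p j < 1.
    have /andP[h0 h1] := r01 j; have h2 : 0 < (1 + r j) / 2 by rewrite divr_gt0// addr_gt0.
    rewrite /p divr_ge0 ?(ltW h0) ?(ltW h2)//= ltr_pdivrMr// mul1r ltr_pdivlMr//.
    by rewrite mulr_natr mulr2n ltrD2r.
  have hp : has_sum (fun be : mindex n => \prod_(i < n) p i ^+ be i : R^o) (\prod_(i < n) (1 - p i)^-1).
    apply: (has_sum_prod_ge0 (u := fun i m => p i ^+ m)) => [i j|i].
      by rewrite exprn_ge0//; case/andP: (p01 i).
    exact: has_sum_geometric.
  apply: (complex_field_has_sum_dominated _ (has_sumZ (a := C * 2 ^+ m) hp)) => be.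
  have := hC (mcons m be); rewrite !normrZ big_ord_recl mcons_ord0 -/(b m be).
  have nE (s : 'I_n -> R) : (forall i, 0 < s i) ->
      `|\prod_(i < n) (s i)%:C ^+ be i| = (\prod_(i < n) s i ^+ be i)%:C.
    move=> s0; rewrite normr_prod rmorph_prod; apply: eq_bigr => i _.
    by rewrite norm_exp_real// ltW.
  have r0 i : 0 < r i by case/andP: (r01 i).
  have s0 i : 0 < (1 + r i) / 2 by rewrite divr_gt0// addr_gt0.
  rewrite (eq_bigr (fun i => ((1 + r i) / 2)%:C ^+ be i)); last first.
    by move=> i _; rewrite mcons_lift /rho liftK.
  rewrite normrM !nE// {1}/rho unlift_none norm_exp_real ?invr_ge0// => h.
  have -> : \prod_(i < n) r i ^+ be i =
      (2^-1 ^+ m * \prod_(i < n) ((1 + r i) / 2) ^+ be i) * (2 ^+ m * \prod_(i < n) p i ^+ be i).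
    rewrite mulrACA -exprMn mulVf ?pnatr_eq0// expr1n mul1r -big_split /=.
    apply: eq_bigr => i _; rewrite -exprMn; congr (_ ^+ _).
    by rewrite /p mulrC divfK// gt_eqF.
  rewrite rmorphM /= mulrAC.
  apply: (@le_trans _ _ (C%:C * (2 ^+ m * \prod_(i < n) p i ^+ be i)%:C)).
    apply: ler_wpM2r; last by rewrite rmorphM.
    rewrite lecR mulr_ge0 ?exprn_ge0// prodr_ge0// => i _.
    by rewrite exprn_ge0//; case/andP: (p01 i).
  by rewrite -rmorphM /= mulrA.
suff G0 : G m = 0 by rewrite -G0; exact: hG.
(* With the other variables fixed at [r], the [G m] are the coefficients of a series in the first
   variable alone that sums to 0. *)
apply: (@power_series_unique E G 1 ltr01) => t t01.
pose s i : R := if unlift ord0 i is Some j then r j else t.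
have s01 i : 0 < s i < 1 by rewrite /s; case: unliftP.
apply: (has_sum_fubini ((has_sum_mcons _ _).2 (ha s s01))) => j /=.
have := has_sumZ (a := t%:C ^+ j) (hG j); apply: eq_has_sum => be.
rewrite scalerA big_ord_recl mcons_ord0 {1}/s unlift_none; congr (_ * _ *: _).
by apply: eq_bigr => i _; rewrite mcons_lift /s liftK.
Qed.

End taylor_uniqueness.

(** * Weight sequences in terms of coefficients *)

Section weights_to_pairs.
Context {R : realType}.
Implicit Types (w : nat -> R).

(** Since [t] is below 1, the lower limit of the roots of [w], it is below some tail infimum of
    these roots; from that index on t^m is at most w_m. The finitely many earlier terms are added to
    the bound. *)
Lemma weight_terms_bounded w t : weight_sequence w -> 0 < t < 1 ->
  exists C : R, forall m, t ^+ m / w m <= C.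
Proof.
move=> hw /andP[t0 t1].
have w0 := weight_gt0 hw.
have : (t%:E < ereal_sup (range (einfs (fun k => (w k `^ k%:R^-1)%:E))))%E.
  have <- : limn_einf (fun k => (w k `^ k%:R^-1)%:E) =
      ereal_sup (range (einfs (fun k => (w k `^ k%:R^-1)%:E))).
    by rewrite limn_einf_lim; apply/cvg_lim => //; exact: cvg_einfs_sup.
  by rewrite (weight_liminf hw) lte_fin.
move=> /ereal_sup_gt[_ [N _ <-] tN].
have late m : (N <= m)%N -> t ^+ m / w m <= 1.
  case: m => [|m] Nm; first by rewrite expr0 (weight0 hw) divr1.
  rewrite ler_pdivrMr// mul1r.
  have : (t%:E <= (w m.+1 `^ m.+1%:R^-1)%:E)%E.
    apply: le_trans (ltW tN) _; apply: ereal_inf_lbound; exists m.+1 => //=.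
  rewrite lee_fin => h.
  have <- : (w m.+1 `^ m.+1%:R^-1) ^+ m.+1 = w m.+1.
    by rewrite -powR_mulrn ?powR_ge0// -powRrM mulVf ?pnatr_eq0// powRr1// ltW.
  by apply: lerXn2r => //; rewrite nnegrE ?powR_ge0// ltW.
have pos m : 0 <= t ^+ m / w m by rewrite divr_ge0 ?exprn_ge0 ?ltW.
exists (1 + \sum_(j < N) t ^+ j / w j) => m.
have [mN|/late h] := ltnP m N; last by apply: le_trans h _; rewrite lerDl sumr_ge0.
by rewrite (bigD1 (Ordinal mN))//= addrCA lerDl addr_ge0// sumr_ge0.
Qed.

Lemma weight_summable w t : weight_sequence w -> 0 <= t < 1 ->
  abs_summable (scal t (fun m => (w m)^-1)).
Proof.
(* Bounded terms at the intermediate radius [u] give a geometric majorant of ratio [t / u] at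
   [t]. *)
move=> hw /andP[t0 t1]; pose u := (1 + t) / 2.
have u01 : 0 < u < 1.
  rewrite /u divr_gt0 ?ltr_wpDr//= ltr_pdivrMr// mul1r.
  by rewrite -[ltRHS]/(1 + 1) ltrD2l.
have [C hC] := weight_terms_bounded hw u01.
have /andP[u0 _] := u01.
have tu : 0 <= t / u < 1.
  rewrite divr_ge0 ?(ltW u0)//= ltr_pdivrMr// mul1r /u ltr_pdivlMr//.
  by rewrite mulr_natr mulr2n ltrD2r.
apply: (has_sum_dominated _ (has_sumZ (a := C) (has_sum_geometric tu))) => m.
rewrite normr_id /scal ger0_norm; last first.
  by rewrite mulr_ge0 ?exprn_ge0// invr_ge0 ltW// (weight_gt0 hw).
apply: le_trans (ler_wpM2r _ (hC m)); last by rewrite exprn_ge0//; case/andP: tu.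
have um : u ^+ m != 0 by rewrite expf_neq0// gt_eqF.
have -> : u ^+ m / w m * (t / u) ^+ m = t ^+ m / w m; last exact: lexx.
by rewrite (expr_div_n t u) mulrC mulrA divfK.
Qed.

Lemma conv_inverse (k : nat -> R) : k 0%N = 1 ->
  exists c, forall N, conv k c N = (N == 0%N)%:R.
Proof.
move=> k0.
have [s hs] : exists s : nat -> seq R, forall n,
    [/\ size (s n) = n.+1, forall m, (m <= n)%N -> nth 0 (s n.+1) m = nth 0 (s n) m &
        \sum_(m < n.+1) k (n - m)%N * nth 0 (s n) m = (n == 0%N)%:R].
  (* Course-of-values recursion: each coefficient depends on all previous ones, so [s n] carries the
     list of the first [n.+1]. *)
  pose s := fix s n := if n is n'.+1
    then rcons (s n') (- \sum_(m < n'.+1) k (n'.+1 - m)%N * nth 0 (s n') m) else [:: 1].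
  have size_s n : size (s n) = n.+1 by elim: n => //= n ih; rewrite size_rcons ih.
  exists s => n; split=> // [m mn|]; first by rewrite /= nth_rcons size_s ltnS mn.
  case: n => [|n]; first by rewrite big_ord1 /= k0 mul1r.
  rewrite big_ord_recr /= subnn k0 mul1r nth_rcons size_s ltnn eqxx.
  rewrite (eq_bigr (fun m : 'I_n.+1 => k (n.+1 - m)%N * nth 0 (s n) m)) ?subrr// => m _.
  by rewrite nth_rcons size_s ltn_ord.
exists (fun n => nth 0 (s n) n) => N; have [_ _ <-] := hs N.
apply: eq_bigr => m _; congr (_ * _).
have stable d (j : nat) : nth 0 (s (j + d)%N) j = nth 0 (s j) j.
  elim: d => [|d ih]; first by rewrite addn0.
  by rewrite addnS; have [_ /(_ j) e _] := hs (j + d)%N; rewrite e ?leq_addr.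
have mN : (m <= N)%N by rewrite -ltnS.
by have := stable (N - m)%N m; rewrite subnKC// => ->.
Qed.

(** This gives the formal inverse a positive radius of convergence. Each term of the recursion is at
    most 2^(m+1) S (S+1)^j, and the geometric sum of the S (S+1)^j for j <= m stays below
    (S+1)^(m+1). *)
Lemma conv_inverse_growth (k c : nat -> R) (S : R) :
  0 <= S -> (forall m, `|k m| <= S * 2 ^+ m) -> k 0%N = 1 ->
  (forall N, conv k c N = (N == 0%N)%:R) -> forall m, `|c m| <= (2 * (S + 1)) ^+ m.
Proof.
move=> S0 kS k0 kc m; have [N] := ubnP m; elim: N m => // N ih [|m] mN.
  by have := kc 0%N; rewrite /conv big_ord1 subnn k0 mul1r => ->; rewrite normr1 expr0.
have := kc m.+1; rewrite /conv big_ord_recr /= subnn k0 mul1r => /eqP.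
rewrite addrC addr_eq0 => /eqP ->; rewrite normrN.
apply: le_trans (ler_norm_sum _ _ _) _.
have le1 (j : 'I_m.+1) : `|k (m.+1 - j)%N * c j| <= 2 ^+ m.+1 * (S * (S + 1) ^+ j).
  rewrite normrM; apply: le_trans (ler_pM _ _ (kS _) (ih j _)) _ => //.
    exact: leq_trans (ltn_ord j) mN.
  have -> : (2 : R) ^+ m.+1 = 2 ^+ (m.+1 - j) * 2 ^+ j by rewrite -exprD subnK// ltnW.
  rewrite exprMn.
  move: (2 ^+ (m.+1 - j)) (2 ^+ j) ((S + 1) ^+ j) => x y v.
  by rewrite (_ : S * x * (y * v) = x * y * (S * v))//; ring.
apply: le_trans (ler_sum _ (fun j _ => le1 j)) _.
rewrite -mulr_sumr exprMn ler_wpM2l ?exprn_ge0//.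
elim: {mN le1 ih} m.+1 => [|j ihj]; first by rewrite big_ord0 expr0.
rewrite big_ord_recr /= exprS mulrDl mul1r addrC lerD//.
Qed.

Lemma conv_real_complex (u v : nat -> R) N :
  (conv u v N)%:C = conv (fun m => (u m)%:C) (fun m => (v m)%:C) N.
Proof. by rewrite /conv rmorph_sum; apply: eq_bigr => m _; rewrite rmorphM. Qed.

Lemma complex_norm_lt1 (z : R[i]) (rho : R) : `|z| < rho%:C ->
  exists2 t : R, 0 <= t < rho & `|z| = t%:C.
Proof.
move=> h; exists (complex.Re `|z|).
  by rewrite -lecR -ltcR RRe_real ?h ?normr_ge0// normr_real.
by rewrite RRe_real// normr_real.
Qed.

Lemma complex_power_series (u : nat -> R) (z : R[i]) (t : R) :
  `|z| = t%:C -> abs_summable (scal t u) ->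
  exists s : R[i]^o, has_sum (fun m => (u m)%:C * z ^+ m : R[i]^o) s.
Proof.
move=> zt [S hS].
have t0 : 0 <= t by rewrite -lecR -zt; exact: normr_ge0.
apply: (@complex_field_has_sum_dominated R _ (complex_field R)) hS => m.
rewrite normrM norm_real_complex normrX zt -rmorphXn -rmorphM lecR.
by rewrite normrM normrX (ger0_norm t0) mulrC.
Qed.

Lemma has_sum_conv_power (u v : nat -> R) (z a b : R[i]) (t : R) : `|z| = t%:C ->
  abs_summable (scal t u) -> abs_summable (scal t v) ->
  has_sum (fun m => (u m)%:C * z ^+ m : R[i]^o) (a : R[i]^o) ->
  has_sum (fun m => (v m)%:C * z ^+ m : R[i]^o) (b : R[i]^o) ->
  has_sum (fun m => (conv u v m)%:C * z ^+ m : R[i]^o) (a * b : R[i]^o).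
Proof.
move=> zt us vs ua vb.
have [S hS] := us; have [S' hS'] := vs.
have t0 : 0 <= t by rewrite -lecR -zt; exact: normr_ge0.
pose F (p : nat * nat) : R[i]^o := ((u p.1)%:C * z ^+ p.1) * ((v p.2)%:C * z ^+ p.2).
have [s hF] : exists s : R[i]^o, has_sum F s.
  have h := has_sum_mul (fun m => normr_ge0 _) (fun m => normr_ge0 _) hS hS'.
  apply: (@complex_field_has_sum_dominated R _ (complex_field R) _ _ _ _ h) => p.
  rewrite !normrM !norm_real_complex !normrX zt -!rmorphXn -!rmorphM lecR.
  by rewrite (ger0_norm t0) [_ * t ^+ p.1]mulrC [_ * t ^+ p.2]mulrC.
have h1 : has_sum (fun m => ((u m)%:C * z ^+ m) * b : R[i]^o) s.
  by apply: (has_sum_fubini hF) => j; exact: has_sumZ vb.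
have -> : a * b = s.
  apply: (has_sum_unique _ h1); rewrite mulrC.
  by have := has_sumZ (a := b) ua; apply: eq_has_sum => m; exact: mulrC.
apply: eq_has_sum (has_sum_diagonal hF) => N; rewrite conv_real_complex /conv big_distrl.
apply: eq_bigr => m _; rewrite /F /= mulrACA -exprD subnK// -ltnS ltn_ord//.
Qed.

(** [has_taylor1] speaks of ordinary convergence. Convergence at one radius bounds the terms there,
    so at smaller radii the series is dominated by a geometric one and becomes an unordered sum, to
    which [power_series_unique] applies. *)
Lemma has_taylor1_unique (f : R[i] -> R[i]) a b :
  has_taylor1 f a -> has_taylor1 f b -> a = b.
Proof.
move=> [r1 r10 h1] [r2 r20 h2].
have {h1 h2} h t : 0 < t < Num.min r1 r2 ->
    series (fun m => (a m - b m) * t%:C ^+ m : R[i]^o) @ \oo --> (0 : R[i]^o).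
  rewrite lt_min => /and3P[t0 tr1 tr2].
  have tz : `|t%:C : R[i]| = t%:C by rewrite norm_real_complex gtr0_norm.
  have {}h1 := h1 t%:C; have {}h2 := h2 t%:C; rewrite tz ltcR in h1; rewrite tz ltcR in h2.
  rewrite -(subrr (f t%:C)) (_ : series _ =
    series (fun m => a m * t%:C ^+ m : R[i]^o) - series (fun m => b m * t%:C ^+ m : R[i]^o)).
    exact: cvgB (h1 tr1) (h2 tr2).
  apply/funext => n; rewrite /series /= fctE -sumrB; apply: eq_bigr => m _.
  by rewrite mulrBl.
have rho0 : 0 < Num.min r1 r2 by rewrite lt_min r10.
suff ab0 m : a m - b m = 0 by apply/funext => m; apply/eqP; rewrite -subr_eq0 ab0.
pose rho := Num.min r1 r2 / 2.
have rhoP : 0 < rho < Num.min r1 r2 by rewrite divr_gt0//= ltr_pdivrMr// ltr_pMr// ltr1n.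
have /andP[rho1 _] := rhoP.
apply: (@power_series_unique R R[i]^o (fun m => a m - b m) rho) => // t /andP[t0 tr].
have [C hC] : exists C : R, forall m, `|(a m - b m) * rho%:C ^+ m| <= C%:C.
  have /cvg_series_cvg_0 : cvg (series (fun m => (a m - b m) * rho%:C ^+ m : R[i]^o) @ \oo).
    by apply/cvg_ex; exists 0; exact: h.
  move=> /cvgrPdist_lt/(_ 1 ltr01)[N _ hN].
  exists (complex.Re (1 + \sum_(j < N) `|(a j - b j) * rho%:C ^+ j|)) => {}m.
  rewrite RRe_real; last by rewrite ger0_real// addr_ge0// sumr_ge0.
  have [mN|Nm] := ltnP m N.
    by rewrite (bigD1 (Ordinal mN))//= addrCA lerDl addr_ge0// sumr_ge0.
  have /ltW := hN m Nm; rewrite sub0r normrN => h1; apply: le_trans h1 _.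
  by rewrite lerDl sumr_ge0.
have tp : 0 <= t / rho < 1 by rewrite divr_ge0 ?ltW//= ltr_pdivrMr// mul1r.
have [s hs] : exists s : R[i]^o, has_sum (fun m => t%:C ^+ m *: (a m - b m) : R[i]^o) s.
  apply: (@complex_field_has_sum_dominated R _ (complex_field R) _ _ _ _
    (has_sumZ (a := C) (has_sum_geometric tp))) => {}m.
  rewrite [X in `|X|](_ : _ = (t / rho)%:C ^+ m * ((a m - b m) * rho%:C ^+ m)); last first.
    rewrite [LHS]mulrC mulrCA -exprMn -rmorphM /= divfK// gt_eqF//.
  rewrite normrM norm_exp_real; last by case/andP: tp.
  rewrite [X in _ <= X](_ : _ = ((t / rho) ^+ m)%:C * C%:C); last by rewrite [RHS]mulrC -rmorphM.
  by rewrite ler_wpM2l// lecR exprn_ge0//; case/andP: tp.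
suff -> : (0 : R[i]^o) = s by [].
have h0 : series (fun m => t%:C ^+ m *: (a m - b m) : R[i]^o) @ \oo --> (0 : R[i]^o).
  rewrite (_ : (fun m => _) = fun m => (a m - b m) * t%:C ^+ m).
    by apply: h; rewrite t0 /=; apply: lt_trans tr _; case/andP: rhoP.
  by apply/funext => {}m; exact: mulrC.
exact: norm_cvg_unique h0 (has_sum_nat hs).
Qed.

Lemma taylor1E (f : R[i] -> R[i]) a : has_taylor1 f a -> taylor1 f = a.
Proof.
by move=> fa; apply: (has_taylor1_unique _ fa); rewrite /taylor1; apply: xgetPex; exists a.
Qed.

Lemma scal1_lt (t rho : R) (u : nat -> R) C : 0 <= t < rho -> (forall m, `|u m| <= C * rho^-1 ^+ m) ->
  abs_summable (scal t u).
Proof.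
move=> /andP[t0 tr] uC; have rho0 := le_lt_trans t0 tr.
have tp : 0 <= t / rho < 1 by rewrite divr_ge0 ?(ltW rho0)//= ltr_pdivrMr// mul1r.
apply: (has_sum_dominated _ (has_sumZ (a := C) (has_sum_geometric tp))) => m.
rewrite normr_id normrM normrX (ger0_norm t0).
apply: le_trans (ler_wpM2l _ (uC m)) _; first exact: exprn_ge0.
by rewrite exprMn mulrCA lexx.
Qed.

Lemma kfun_has_sum w (z : R[i]) : (forall t, 0 <= t < 1 -> abs_summable (scal t (fun m => (w m)^-1))) ->
  `|z| < 1 -> has_sum (fun m => (w m)^-1%:C * z ^+ m : R[i]^o) (kfun w z : R[i]^o).
Proof.
move=> ws z1; have [t t01 zt] := @complex_norm_lt1 z 1 z1.
have [s hs] := complex_power_series zt (ws t t01).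
by rewrite /kfun (cvg_lim _ (has_sum_nat hs)).
Qed.

Lemma has_taylor1_power_series (f : R[i] -> R[i]) (u : nat -> R) (rho : R) : 0 < rho ->
  (forall z : R[i], `|z| < rho%:C -> has_sum (fun m => (u m)%:C * z ^+ m : R[i]^o) (f z : R[i]^o)) ->
  taylor1 f = fun m => (u m)%:C.
Proof.
by move=> rho0 h; apply: taylor1E; exists rho => // z zr; exact/has_sum_nat/h.
Qed.

(** The formal inverse [c] is first known to converge only on a disc of radius 1/D. That is enough
    to read the Taylor coefficients of the quotients in (P1) and (P2) as Cauchy products; (P2) then
    bounds [c], which makes the expansion of 1/k valid on the whole disc. *)
Lemma weight_sequence_pair w : weight_sequence w -> exists c : nat -> R,
  weight_pair (fun m => (w m)^-1) c /\
  forall z : R[i], `|z| < 1 ->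
    has_sum (fun m => (c m)%:C * z ^+ m : R[i]^o) ((kfun w z)^-1 : R[i]^o).
Proof.
move=> hw; pose k m := (w m)^-1.
have k_gt0 m : 0 < k m by rewrite invr_gt0 (weight_gt0 hw).
have k0 : k 0%N = 1 by rewrite /k (weight0 hw) invr1.
have ks t : 0 <= t < 1 -> abs_summable (scal t k) by exact: weight_summable.
have [c kc] := conv_inverse k0.
have half : 0 <= (2^-1 : R) < 1 by rewrite invr_ge0 ler0n invf_lt1 ?ltr1n.
have [S hS] := ks _ half.
have S0 : 0 <= S by apply: has_sum_ge0 hS.
have kS m : `|k m| <= S * 2 ^+ m.
  have := has_sum_ge_term [fset m]%fset (fun i => normr_ge0 _) hS.
  rewrite big_seq_fset1 normrM ger0_norm ?exprn_ge0 ?invr_ge0// exprVn => h.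
  by rewrite -ler_pdivrMr ?exprn_gt0// mulrC.
have cD := conv_inverse_growth S0 kS k0 kc.
set D := 2 * (S + 1) in cD.
have D1 : 1 <= D by rewrite /D mulrDr mulr1 -[leLHS]add0r lerD ?mulr_ge0// ler1n.
have D0 : 0 < D by apply: lt_le_trans D1.
have cs t r : 0 <= r <= 1 -> 0 <= t < D^-1 -> abs_summable (scal t (scal r c)).
  move=> /andP[r0 r1] tD; apply: (scal1_lt (C := 1) tD) => m.
  rewrite invrK mul1r normrM; apply: le_trans (cD m).
  by rewrite ler_piMl// normrX ger0_norm// exprn_ile1.
have krs t r : 0 <= r <= 1 -> 0 <= t < 1 -> abs_summable (scal t (scal r k)).
  move=> /andP[r0 r1] /andP[t0 t1].
  have tr : 0 <= t * r < 1 by rewrite mulr_ge0//= (le_lt_trans _ t1)// ler_piMr.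
  have [S' hS'] := ks _ tr; exists S'; apply: eq_has_sum hS' => m.
  by rewrite scal_scal.
have Dinv0 : 0 < D^-1 by rewrite invr_gt0.
have Dinv1 : D^-1 <= 1 by rewrite invf_le1.
have scal1 (u : nat -> R) : scal 1 u = u by apply/funext => m; rewrite /scal expr1n mul1r.
have kz (z : R[i]) : `|z| < 1 -> has_sum (fun m => (k m)%:C * z ^+ m : R[i]^o) (kfun w z : R[i]^o).
  exact: kfun_has_sum.
have scalz r (u : nat -> R) (z a : R[i]) :
    has_sum (fun m => (u m)%:C * (r%:C * z) ^+ m : R[i]^o) (a : R[i]^o) ->
    has_sum (fun m => (scal r u m)%:C * z ^+ m : R[i]^o) (a : R[i]^o).
  by apply: eq_has_sum => m; rewrite exprMn rmorphM /= rmorphXn /= mulrCA mulrA.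
have rz_lt r (z : R[i]) (rho : R) : 0 <= r <= 1 -> `|z| < rho%:C -> `|r%:C * z| < rho%:C.
  move=> /andP[r0 r1]; apply: le_lt_trans; rewrite normrM norm_real_complex (ger0_norm r0).
  by rewrite ler_piMl// -[1]/(1%:C) lecR.
have cz (z : R[i]) : `|z| < (D^-1)%:C ->
    has_sum (fun m => (c m)%:C * z ^+ m : R[i]^o) ((kfun w z)^-1 : R[i]^o).
  move=> zD; have [t tD zt] := complex_norm_lt1 zD.
  have cst : abs_summable (scal t c) by rewrite -(scal1 c); apply: cs; rewrite ?ler01 ?lexx.
  have t1 : 0 <= t < 1 by case/andP: tD => -> /lt_le_trans -> //.
  have [s hs] := complex_power_series zt cst.
  have z1 : `|z| < 1 by rewrite zt -[1]/(1%:C) ltcR; case/andP: t1.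
  have := has_sum_conv_power zt (ks t t1) cst (kz z z1) hs.
  rewrite (_ : (fun m => _) = fun m => if m == 0%N then 1 : R[i]^o else 0); last first.
    by apply/funext => m; rewrite kc; case: m => [|m]; rewrite /= ?mul1r ?mul0r.
  move=> /(has_sum_unique (@has_sum1 _ _ R[i]^o 0%N 1)) => e.
  suff -> : (kfun w z)^-1 = s by [].
  have kn0 : kfun w z != 0 by apply: contraPneq e => ->; rewrite mul0r; apply/eqP/oner_neq0.
  by rewrite -[LHS]mulr1 [X in _ * X]e mulrA mulVf// mul1r.
have P1 r : 0 < r < 1 -> forall m, 0 <= conv k (scal r c) m.
  move=> r01 m; have r01' : 0 <= r <= 1 by case/andP: r01 => /ltW -> /ltW ->.
  have h (z : R[i]) : `|z| < (D^-1)%:C ->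
      has_sum (fun m => (conv k (scal r c) m)%:C * z ^+ m : R[i]^o)
        (kfun w z / kfun w (r%:C * z) : R[i]^o).
    move=> zD; have [t tD zt] := complex_norm_lt1 zD.
    have t1 : 0 <= t < 1 by case/andP: tD => -> /lt_le_trans -> //.
    have z1 : `|z| < 1 by rewrite zt -[1]/(1%:C) ltcR; case/andP: t1.
    apply: (has_sum_conv_power zt (ks t t1) (cs t r r01' tD) (kz z z1)).
    exact/scalz/cz/rz_lt.
  by have := weight_P1 hw r01 m; rewrite (has_taylor1_power_series Dinv0 h) lecR.
have P2 : exists M, forall r, 0 < r < 1 -> forall m, `|conv (scal r k) c m| <= M.
  have [M hM] := weight_P2 hw; exists M => r r01 m.
  have r01' : 0 <= r <= 1 by case/andP: r01 => /ltW -> /ltW ->.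
  have h (z : R[i]) : `|z| < (D^-1)%:C ->
      has_sum (fun m => (conv (scal r k) c m)%:C * z ^+ m : R[i]^o)
        (kfun w (r%:C * z) / kfun w z : R[i]^o).
    move=> zD; have [t tD zt] := complex_norm_lt1 zD.
    have t1 : 0 <= t < 1 by case/andP: tD => -> /lt_le_trans -> //.
    have z1 : `|z| < 1 by rewrite zt -[1]/(1%:C) ltcR; case/andP: t1.
    apply: (has_sum_conv_power zt (krs t r r01' t1) _ _ (cz z zD)).
      by rewrite -(scal1 c); apply: cs; rewrite ?ler01 ?lexx.
    apply/scalz/kz; exact: (@rz_lt r z 1).
  have := hM r r01 m; rewrite (has_taylor1_power_series Dinv0 h).
  by rewrite norm_real_complex lecR.
(* As r -> 0 the coefficients of k_r / k tend to those of 1/k, so the uniform bound of (P2) passes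
   to [c]. *)
have bound : exists M, forall m, `|c m| <= M.
  have [M hM] := P2; exists M => m.
  pose r (n : nat) : R := n.+2%:R^-1.
  have r01 n : 0 < r n < 1 by rewrite invr_gt0 ltr0n /= invf_lt1 ?ltr1n.
  have rcvg : r @ \oo --> (0 : R^o).
    by have := @cvg_harmonic R; rewrite -(cvg_shiftS); exact.
  have lim : (fun n => conv (scal (r n) k) c m : R^o) @ \oo --> (conv (scal 0 k) c m : R^o).
    apply: cvg_finite_sum => j; apply: cvgM; last exact: cvg_cst.
    by apply: cvgM; [exact: cvg_exp|exact: cvg_cst].
  have -> : c m = conv (scal 0 k) c m.
    rewrite /conv big_ord_recr /= subnn /scal expr0 k0 !mul1r big1 ?add0r// => j _.
    by rewrite expr0n subn_eq0 leqNgt ltn_ord /= !mul0r.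
  have := cvg_norm lim => /(_ _) h.
  rewrite -subr_ge0; apply: (cvg_ge0 _ (cvgB (cvg_cst M) h)); apply: nearW => n.
  by rewrite subr_ge0 hM.
exists c; split; first by split.
move=> z z1; have [t t1 zt] := @complex_norm_lt1 z 1 z1.
have [M cM] := bound; have cst := scal_bounded_summable t1 cM.
have [s hs] := complex_power_series zt cst.
have := has_sum_conv_power zt (ks t t1) cst (kz z z1) hs.
rewrite (_ : (fun m => _) = fun m => if m == 0%N then 1 : R[i]^o else 0); last first.
  by apply/funext => m; rewrite kc; case: m => [|m]; rewrite /= ?mul1r ?mul0r.
move=> /(has_sum_unique (@has_sum1 _ _ R[i]^o 0%N 1)) => e.
suff -> : (kfun w z)^-1 = s by [].
by rewrite -[LHS]mulr1 [X in _ * X]e mulrA mulVf ?mul1r// (kfun_neq0 hw).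
Qed.

Lemma kfun1_inverse (z : R[i]) : `|z| < 1 ->
  has_sum (fun m => (szego_inv m : R)%:C * z ^+ m : R[i]^o) ((kfun (fun=> 1 : R) z)^-1 : R[i]^o).
Proof.
move=> z1.
have hs : has_sum (fun m => (szego_inv m : R)%:C * z ^+ m : R[i]^o) (1 - z : R[i]^o).
  have := @has_sum_ord R[i] R[i]^o (fun m => (szego_inv m : R)%:C * z ^+ m) 2.
  rewrite !big_ord_recl big_ord0 /szego_inv /= expr0 expr1 mul1r rmorphN1 mulN1r addr0.
  by apply=> -[|[|m]] // _; rewrite mul0r.
have [t t1 zt] := @complex_norm_lt1 z 1 z1.
have s1 u : 0 <= u < 1 -> abs_summable (scal u (fun m => (1 : R)^-1)).
  by move=> u01; apply: (scal_bounded_summable (M := 1) u01) => m; rewrite invr1 normr1.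
have sz : abs_summable (scal t (@szego_inv R)).
  by apply: (scal_bounded_summable (M := 1) t1) => -[|[|m]];
    rewrite /szego_inv /= ?normrN ?normr1 ?normr0.
have := has_sum_conv_power zt (s1 t t1) sz (kfun_has_sum s1 z1) hs.
rewrite (_ : (fun m => _) = fun m => if m == 0%N then 1 : R[i]^o else 0); last first.
  apply/funext => -[|m].
    by rewrite /conv big_ord1 /szego_inv /= invr1 !mul1r.
  rewrite /conv !big_ord_recl big1 /= /szego_inv /= ?invr1 ?mulr0// ?mul1r addr0 subrr mul0r//.
move=> /(has_sum_unique (@has_sum1 _ _ R[i]^o 0%N 1)) => e.
suff -> : (kfun (fun=> 1) z)^-1 = 1 - z by [].
have kn0 : kfun (fun=> 1 : R) z != 0 by apply: contraPneq e => ->; rewrite mul0r; apply/eqP/oner_neq0.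
by rewrite -[LHS]mulr1 [X in _ * X]e mulrA mulVf// mul1r.
Qed.

End weights_to_pairs.

(** * Hilbert spaces *)

Section semi_inner_product.
Context {R : realType} {V : lmodType R[i]} (b : V -> V -> R[i]).
Hypothesis bP : forall a x y z, b (a *: x + y) z = a * b x z + b y z.
Hypothesis bC : forall x y, b y x = (b x y)^*%R.
Hypothesis b_ge0 : forall x, 0 <= b x x.

(** Stated for semi-definite forms because it is also applied to the polarization of [d] and to the
    form of a positive operator, which may degenerate. *)
Lemma cauchy_schwarz x y : `|b x y| ^+ 2 <= b x x * b y y.
Proof.
have bPr a u v w : b w (a *: u + v) = a^*%R * b w u + b w v.
  by rewrite bC bP rmorphD rmorphM (bC u w) (bC v w).
have key a : 0 <= b x x - a * b y x - a^*%R * b x y + a * a^*%R * b y y.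
  have := b_ge0 ((- a) *: y + x); rewrite bP !bPr rmorphN.
  by congr (_ <= _); ring.
have [y0|yn0] := eqVneq (b y y) 0; last first.
  have y0 : 0 < b y y by rewrite lt_def yn0 b_ge0.
  have tR : ((b y y)^-1)^*%R = (b y y)^-1 by rewrite conj_Creal// realV ger0_real.
  have := key (b x y / b y y); rewrite rmorphM /= tR -bC.
  rewrite [X in 0 <= X](_ : _ = b x x - (b x y * b y x) / b y y); last by field.
  by rewrite subr_ge0 ler_pdivrMr// normCK -bC.
have [->|xy0] := eqVneq (b x y) 0; first by rewrite normr0 expr0n mulr_ge0.
have n0 : 0 < `|b x y| ^+ 2 by rewrite exprn_gt0// normr_gt0.
(* If [b y y = 0] but [b x y] is nonzero, the form is affine along multiples of [y]; this [t] makes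
   its value exactly -1. *)
pose t := (b x x + 1) / `|b x y| ^+ 2 / 2.
have tR : t^*%R = t.
  by rewrite conj_Creal// ger0_real// !divr_ge0 ?addr_ge0// ltW.
have := key (t * b x y); rewrite y0 mulr0 addr0 rmorphM /= tR.
rewrite [X in 0 <= X](_ : _ = b x x - (b x x + 1) / `|b x y| ^+ 2 * `|b x y| ^+ 2); last first.
  have -> : (b x x + 1) / `|b x y| ^+ 2 = t * 2 by rewrite divfK// pnatr_eq0.
  by rewrite normCK -bC; ring.
rewrite divfK ?(gt_eqF n0)// opprD addrA subrr add0r oppr_ge0 => h.
by have := le_lt_trans h ltr01; rewrite ltxx.
Qed.

End semi_inner_product.

Section hilbert.
Context {R : realType}.
Implicit Types H : hilbertType R.
Local Notation "<< x , y >>" := (hdot _ x y) (at level 0, format "<< x ,  y >>").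

Section basic_facts.
Context {H : hilbertType R}.
Implicit Types x y z : H.

Lemma dotP a x y z : <<a *: x + y, z>> = a * <<x, z>> + <<y, z>>.
Proof. by rewrite linearPl. Qed.

Lemma dotC x y : <<y, x>> = <<x, y>>^*%R.
Proof. by rewrite hermC /= expr0 mul1r. Qed.

Lemma dotPr a x y z : <<z, a *: x + y>> = a^*%R * <<z, x>> + <<z, y>>.
Proof. by rewrite linearPr. Qed.

Lemma dot0l x : <<0, x>> = 0 :> R[i].
Proof. exact: linear0l. Qed.

Lemma dotDl x y z : <<x + y, z>> = <<x, z>> + <<y, z>>.
Proof. exact: linearDl. Qed.

Lemma dotBl x y z : <<x - y, z>> = <<x, z>> - <<y, z>>.
Proof. exact: linearBl. Qed.

Lemma dotZl a x z : <<a *: x, z>> = a * <<x, z>>.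
Proof. exact: linearZl_LR. Qed.

Lemma dotDr x y z : <<z, x + y>> = <<z, x>> + <<z, y>>.
Proof. exact: linearDr. Qed.

Lemma dotBr x y z : <<z, x - y>> = <<z, x>> - <<z, y>>.
Proof. exact: linearBr. Qed.

Lemma dotZr a x z : <<z, a *: x>> = a^*%R * <<z, x>>.
Proof. exact: linearZr_LR. Qed.

Lemma dot_ge0 x : 0 <= <<x, x>>.
Proof. by rewrite -hdotE exprn_ge0. Qed.

Lemma dot_le x y : `|<<x, y>>| <= `|x| * `|y|.
Proof.
rewrite -(@ler_pXn2r _ 2) ?nnegrE ?mulr_ge0// exprMn !hdotE.
exact: (cauchy_schwarz dotP dotC dot_ge0).
Qed.

Lemma dot_eq0 x : (forall y, <<y, x>> = 0) -> x = 0.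
Proof. by move=> h; apply/eqP; rewrite -normr_eq0 -sqrf_eq0 hdotE h. Qed.

Lemma dot_inj x y : (forall z, <<z, x>> = <<z, y>>) -> x = y.
Proof.
move=> h; apply/eqP; rewrite -subr_eq0; apply/eqP/dot_eq0 => z.
by rewrite dotBr h subrr.
Qed.

Definition sqnorm x : R := complex.Re <<x, x>>.

Lemma sqnormE x : (sqnorm x)%:C = <<x, x>>.
Proof. by rewrite /sqnorm RRe_real// ger0_real// dot_ge0. Qed.

Lemma sqnorm_ge0 x : 0 <= sqnorm x.
Proof. by rewrite -lecR sqnormE dot_ge0. Qed.

Lemma sqnorm_norm x : (sqnorm x)%:C = `|x| ^+ 2.
Proof. by rewrite sqnormE hdotE. Qed.

Lemma norm_sqnorm_le x (C : R) : 0 <= C -> sqnorm x <= C ^+ 2 -> `|x| <= C%:C.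
Proof.
move=> C0; rewrite -lecR sqnorm_norm rmorphXn ler_pXn2r ?nnegrE//.
by rewrite lecR.
Qed.

Lemma parallelogram x y : sqnorm (x + y) + sqnorm (x - y) = (sqnorm x + sqnorm y) *+ 2.
Proof.
apply: complexI; rewrite rmorphD rmorphMn rmorphD /= !sqnormE.
rewrite !(dotBl, dotBr); rewrite !(dotDl, dotDr); ring.
Qed.

Lemma sqnormZ a x : (sqnorm (a *: x))%:C = `|a| ^+ 2 * (sqnorm x)%:C.
Proof. by rewrite !sqnorm_norm normrZ exprMn. Qed.

Lemma dot_cvgl (T : Type) (F : set_system T) {FF : Filter F} (f : T -> H) x y :
  f @ F --> x -> (fun n => <<f n, y>> : R[i]^o) @ F --> (<<x, y>> : R[i]^o).
Proof.
move=> /cvgrPdist_lt fx; apply/cvgrPdist_lt => e e0.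
have e1 : 0 < e / (`|y| + 1) by rewrite divr_gt0// ltr_wpDl.
near=> n; rewrite -dotBl; apply: (le_lt_trans (dot_le _ _)).
have h : `|x - f n| < e / (`|y| + 1) by near: n; exact: fx.
apply: (@le_lt_trans _ _ (`|x - f n| * (`|y| + 1))); first by rewrite ler_wpM2l// lerDl.
by rewrite -ltr_pdivlMr// ltr_wpDl.
Unshelve. all: by end_near. Qed.

Lemma has_sum_dotl (I : choiceType) (v : I -> H) (s x : H) : has_sum v s ->
  has_sum (fun i => hdot H (v i) x : R[i]^o) (hdot H s x : R[i]^o).
Proof.
move=> vs; rewrite /has_sum.
rewrite (_ : partial_sum _ = fun A => hdot H (partial_sum v A) x); first exact: dot_cvgl.
by apply/funext => A; rewrite /partial_sum linear_sumlz.
Qed.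

Lemma conj_cvg (T : Type) (F : set_system T) {FF : Filter F} (f : T -> R[i]^o) (l : R[i]^o) :
  f @ F --> l -> (fun n => (f n)^*%R : R[i]^o) @ F --> (l^*%R : R[i]^o).
Proof.
move=> /cvgrPdist_lt fl; apply/cvgrPdist_lt => e e0; near=> n.
by rewrite -rmorphB norm_conjC; near: n; exact: fl.
Unshelve. all: by end_near. Qed.

Lemma has_sum_conj (I : choiceType) (v : I -> R[i]^o) (s : R[i]^o) : has_sum v s ->
  has_sum (fun i => (v i)^*%R : R[i]^o) (s^*%R : R[i]^o).
Proof.
move=> vs; rewrite /has_sum.
rewrite (_ : partial_sum _ = fun A => (partial_sum v A)^*%R); first exact: conj_cvg.
by apply/funext => A; rewrite /partial_sum rmorph_sum.
Qed.

Lemma Re_cvg (T : Type) (F : set_system T) {FF : Filter F} (f : T -> R[i]^o) (l : R[i]^o) :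
  f @ F --> l -> (fun n => complex.Re (f n) : R^o) @ F --> (complex.Re l : R^o).
Proof.
move=> /cvgrPdist_lt fl; apply/cvgrPdist_lt => e e0.
have e0C : 0 < (e%:C : R[i]) by rewrite ltcR.
near=> n; rewrite -raddfB /= -ltcR; apply: (le_lt_trans (normc_ge_Re _)).
by near: n; exact: fl.
Unshelve. all: by end_near. Qed.

End basic_facts.

(** * Riesz representation by minimization *)

Section riesz.
Context {H : hilbertType R} (phi : H -> R[i]) (C : R).
Hypothesis phiP : forall a x y, phi (a *: x + y) = a * phi x + phi y.
Hypothesis phi_bounded : forall x, sqnorm x <= 1 -> `|phi x| <= C%:C.

Let phi0 : phi 0 = 0.
Proof.
have := phiP 1 0 0; rewrite scale1r addr0 mul1r => /eqP.
by rewrite -subr_eq0 opprD addrA subrr sub0r oppr_eq0 => /eqP.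
Qed.

Let phiZ a x : phi (a *: x) = a * phi x.
Proof. by rewrite -[a *: x]addr0 phiP phi0 addr0. Qed.

Let phiD x y : phi (x + y) = phi x + phi y.
Proof. by rewrite -[x]scale1r phiP mul1r scale1r. Qed.

Let C0 : 0 <= C.
Proof.
rewrite -lecR; apply: le_trans (normr_ge0 _) (phi_bounded (x := 0) _).
by rewrite /sqnorm dot0l.
Qed.

Let phi_le x : `|phi x| <= C%:C * `|x|.
Proof.
have [->|x0] := eqVneq x 0; first by rewrite phi0 !normr0 mulr0.
have nx : 0 < `|x| by rewrite normr_gt0.
have := phi_bounded (x := `|x|^-1 *: x) _.
rewrite phiZ normrM ger0_norm ?invr_ge0// mulrC ler_pdivrMr//; apply.
by rewrite -lecR sqnormZ sqnorm_norm ger0_norm ?invr_ge0// -exprMn mulVf ?expr1n// gt_eqF.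
Qed.

(** If z represents [phi], then [J x] is the squared distance from x to z minus the constant |z|^2;
    so z is sought as the minimizer of [J]. *)
Let J x : R := sqnorm x - complex.Re (phi x) *+ 2.

(** As [J] at the midpoint is at least its infimum, two near-minimizers are close to each other:
    minimizing sequences are Cauchy. *)
Let J_mid x y : J (2^-1 *: (x + y)) *+ 4 = J x *+ 2 + J y *+ 2 - sqnorm (x - y).
Proof.
have e1 : sqnorm (2^-1 *: (x + y)) *+ 4 = sqnorm (x + y).
  apply: complexI; rewrite rmorphMn /= sqnormZ ger0_norm ?invr_ge0//.
  by rewrite -mulr_natl mulrA exprVn -natrX mulfV ?mul1r// pnatr_eq0.
have e2 : complex.Re (phi (2^-1 *: (x + y))) *+ 2 = complex.Re (phi x) + complex.Re (phi y).
  rewrite phiZ phiD -raddfMn -raddfD /=; congr complex.Re.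
  by rewrite -mulrnAl -mulr_natr mulVf ?mul1r// pnatr_eq0.
have p := parallelogram x y.
have -> : J (2^-1 *: (x + y)) *+ 4 = sqnorm (x + y) - (complex.Re (phi x) + complex.Re (phi y)) *+ 4.
  by rewrite /J mulrnBl e1 -e2.
move: p; rewrite /J => p.
rewrite -[sqnorm (x + y)](addrK (sqnorm (x - y))) p; ring.
Qed.

Let J_lb x : - C ^+ 2 <= J x.
Proof.
pose n := complex.Re `|x|.
have nE : `|x| = n%:C by rewrite RRe_real// normr_real.
have h1 : complex.Re (phi x) <= C * n.
  apply: le_trans (ler_norm _) _; rewrite -lecR rmorphM /= -nE.
  by apply: le_trans (phi_le x); exact: normc_ge_Re.
have h2 : sqnorm x = n ^+ 2 by apply: complexI; rewrite sqnorm_norm nE rmorphXn.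
rewrite /J h2; have := sqr_ge0 (n - C); nra.
Qed.

Lemma riesz : exists z : H, forall x, phi x = hdot H x z.
Proof.
pose S := range J.
have Sinf : has_inf S by split; [exists (J 0); exists 0|exists (- C ^+ 2) => _ [x _ <-]].
pose m := inf S.
have mJ x : m <= J x by apply: ge_inf; [exact: Sinf.2|exists x].
have seqP n : exists x, J x < m + n.+1%:R^-1.
  have n0 : 0 < (n.+1%:R^-1 : R) by rewrite invr_gt0.
  by have [_ [x _ <-] h] := inf_adherent n0 Sinf; exists x.
pose u n := projT1 (cid (seqP n)).
have uP n : J (u n) < m + n.+1%:R^-1 by rewrite /u; case: cid.
have dist i j : sqnorm (u i - u j) <= (i.+1%:R^-1 + j.+1%:R^-1) *+ 2.
  have gen (a b s jm ji jj : R) : m <= jm -> jm *+ 4 = ji *+ 2 + jj *+ 2 - s ->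
    ji < m + a -> jj < m + b -> s <= (a + b) *+ 2 by lra.
  exact: gen (mJ _) (J_mid (u i) (u j)) (uP i) (uP j).
have ucvg : cvg (u @ \oo).
  apply/cauchy_cvgP/cauchy_ballP => e e0.
  have eR : e = (complex.Re e)%:C by rewrite RRe_real// gtr0_real.
  set d := complex.Re e in eR.
  have d0 : 0 < d by rewrite -ltcR -eR.
  have [N _ hN] : \forall n \near \oo, (n.+1%:R^-1 : R) < d ^+ 2 / 16.
    have := @cvg_harmonic R => /cvgrPdist_lt/(_ (d ^+ 2 / 16)) [|N _ hN].
      by rewrite divr_gt0// exprn_gt0.
    exists N => // n Nn; have := hN n Nn; rewrite sub0r normrN ger0_norm//.
    by rewrite invr_ge0.
  exists (u @` [set n | (N <= n)%N], u @` [set n | (N <= n)%N]).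
    by split; exists N => // n Nn; exists n.
  move=> [_ _] [[i Ni <-] [j Nj <-]] /=; rewrite -ball_normE /=.
  apply: (@le_lt_trans _ _ (d * 2^-1)%:C); last by rewrite eR ltcR; lra.
  apply: norm_sqnorm_le; first by lra.
  rewrite (_ : (d / 2) ^+ 2 = d ^+ 2 / 4); last by field.
  have gen (a b s q : R) : a < q / 16 -> b < q / 16 -> s <= (a + b) *+ 2 -> s <= q / 4 by lra.
  exact: gen (hN i Ni) (hN j Nj) (dist i j).
have /cvg_ex[z uz] := ucvg; exists z.
have Jz : J z <= m.
  have c1 : (fun n => sqnorm (u n) : R^o) @ \oo --> (sqnorm z : R^o).
    have h : (fun n => `|u n| : R[i]^o) @ \oo --> (`|z| : R[i]^o) by exact: (cvg_norm uz).
    have h2 : (fun n => `|u n| * `|u n| : R[i]^o) @ \oo --> (`|z| * `|z| : R[i]^o) by exact: cvgM.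
    have e x : sqnorm x = complex.Re (`|x| * `|x|) by rewrite -expr2 -sqnorm_norm.
    by rewrite e; under eq_fun do rewrite e; exact: Re_cvg.
  have c2 : (fun n => phi (u n) : R[i]^o) @ \oo --> (phi z : R[i]^o).
    apply/cvgrPdist_lt => e e0.
    have C1 : 0 < (C + 1)%:C by rewrite ltcR ltr_wpDl.
    have e1 : 0 < e / (C + 1)%:C by rewrite divr_gt0.
    near=> n; have -> : phi z - phi (u n) = phi (z - u n).
      by rewrite phiD -[- u n]scaleN1r phiZ mulN1r.
    apply: (le_lt_trans (phi_le _)).
    have h : `|z - u n| < e / (C + 1)%:C by near: n; move/cvgrPdist_lt: uz; apply.
    apply: (@le_lt_trans _ _ ((C + 1)%:C * `|z - u n|)).
      by rewrite ler_wpM2r// lecR lerDl.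
    by rewrite mulrC -ltr_pdivlMr.
  have c3 : (fun n => m + n.+1%:R^-1 - J (u n) : R^o) @ \oo --> (m + 0 - J z : R^o).
    apply: cvgB; first by apply: cvgD; [exact: cvg_cst|exact: cvg_harmonic].
    apply: cvgB => //; rewrite !mulr2n.
    under eq_fun do rewrite mulr2n.
    by apply: cvgD; exact: Re_cvg.
  rewrite -subr_ge0 -[m]addr0; apply: (cvg_ge0 _ c3); apply: nearW => n.
  by rewrite subr_ge0 ltW.
(* The first-order condition at a minimum. At t = -d / (N + 1) the polynomial is non-positive, and
   strictly negative unless d = 0; the 1 avoids dividing by a vanishing N. *)
have quad (N d : R) : 0 <= N -> (forall t, 0 <= t ^+ 2 * N + t * d *+ 2) -> d = 0.
  move=> N0 h; have N1 : 0 < N + 1 by rewrite ltr_wpDl.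
  have := h (- d / (N + 1)).
  rewrite (_ : _ + _ = - (d ^+ 2 * ((N + 2) / (N + 1) ^+ 2))); last by field; rewrite gt_eqF.
  rewrite oppr_ge0 pmulr_lle0; last by rewrite divr_gt0 ?exprn_gt0// ltr_wpDl.
  by move=> d2; apply/eqP; rewrite -sqrf_eq0 eq_le d2 sqr_ge0.
have re x : complex.Re (phi x) = complex.Re (hdot H x z).
  apply/esym/eqP; rewrite -subr_eq0; apply/eqP/(quad (sqnorm x)); first exact: sqnorm_ge0.
  move=> t; have := le_trans Jz (mJ (t%:C *: x + z)); rewrite -subr_ge0.
  congr (_ <= _); rewrite /J phiP.
  have -> : sqnorm (t%:C *: x + z) = sqnorm z + t ^+ 2 * sqnorm x + t * complex.Re (hdot H x z) *+ 2.
    apply: complexI; rewrite !rmorphD !rmorphM /= !sqnormE.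
    rewrite dotDl !dotDr !dotZl !dotZr (@conj_Creal _ t%:C) ?complex_real ?eqxx//.
    have e v : (complex.Re v)%:C = (v + v^*%R) / 2 :> R[i] by rewrite complexRe ReE.
    by rewrite [hdot H z x]dotC !e; field.
  have -> : complex.Re (t%:C * phi x + phi z) = t * complex.Re (phi x) + complex.Re (phi z).
    by rewrite raddfD /=; case: (phi x) => a b /=; rewrite mul0r subr0.
  ring.
move=> x; apply/eqP; rewrite eq_complex re eqxx /=.
(* Equality of real parts at ['i *: x] is equality of imaginary parts at [x]. *)
have := re ('i *: x); rewrite phiZ dotZl.
case: (phi x) => a b; case: (hdot H x z) => a' b' /=.
by rewrite !mul0r !sub0r !mul1r => /eqP; rewrite eqr_opp.
Unshelve. all: by end_near. Qed.

End riesz.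
End hilbert.

(** * Taylor coefficients on the polydisc *)

Section inverse_coefficients.
Context {R : realType}.

Lemma has_taylor_unique (n : nat) (E : completeNormedModType R[i])
    (f : polydisc R n -> E) a b : has_taylor f a -> has_taylor f b -> a = b.
Proof.
move=> fa fb; apply/funext => al; apply/eqP; rewrite -subr_eq0; apply/eqP.
apply: (multi_power_series_unique (a := fun al => a al - b al)) => r r01.
have zP : [forall i, `|(\row_i (r i)%:C : 'rV[R[i]]_n) 0 i| < 1].
  apply/forallP => i; rewrite mxE norm_real_complex -[1]/(1%:C) ltcR.
  by case/andP: (r01 i) => r0 r1; rewrite gtr0_norm.
pose z : polydisc R n := exist (fun z : 'rV[R[i]]_n => [forall i, `|z 0 i| < 1]) _ zP.
have ha : has_sum (fun al : mindex n => (\prod_(i < n) val z 0 i ^+ al i) *: a al) (f z) := fa z.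
have hb : has_sum (fun al : mindex n => (\prod_(i < n) val z 0 i ^+ al i) *: b al) (f z) := fb z.
have := has_sumB ha hb; rewrite subrr; apply: eq_has_sum => be.
by rewrite -scalerBr; congr (_ *: _); apply: eq_bigr => i _; rewrite mxE.
Qed.

Lemma taylorE (n : nat) (E : completeNormedModType R[i]) (f : polydisc R n -> E) a :
  has_taylor f a -> taylor f = a.
Proof.
by move=> fa; apply: (has_taylor_unique _ fa); rewrite /taylor; apply: xgetPex; exists a.
Qed.

Lemma inv_coefE (n : nat) (W : 'I_n -> nat -> R) (c : 'I_n -> nat -> R) (M : 'I_n -> R) :
  (forall i m, `|c i m| <= M i) ->
  (forall i (z : R[i]), `|z| < 1 ->
    has_sum (fun m => (c i m)%:C * z ^+ m : R[i]^o) ((kfun (W i) z)^-1 : R[i]^o)) ->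
  inv_coef W = fun al => (\prod_(i < n) c i (al i))%:C.
Proof.
move=> cM hc; apply: (@taylorE n (complex_field R)) => z.
have z1 i : `|val z 0 i| < 1 by move/forallP: (valP z).
have [t ht] : exists t : 'I_n -> R, forall i, 0 <= t i < 1 /\ `|val z 0 i| = (t i)%:C.
  exists (fun i => complex.Re `|val z 0 i|) => i.
  by have [t t1 zt] := @complex_norm_lt1 R _ 1 (z1 i); rewrite zt.
have us i := scal_bounded_summable (ht i).1 (cM i).
have [S hS] : exists S : 'I_n -> R, forall i,
    has_sum (fun m => `|scal (t i) (c i) m| : R^o) (S i).
  exists (fun i => summability.sum (fun m => `|scal (t i) (c i) m| : R^o)) => i.
  by have [s hs] := us i; rewrite (has_sumE hs).
have := @has_sum_prod R n (fun i m => (c i m)%:C * (val z 0 i) ^+ m) _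
  (fun i m => `|scal (t i) (c i) m|) S _ hS (fun i => hc i _ (z1 i)).
rewrite /mkfun prodfV => h; apply: eq_has_sum (h _) => [al|i m].
  by rewrite big_split /= mulrC rmorph_prod.
have [/andP[t0 _] zt] := ht i.
by rewrite normrM normrX zt norm_real_complex -rmorphXn -rmorphM lecR normrM normrX (ger0_norm t0) mulrC.
Qed.

End inverse_coefficients.

(** * Adjoints and the defect as a scalar sum *)

Section adjoints.
Context {R : realType} {H : hilbertType R}.
Local Notation "<< x , y >>" := (hdot _ x y) (at level 0, format "<< x ,  y >>").

Lemma adjointP (T : H -> H) y (S : H) : (forall x, <<T x, y>> = <<x, S>>) -> hadjoint T y = S.
Proof.
move=> hS; have ex : exists z, [set z | [set: H] z /\ forall x, [set: H] x -> <<T x, y>> = <<x, z>>] z.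
  by exists S; split=> // x _.
have [_ h] : [set z | [set: H] z /\ forall x, [set: H] x -> <<T x, y>> = <<x, z>>] (hadjoint T y).
  exact: xgetPex.
by apply: dot_inj => x; rewrite -h// hS.
Qed.

Lemma hadjointP (T : {linear H -> H}) : contractive T ->
  forall x y, <<T x, y>> = <<x, hadjoint T y>>.
Proof.
move=> Tc x y; have [z hz] : exists z, forall x, <<T x, y>> = <<x, z>>.
  apply: (@riesz _ _ _ (complex.Re `|y|)) => [a u v|u].
    by rewrite linearP dotP.
  move=> u1; apply: (le_trans (dot_le _ _)); rewrite RRe_real ?normr_real//.
  apply: ler_piMl => //; apply: le_trans (Tc u) _.
  by rewrite -[1]/(1%:C); apply: norm_sqnorm_le => //; rewrite expr1n.
by rewrite (adjointP hz).
Qed.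

Lemma hadjoint_linear (T : {linear H -> H}) : contractive T -> linear (hadjoint T).
Proof.
move=> Tc a u v; apply: dot_inj => z.
by rewrite -hadjointP// !dotPr !hadjointP.
Qed.

Lemma hadjoint_contractive (T : {linear H -> H}) : contractive T -> contractive (hadjoint T).
Proof.
move=> Tc y; have [->|y0] := eqVneq (hadjoint T y) 0; first by rewrite normr0.
have n0 : 0 < `|hadjoint T y| by rewrite normr_gt0.
rewrite -(ler_pM2l n0) -expr2 hdotE -hadjointP//.
rewrite -[leLHS]ger0_norm; last by rewrite hadjointP// dot_ge0.
by apply: (le_trans (dot_le _ _)); rewrite ler_wpM2r.
Qed.

Lemma hadjoint_comm (T T' : {linear H -> H}) : contractive T -> contractive T' ->
  (forall x, T (T' x) = T' (T x)) ->
  forall x, hadjoint T (hadjoint T' x) = hadjoint T' (hadjoint T x).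
Proof. by move=> Tc Tc' TT' x; apply: dot_inj => z; rewrite -!hadjointP// TT'. Qed.

Lemma norm_mpow_le n (f : 'I_n -> H -> H) (al : mindex n) x :
  (forall i x, `|f i x| <= `|x|) -> `|mpow f al x| <= `|x|.
Proof.
elim: n f al x => [|n ih] f al x fc; first by rewrite mpow0.
rewrite -(mcons_eta al).
rewrite mpow_mcons; apply: le_trans (ih (fun i => f (lift ord0 i)) _ x _) => //.
by elim: (al ord0) => //= m; apply: le_trans.
Qed.

(** Taking adjoints reverses the order of the factors; commutation of the [S i] restores it. *)
Lemma mpow_adjoint n (T S : 'I_n -> H -> H) (al : mindex n) x y :
  (forall i x y, <<T i x, y>> = <<x, S i y>>) ->
  (forall i j x, S i (S j x) = S j (S i x)) ->
  <<mpow T al x, y>> = <<x, mpow S al y>>.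
Proof.
elim: n T S al x y => [|n ih] T S al x y TS SC; first by rewrite !mpow0.
rewrite -(mcons_eta al).
rewrite !mpow_mcons.
have -> m u v : <<iter m (T ord0) u, v>> = <<u, iter m (S ord0) v>>.
  by elim: m u v => //= m ihm u v; rewrite TS ihm -iterSr.
rewrite (ih _ (fun i => S (lift ord0 i)))//; congr (hdot _ x _).
by apply: mpow_comm => i z; rewrite iter_comm.
Qed.

Lemma sqnorm_le (x y : H) : `|x| <= `|y| -> sqnorm x <= sqnorm y.
Proof. by move=> h; rewrite -lecR !sqnorm_norm ler_pXn2r ?nnegrE. Qed.

Variables (n : nat) (T : 'I_n -> {linear H -> H}).
Hypothesis Tc : forall i, contractive (T i).
Hypothesis TC : forall i j x, T i (T j x) = T j (T i x).
Local Notation S := (fun i => hadjoint (T i)).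

Lemma hadjoint_multi_bound : multi_bound S (@sqnorm R H) (@sqnorm R H).
Proof.
split=> [i x|x]; first exact/sqnorm_le/hadjoint_contractive.
by rewrite ger0_norm// sqnorm_ge0.
Qed.

(** The passage from the vector-valued defect to the calculus of forms. It takes any bounded
    expansions of the reciprocal kernels, so it serves every choice in S(W), in both directions of
    the equivalence. *)
Lemma defectE (W : 'I_n -> nat -> R) (c : 'I_n -> nat -> R) (M r : 'I_n -> R) x :
  (forall i m, `|c i m| <= M i) ->
  (forall i (z : R[i]), `|z| < 1 ->
    has_sum (fun m => (c i m)%:C * z ^+ m : R[i]^o) ((kfun (W i) z)^-1 : R[i]^o)) ->
  (forall i, 0 < r i < 1) ->
  <<defect W T r x, x>> = (msum S (fun i => scal (r i) (c i)) (@sqnorm R H) x)%:C.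
Proof.
move=> cM hc r01; rewrite /defect (inv_coefE cM hc).
have r01' i : 0 <= r i < 1 by case/andP: (r01 i) => /ltW -> ->.
have us i := scal_bounded_summable (r01' i) (cM i).
have [D hD] := prod_summable us.
pose nx := complex.Re `|x|.
have nxE : `|x| = nx%:C by rewrite RRe_real// normr_real.
have coefE (al : mindex n) : (\prod_(i < n) c i (al i))%:C * \prod_(i < n) (r i)%:C ^+ al i =
    (\prod_(i < n) scal (r i) (c i) (al i))%:C.
  rewrite !rmorph_prod -big_split /=; apply: eq_bigr => i _.
  by rewrite -rmorphXn -rmorphM mulrC.
pose v (al : mindex n) : H := ((\prod_(i < n) c i (al i))%:C * \prod_(i < n) (r i)%:C ^+ al i) *:
  mpow (fun i => T i) al (mpow S al x).
have [s hs] : exists s, has_sum v s.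
  apply: (complex_field_has_sum_dominated _ (has_sumZ (a := nx) hD)) => al.
  rewrite /v coefE normrZ norm_real_complex normr_prod.
  rewrite [X in _ <= X](_ : _ = (\prod_(i < n) `|scal (r i) (c i) (al i)|)%:C * nx%:C); last first.
    by rewrite mulrC -rmorphM.
  rewrite ler_wpM2l ?lecR ?prodr_ge0// -nxE.
  apply: (@le_trans _ _ `|mpow S al x|); apply: norm_mpow_le => i y; first exact: Tc.
  exact: hadjoint_contractive.
rewrite (_ : summability.sum _ = s); last exact: has_sumE hs.
apply: (has_sum_unique (has_sum_dotl (x := x) hs)).
have := (has_sum_real_complex _ _).2 (msum_has_sum (x := x) us hadjoint_multi_bound).
apply: eq_has_sum => al; rewrite /v coefE dotZl rmorphM /= sqnormE.
congr (_ * _); symmetry; apply: (@mpow_adjoint _ (fun i => T i) S) => [i y z|i j y].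
  exact: hadjointP.
by apply: hadjoint_comm => // z; exact: TC.
Qed.

End adjoints.

(** * The weighted space and its shift *)

Section A2_space.
Context {R : realType} {n : nat} (W : 'I_n -> nat -> R) (E : hilbertType R).
Hypothesis hW : forall i, weight_sequence (W i).
Implicit Types (a b : mindex n -> E) (f g : polydisc R n -> E).

Lemma mweight_gt0 al : 0 < mweight W al.
Proof. by apply: prodr_gt0 => i _; exact: weight_gt0. Qed.

Definition l2 a := exists S : R, has_sum (fun al => sqnorm (a al) * mweight W al : R^o) S.

Lemma Re_norm (V : normedModType R[i]) (x : V) : (complex.Re `|x|)%:C = `|x|.
Proof. by rewrite RRe_real// normr_real. Qed.

Lemma sqnorm_sqr (x : E) : sqnorm x = complex.Re `|x| ^+ 2.
Proof. by apply: complexI; rewrite sqnorm_norm rmorphXn /= RRe_real// normr_real. Qed.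

(** Point evaluations converge: with p = |z^al|, v = |a_al| and w the weight, p v <= p^2 / w + v^2
    w. The first terms sum to the diagonal of the reproducing kernel, the second to the norm of
    [a]. *)
Lemma l2_has_taylor a : l2 a -> exists f, has_taylor f a.
Proof.
move=> [S hS].
suff h (z : polydisc R n) : exists s, has_sum
    (fun al : mindex n => (\prod_(i < n) val z 0 i ^+ al i) *: a al) s.
  by have [f hf] := choice h; exists f.
have z1 i : `|val z 0 i| < 1 by move/forallP: (valP z).
have [t ht] : exists t : 'I_n -> R, forall i, 0 <= t i < 1 /\ `|val z 0 i| = (t i)%:C.
  exists (fun i => complex.Re `|val z 0 i|) => i.
  by have [t t1 zt] := @complex_norm_lt1 R _ 1 (z1 i); rewrite zt.
have t2 i : 0 <= t i ^+ 2 < 1.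
  by have [/andP[t0 t1] _] := ht i; rewrite exprn_ge0//= expr_lt1.
have us i := weight_summable (hW i) (t2 i).
have [D hD] := prod_summable us.
apply: (complex_field_has_sum_dominated _ (has_sumD hD hS)) => al.
have -> : `|(\prod_(i < n) val z 0 i ^+ al i) *: a al| =
    ((\prod_(i < n) t i ^+ al i) * complex.Re `|a al|)%:C.
  rewrite normrZ normr_prod rmorphM /= RRe_real ?normr_real// rmorph_prod; congr (_ * _).
  by apply: eq_bigr => i _; rewrite normrX (ht i).2 rmorphXn.
rewrite lecR; set p := \prod_(i < n) _; set v := complex.Re _.
have w0 := mweight_gt0 al; set w := mweight W al in w0 *.
have -> : \prod_(i < n) `|scal (t i ^+ 2) (fun m => (W i m)^-1) (al i)| = p ^+ 2 / w.
  rewrite /p /w /mweight -prodrXl -prodfV -big_split /=; apply: eq_bigr => i _.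
  rewrite ger0_norm /scal -?exprM ?[(2 * _)%N]mulnC// mulr_ge0 ?exprn_ge0 ?invr_ge0//.
    by case/andP: (ht i).1.
  exact/ltW/weight_gt0.
rewrite sqnorm_sqr -/v.
have h : p ^+ 2 / w + v ^+ 2 * w - p * v *+ 2 = (p / w - v) ^+ 2 * w.
  by field; rewrite gt_eqF.
have h2 : 0 <= p ^+ 2 / w + v ^+ 2 * w - p * v *+ 2.
  by rewrite h mulr_ge0 ?sqr_ge0// ltW.
have h3 : 0 <= p * v.
  rewrite mulr_ge0//; first by apply: prodr_ge0 => i _; rewrite exprn_ge0//; case/andP: (ht i).1.
  by rewrite /v -lecR Re_norm; exact: normr_ge0.
by move: h2 h3; move: (p ^+ 2 / w) (v ^+ 2 * w) (p * v) => A B C; lra.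
Qed.

Lemma A2_l2 f : A2 W E f <-> has_taylor f (taylor f) /\ l2 (taylor f).
Proof.
have an a : has_taylor f a -> has_taylor f (taylor f) by move=> fa; rewrite (taylorE fa).
have l2E : (\esum_(al in [set: mindex n])
    (complex.Re `|taylor f al| ^+ 2 * mweight W al)%:E < +oo)%E <-> l2 (taylor f).
  rewrite (esum_lty_has_sum (x := fun al => complex.Re `|taylor f al| ^+ 2 * mweight W al)).
    by split=> -[S hS]; exists S; apply: eq_has_sum hS => al; rewrite sqnorm_sqr.
  by move=> al; rewrite mulr_ge0 ?sqr_ge0// ltW// mweight_gt0.
by split=> [[[a /an fa] /l2E]|[fa /l2E h]]; [|split=> //; exists (taylor f)].
Qed.

Lemma l2_A2 f a : has_taylor f a -> l2 a -> A2 W E f.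
Proof. by move=> fa ha; apply/A2_l2; rewrite (taylorE fa). Qed.

Lemma has_taylor_eq f g a : has_taylor f a -> has_taylor g a -> f = g.
Proof. by move=> fa ga; apply/funext => z; exact: has_sum_unique (fa z) (ga z). Qed.

Lemma has_taylor_linear c f g a b : has_taylor f a -> has_taylor g b ->
  has_taylor (c *: f + g) (fun al => c *: a al + b al).
Proof.
move=> fa gb z; have := has_sumD (has_sumZ (a := c) (fa z)) (gb z).
by apply: eq_has_sum => al; rewrite scalerDr !scalerA mulrC.
Qed.

Lemma has_taylor0 : has_taylor (0 : polydisc R n -> E) (fun=> 0).
Proof. by move=> z; apply: eq_has_sum (@has_sum0 _ _ _) => al; rewrite scaler0. Qed.

Lemma sqnormD_le (x y : E) : sqnorm (x + y) <= (sqnorm x + sqnorm y) *+ 2.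
Proof. by rewrite -parallelogram lerDl sqnorm_ge0. Qed.

Lemma l2_linear c a b : l2 a -> l2 b -> l2 (fun al => c *: a al + b al).
Proof.
move=> [S hS] [S' hS'].
have h := has_sumD (has_sumZ (a := (complex.Re `|c|) ^+ 2 * 2) hS) (has_sumZ (a := 2) hS').
apply: (has_sum_dominated _ h) => al; have w0 := mweight_gt0 al.
rewrite ger0_norm; last by rewrite mulr_ge0 ?sqnorm_ge0// ltW.
rewrite [X in _ <= X](_ : _ = (complex.Re `|c| ^+ 2 * 2 * sqnorm (a al) + 2 * sqnorm (b al)) * mweight W al); last first.
  by rewrite mulrDl; congr (_ + _); exact: mulrA.
rewrite ler_wpM2r ?(ltW w0)//; apply: le_trans (sqnormD_le _ _) _.
have -> : sqnorm (c *: a al) = complex.Re `|c| ^+ 2 * sqnorm (a al).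
  by apply: complexI; rewrite sqnormZ rmorphM rmorphXn /=; congr (_ ^+ 2 * _); rewrite [RHS](@Re_norm R[i]^o c).
by move: (complex.Re _ ^+ 2) (sqnorm (a al)) (sqnorm (b al)) => p u v; rewrite le_eqVlt; apply/orP; left; apply/eqP; ring.
Qed.

Lemma A2_linear c f g : A2 W E f -> A2 W E g -> A2 W E (c *: f + g).
Proof.
move=> /A2_l2[fa ha] /A2_l2[gb hb].
exact: l2_A2 (has_taylor_linear (c := c) fa gb) (l2_linear c ha hb).
Qed.

Lemma A2_0 : A2 W E 0.
Proof.
apply: (l2_A2 has_taylor0); exists 0; apply: eq_has_sum (@has_sum0 _ _ _) => al.
by rewrite /sqnorm dot0l mul0r.
Qed.

Lemma taylor_linear c f g : A2 W E f -> A2 W E g ->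
  taylor (c *: f + g) = fun al => c *: taylor f al + taylor g al.
Proof. by move=> /A2_l2[fa _] /A2_l2[gb _]; rewrite (taylorE (has_taylor_linear (c := c) fa gb)). Qed.

Lemma A2_ext f g : A2 W E f -> A2 W E g -> taylor f = taylor g -> f = g.
Proof. by move=> /A2_l2[fa _] /A2_l2[gb _] e; apply: has_taylor_eq fa _; rewrite e. Qed.

Lemma norm_dot_le (x y : E) : `|hdot E x y| <= ((sqnorm x + sqnorm y) / 2)%:C.
Proof.
apply: (le_trans (dot_le _ _)).
pose u := complex.Re `|x|; pose v := complex.Re `|y|.
have uE : `|x| = u%:C by rewrite RRe_real// normr_real.
have vE : `|y| = v%:C by rewrite RRe_real// normr_real.
rewrite !sqnorm_sqr -/u -/v uE vE -rmorphM lecR.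
have := sqr_ge0 (u - v); rewrite ler_pdivlMr// => h.
by rewrite -subr_ge0; apply: le_trans h _; rewrite le_eqVlt; apply/orP; left; apply/eqP; ring.
Qed.

Lemma A2dot_has_sum f g : A2 W E f -> A2 W E g ->
  has_sum (fun al => (mweight W al)%:C * hdot E (taylor f al) (taylor g al) : R[i]^o)
    (A2dot W E f g : R[i]^o).
Proof.
move=> /A2_l2[_ [S hS]] /A2_l2[_ [S' hS']].
have [s hs] : exists s : R[i]^o, has_sum
    (fun al => (mweight W al)%:C * hdot E (taylor f al) (taylor g al) : R[i]^o) s.
  apply: (@complex_field_has_sum_dominated R _ (complex_field R) _ _ _ _
    (has_sumZ (a := 2^-1) (has_sumD hS hS'))) => al.
  have w0 := ltW (mweight_gt0 al).
  rewrite normrM norm_real_complex (ger0_norm w0).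
  apply: (le_trans (ler_wpM2l _ (norm_dot_le _ _))); first by rewrite lecR.
  rewrite -rmorphM lecR -mulrDl [X in _ <= X]mulrC mulrAC [_ * mweight W al]mulrC.
  by rewrite mulrA lexx.
by rewrite /A2dot (has_sumE hs).
Qed.

Lemma A2dotP c f g h : A2 W E f -> A2 W E g -> A2 W E h ->
  A2dot W E (c *: f + g) h = c * A2dot W E f h + A2dot W E g h.
Proof.
move=> Af Ag Ah; apply: (has_sum_unique (A2dot_has_sum (A2_linear c Af Ag) Ah)).
have := has_sumD (has_sumZ (a := c) (A2dot_has_sum Af Ah)) (A2dot_has_sum Ag Ah).
apply: eq_has_sum => al; rewrite taylor_linear// dotP mulrDr; congr (_ + _).
by rewrite [LHS]mulrCA.
Qed.

Lemma A2dotC f g : A2 W E f -> A2 W E g -> A2dot W E g f = (A2dot W E f g)^*%R.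
Proof.
move=> Af Ag; apply: (has_sum_unique (A2dot_has_sum Ag Af)).
apply: eq_has_sum (has_sum_conj (A2dot_has_sum Af Ag)) => al.
rewrite rmorphM /= conj_Creal; first by rewrite -dotC.
by rewrite complex_real.
Qed.

Lemma A2dot_self f : A2 W E f ->
  exists2 S : R, has_sum (fun al => sqnorm (taylor f al) * mweight W al : R^o) S & A2dot W E f f = S%:C.
Proof.
move=> Af; have /A2_l2[_ [S hS]] := Af; exists S => //.
apply: (has_sum_unique (A2dot_has_sum Af Af)).
apply: eq_has_sum ((has_sum_real_complex _ _).2 hS) => al.
by rewrite -sqnormE -rmorphM mulrC.
Qed.

Lemma A2dot_ge0 f : A2 W E f -> 0 <= A2dot W E f f.
Proof.
move=> /A2dot_self[S hS ->]; rewrite lecR; apply: has_sum_ge0 hS => al.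
by rewrite mulr_ge0 ?sqnorm_ge0// ltW// mweight_gt0.
Qed.

Lemma A2dot_eq0 f : A2 W E f -> A2dot W E f f = 0 -> f = 0.
Proof.
move=> Af; have [S hS ->] := A2dot_self Af => -[S0].
apply: (A2_ext Af A2_0); rewrite (taylorE has_taylor0); apply/funext => al.
have := has_sum_ge_term [fset al]%fset _ hS.
rewrite big_seq_fset1 S0 => h.
have w0 := mweight_gt0 al.
have s0 : sqnorm (taylor f al) = 0.
  apply/eqP; rewrite eq_le sqnorm_ge0 andbT -(pmulr_lle0 _ w0); apply: h => be.
  by rewrite mulr_ge0 ?sqnorm_ge0// ltW// mweight_gt0.
apply/eqP; rewrite -normr_eq0 -sqrf_eq0 -sqnorm_norm s0; exact/eqP.
Qed.

Lemma A2_dot_inj f g : A2 W E f -> A2 W E g ->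
  (forall h, A2 W E h -> A2dot W E h f = A2dot W E h g) -> f = g.
Proof.
move=> Af Ag h; apply/eqP; rewrite -subr_eq0; apply/eqP.
have -> : f - g = (-1) *: g + f by rewrite scaleN1r addrC.
have Afg := A2_linear (-1) Ag Af.
apply: (A2dot_eq0 Afg); rewrite A2dotP// mulN1r.
by rewrite (A2dotC Afg Ag) (A2dotC Afg Af) -h// addNr.
Qed.

End A2_space.

(** * Multiplication by a coordinate and its adjoint *)

Section A2_shift.
Context {R : realType} {n : nat} (W : 'I_n -> nat -> R) (E : hilbertType R).
Hypothesis hW : forall i, weight_sequence (W i).
Implicit Types (a b : mindex n -> E) (f g : polydisc R n -> E) (i : 'I_n) (al : mindex n).

Definition minc i al : mindex n := [ffun j => (al j + (j == i))%N].
Definition mdec i al : mindex n := [ffun j => (al j - (j == i))%N].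

Lemma mincK i : cancel (minc i) (mdec i).
Proof. by move=> al; apply/ffunP => j; rewrite !ffunE addnK. Qed.

Lemma mdecK i al : (0 < al i)%N -> minc i (mdec i al) = al.
Proof.
move=> al0; apply/ffunP => j; rewrite !ffunE subnK//.
by case: eqP => [->|].
Qed.

Lemma minc_gt0 i al : (0 < minc i al i)%N.
Proof. by rewrite ffunE eqxx addn1. Qed.

Lemma has_sum_minc (F : normedModType R[i]) i (x : mindex n -> F) (s : F) :
  (forall al, al i = 0%N -> x al = 0) -> has_sum (x \o minc i) s <-> has_sum x s.
Proof.
move=> x0; apply: has_sum_reindex; first exact: can_inj (mincK i).
move=> al xal; exists (mdec i al); apply: mdecK; rewrite lt0n.
by apply: contraNneq xal => /x0 ->.
Qed.

Definition mul_coef i a al : E := if al i == 0%N then 0 else a (mdec i al).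
(** After multiplication of all coefficients by their weights this is a plain backward shift; the
    quotient of weights only converts between the two normalizations. *)
Definition adj_coef i a al : E :=
  (mweight W (minc i al) / mweight W al)%:C *: a (minc i al).

Lemma mul_coef_minc i a al : mul_coef i a (minc i al) = a al.
Proof. by rewrite /mul_coef -[_ == 0%N]negbK -lt0n minc_gt0 mincK. Qed.

Lemma mul_coef0 i a al : al i = 0%N -> mul_coef i a al = 0.
Proof. by rewrite /mul_coef => ->. Qed.

Lemma has_taylor_mul i f a : has_taylor f a -> has_taylor (mul_coord E i f) (mul_coef i a).
Proof.
move=> fa z; apply/(@has_sum_minc _ i) => [al al0|]; first by rewrite mul_coef0// scaler0.
apply: eq_has_sum (has_sumZ (a := val z 0 i) (fa z)) => al /=.
rewrite mul_coef_minc scalerA; congr (_ *: _).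
rewrite -[RHS]/(\prod_(j < n) val z 0 j ^+ minc i al j).
rewrite [RHS](eq_bigr (fun j => val z 0 j ^+ al j * val z 0 j ^+ (j == i))); last first.
  by move=> j _; rewrite ffunE exprD.
rewrite big_split /= mulrC; congr (_ * _).
by rewrite (bigD1 i)//= eqxx expr1 big1 ?mulr1// => j /negPf ->.
Qed.

Lemma mweight_minc i al : mweight W (minc i al) <= mweight W al.
Proof.
apply: ler_prod => j _; rewrite ffunE ltW ?weight_gt0//=.
by apply: weight_nonincreasing => //; rewrite leq_addr.
Qed.

Lemma l2_mul i a : l2 W a -> l2 W (mul_coef i a).
Proof.
move=> [S hS].
have [s hs] : exists s : R, has_sum (fun al => sqnorm (a al) * mweight W (minc i al) : R^o) s.
  apply: (has_sum_dominated _ hS) => al; rewrite ger0_norm ?mulr_ge0 ?sqnorm_ge0//.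
    by rewrite ler_wpM2l ?sqnorm_ge0// mweight_minc.
  by rewrite ltW// mweight_gt0.
exists s; apply/(@has_sum_reindex _ _ _ _ (minc i)).
- exact: can_inj (mincK i).
- move=> al; have [al0|] := posnP (al i); last by exists (mdec i al); exact: mdecK.
  by rewrite mul_coef0// /sqnorm dot0l mul0r eqxx.
- by apply: eq_has_sum hs => al /=; rewrite mul_coef_minc.
Qed.

Lemma has_sum_minc_ge0 i (x : mindex n -> R^o) (S : R) : (forall al, 0 <= x al) ->
  has_sum x S -> exists s : R, has_sum (x \o minc i) s.
Proof.
move=> x0 hS; pose y al := if al i == 0%N then 0 else x al.
have [s hs] : exists s : R^o, has_sum y s.
  apply: (has_sum_dominated _ hS) => al; rewrite /y.
  by case: ifP => _; [rewrite normr0|rewrite ger0_norm].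
exists s; have /= := (@has_sum_reindex _ _ _ _ (minc i) y s _ _).2 hs.
move=> h; apply: eq_has_sum (h _ _) => [al||].
- by rewrite /y /= -[_ == 0%N]negbK -lt0n minc_gt0.
- exact: can_inj (mincK i).
- move=> al; have [al0|] := posnP (al i); first by rewrite /y al0 /= eqxx.
  by exists (mdec i al); exact: mdecK.
Qed.

Lemma l2_adj i a : l2 W a -> l2 W (adj_coef i a).
Proof.
move=> [S hS].
have [|s hs] := has_sum_minc_ge0 i _ hS.
  by move=> al; rewrite mulr_ge0 ?sqnorm_ge0// ltW// mweight_gt0.
apply: (has_sum_dominated _ hs) => al /=.
have w0 := mweight_gt0 hW al; have w1 := mweight_gt0 hW (minc i al).
rewrite ger0_norm; last by rewrite mulr_ge0 ?sqnorm_ge0// ltW.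
have -> : sqnorm (adj_coef i a al) = (mweight W (minc i al) / mweight W al) ^+ 2 * sqnorm (a (minc i al)).
  apply: complexI; rewrite sqnormZ norm_real_complex rmorphM rmorphXn /=.
  by rewrite ger0_norm// divr_ge0// ltW.
have := mweight_minc i al; have s0 := sqnorm_ge0 (a (minc i al)).
move: (sqnorm _) s0 (mweight _ _) w0 (mweight _ _) w1 => q q0 w w0 w' w1 ww.
rewrite (_ : _ * w = (q * w') * (w' / w)); last by field; rewrite gt_eqF.
by rewrite ler_piMr ?mulr_ge0 ?(ltW w1)// ler_pdivrMr// mul1r.
Qed.

Lemma A2_mul i f : A2 W E f -> A2 W E (mul_coord E i f).
Proof.
move=> /(A2_l2 hW)[fa ha].
exact: (l2_A2 hW (has_taylor_mul (i := i) fa) (l2_mul i ha)).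
Qed.

Lemma taylor_mul i f : A2 W E f -> taylor (mul_coord E i f) = mul_coef i (taylor f).
Proof. by move=> /(A2_l2 hW)[fa _]; rewrite (taylorE (has_taylor_mul (i := i) fa)). Qed.

Local Notation adj i := (adjoint (A2 W E) (A2dot W E) (mul_coord E i)).

(** [A2] is a subset of a function space with a form, not a [hilbertType], so [riesz] does not
    produce the adjoint. It is exhibited by its coefficients, and the choice made by [adjoint]
    agrees with it by uniqueness. *)
Let adj_spec i g : A2 W E g -> A2 W E (adj i g) /\ taylor (adj i g) = adj_coef i (taylor g) /\
  forall f, A2 W E f -> A2dot W E (mul_coord E i f) g = A2dot W E f (adj i g).
Proof.
move=> Ag; have /(A2_l2 hW)[ga la] := Ag.
have [h ha] := l2_has_taylor hW (l2_adj i la).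
have Ah := l2_A2 hW ha (l2_adj i la).
have spec f : A2 W E f -> A2dot W E (mul_coord E i f) g = A2dot W E f h.
  move=> Af; apply: (has_sum_unique (A2dot_has_sum hW (A2_mul i Af) Ag)).
  apply/(@has_sum_minc _ i) => [al al0|]; first by rewrite taylor_mul// mul_coef0// dot0l mulr0.
  apply: eq_has_sum (A2dot_has_sum hW Af Ah) => al /=.
  rewrite taylor_mul// mul_coef_minc (taylorE ha) dotZr mulrA; congr (_ * _).
  rewrite (@conj_Creal _ (_ / _)%:C) ?complex_real// -rmorphM; congr (_%:C).
  by rewrite mulrC divfK// gt_eqF// mweight_gt0.
suff -> : adj i g = h by rewrite (taylorE ha).
have ex : [set z | A2 W E z /\ forall x, A2 W E x ->
    A2dot W E (mul_coord E i x) g = A2dot W E x z] (adj i g).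
  by apply: xgetPex; exists h; split.
apply: (A2_dot_inj hW) => //; first exact: ex.1.
by move=> f Af; rewrite -ex.2// spec.
Qed.

Lemma A2_adj i g : A2 W E g -> A2 W E (adj i g).
Proof. by move=> /(adj_spec i)[]. Qed.

Lemma taylor_adj i g : A2 W E g -> taylor (adj i g) = adj_coef i (taylor g).
Proof. by move=> /(adj_spec i)[_ []]. Qed.

Lemma A2dot_mul i f g : A2 W E f -> A2 W E g ->
  A2dot W E (mul_coord E i f) g = A2dot W E f (adj i g).
Proof. by move=> Af /(adj_spec i)[_ [_]]; apply. Qed.

(** Any two candidates differ by an element of [Q] orthogonal to [Q], hence by 0; so the choice in
    [orthoproj] can be computed from an explicit candidate. *)
Lemma orthoprojE (Q : set (polydisc R n -> E)) f q : Q `<=` A2 W E ->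
  (forall c x y, Q x -> Q y -> Q (c *: x + y)) -> A2 W E f -> Q q ->
  (forall p, Q p -> A2dot W E (f - q) p = 0) -> orthoproj (A2dot W E) Q f = q.
Proof.
move=> QA QL Af Qq hq.
have ex : [set q | Q q /\ forall p, Q p -> A2dot W E (f - q) p = 0]
    (orthoproj (A2dot W E) Q f) by apply: xgetPex; exists q; split.
set q' := orthoproj _ _ _ in ex *; have [Qq' hq'] := ex.
have eB u v : u - v = (-1) *: v + u :> (polydisc R n -> E) by rewrite scaleN1r addrC.
have Qd : Q (q' - q) by rewrite eB; exact: QL.
have dotB u v p : A2 W E u -> A2 W E v -> A2 W E p ->
    A2dot W E (u - v) p = A2dot W E u p - A2dot W E v p.
  by move=> Au Av Ap; rewrite eB A2dotP// mulN1r addrC.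
apply/eqP; rewrite -subr_eq0; apply/eqP/(A2dot_eq0 hW); first exact: QA.
have [Aq Aq' Ad] := And3 (QA _ Qq) (QA _ Qq') (QA _ Qd).
have := hq _ Qd; rewrite (dotB f q _ Af Aq Ad) => /subr0_eq h.
have := hq' _ Qd; rewrite (dotB f q' _ Af Aq' Ad) => /subr0_eq h'.
by rewrite (dotB q' q _ Aq' Aq Ad) -h -h' subrr.
Qed.

End A2_shift.

(** * Square roots of quadratic forms *)

Lemma has_sum_ge_ord (R : realType) (x : nat -> R^o) (s : R) N :
  (forall m, 0 <= x m) -> has_sum x s -> \sum_(m < N) x m <= s.
Proof.
move=> x0 xs; pose y m := if (m < N)%N then x m else 0.
have -> : \sum_(m < N) x m = \sum_(m < N) y m by apply: eq_bigr => m _; rewrite /y ltn_ord.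
have ys : has_sum (y : nat -> R^o) (\sum_(m < N) y m).
  by apply: (@has_sum_ord R R^o) => m Nm; rewrite /y ltnNge Nm.
by apply: has_sum_le ys xs => m; rewrite /y; case: ifP.
Qed.

Section sqrt_coefficients.
Context {R : realType}.

(* The solution [g] of [g = (z + g ^ 2) / 2], i.e. [1 - sqrt (1 - z)]. *)
Lemma sqrt_recursion : exists g : nat -> R,
  g 0%N = 0 /\ forall N, g N.+1 = ((N == 0%N)%:R + conv g g N.+1) / 2.
Proof.
(* The extreme terms of the inner sum read entry [n'.+1], which is not yet in the list and defaults
   to 0. This is harmless: in the Cauchy product that coefficient is multiplied by g_0 = 0. *)
pose s := fix s n := if n is n'.+1
  then rcons (s n') (((n' == 0%N)%:R + \sum_(m < n'.+2) nth 0 (s n') (n'.+1 - m)%N * nth 0 (s n') m) / 2)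
  else [:: 0 : R].
have size_s n : size (s n) = n.+1 by elim: n => //= n ih; rewrite size_rcons ih.
pose g n := nth 0 (s n) n; exists g; split=> // N.
have stable m : (m <= N)%N -> nth 0 (s N) m = g m.
  move=> mN; rewrite -(subnKC mN); elim: (N - m)%N => [|d ih]; first by rewrite addn0.
  by rewrite addnS /= nth_rcons size_s ltnS leq_addr.
have last0 : nth 0 (s N) N.+1 = 0 by rewrite nth_default// size_s.
have g0 : g 0%N = 0 by [].
rewrite {1}/g /= nth_rcons size_s ltnn eqxx; congr ((_ + _) / 2).
apply: eq_bigr => -[m mN] _ /=.
have [->|m0] := posnP m; first by rewrite subn0 last0 stable// g0 mul0r mulr0.
have [->|m1] := eqVneq m N.+1; first by rewrite subnn last0 stable// g0 mulr0 mul0r.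
by rewrite !stable//; lia.
Qed.

(** [b] expands sqrt (1 - z) as 1 - g with g non-negative. The partial sums t_N of g satisfy t_(N+1)
    <= (1 + t_N^2) / 2, so they never exceed 1. Summability at the boundary point 1 is what allows a
    contraction to be substituted for z. *)
Lemma sqrt_coef : exists2 b : nat -> R, abs_summable b & forall N, conv b b N = szego_inv N.
Proof.
have [g [g0 gS]] := sqrt_recursion.
have g_ge0 m : 0 <= g m.
  elim/ltn_ind: m => -[|m] ih; first by rewrite g0.
  rewrite gS divr_ge0// addr_ge0//; apply: sumr_ge0 => -[j jm] _ /=.
  have [->|j0] := posnP j; first by rewrite g0 mulr0.
  have [->|j1] := eqVneq j m.+1; first by rewrite subnn g0 mul0r.
  by rewrite mulr_ge0// ih//; lia.
have s_le1 N : \sum_(m < N.+1) g m <= 1.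
  elim: N => [|N ih]; first by rewrite big_ord1 g0.
  (* Because g_0 = 0, the Cauchy square up to degree N+1 involves only the coefficients kept by this
     truncation, and its total is t^2. *)
  pose h m := if (m < N.+1)%N then g m else 0.
  have h_ge0 m : 0 <= h m by rewrite /h; case: ifP.
  have hs : has_sum (h : nat -> R^o) (\sum_(m < N.+1) g m).
    have -> : \sum_(m < N.+1) g m = \sum_(m < N.+1) h m by apply: eq_bigr => m _; rewrite /h ltn_ord.
    by apply: (@has_sum_ord R R^o) => m Nm; rewrite /h ltnNge Nm.
  set t := \sum_(m < N.+1) g m in ih hs *.
  have cs : has_sum (conv h h : nat -> R^o) (t * t).
    exact: has_sum_diagonal (has_sum_mul h_ge0 h_ge0 hs hs).
  have c_ge0 m : 0 <= conv h h m by apply: sumr_ge0 => j _; rewrite mulr_ge0.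
  have t0 : 0 <= t by apply: sumr_ge0.
  have hle : \sum_(m < N.+1) conv g g m.+1 <= t * t.
    have := has_sum_ge_ord N.+2 c_ge0 cs.
    rewrite big_ord_recl /=; apply: le_trans; apply: le_trans (_ : _ <= \sum_(m < N.+1) conv h h m.+1) _; last first.
      by rewrite lerDr.
    rewrite le_eqVlt; apply/orP; left; apply/eqP; apply: eq_bigr => -[m mN] _ /=.
    apply: eq_bigr => -[j jm] _ /=.
    have [->|j0] := posnP j; first by rewrite /h g0 !mulr0.
    have [->|j1] := eqVneq j m.+1; first by rewrite subnn /h g0 !mul0r.
    by rewrite /h !ifT//; lia.
  rewrite big_ord_recl /= g0 add0r; under eq_bigr do rewrite /= gS.
  rewrite -mulr_suml big_split /= big_ord_recl /= big1 => [|i _]; last by [].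
  have gen (u : R) : 0 <= t -> t <= 1 -> u <= t * t -> (1 + 0 + u) / 2 <= 1 by nra.
  exact: gen hle.
have gcvg : cvg (series (g : nat -> R^o) @ \oo).
  apply: nondecreasing_is_cvgn.
    apply/nondecreasing_seqP => N; rewrite /series /= big_nat_recr//= lerDl; exact: g_ge0.
  exists 1 => _ [N _ <-]; rewrite /series /= big_mkord.
  by apply: le_trans (s_le1 N); rewrite big_ord_recr /= lerDl.
have [s gs] : exists s : R, has_sum (g : nat -> R^o) s.
  by move/cvg_ex: gcvg => [s gs]; exists s; apply: has_sum_series.
pose b m := (m == 0%N)%:R - g m.
have bS m : b m.+1 = - g m.+1 by rewrite /b sub0r.
have b0 : b 0%N = 1 by rewrite /b g0 subr0.
exists b.
  have d1 : has_sum (fun m => if m == 0%N then 1 else 0 : R^o) 1 by exact: (@has_sum1 _ R R^o).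
  apply: (has_sum_dominated _ (has_sumD gs d1)) => -[|m]; rewrite normr_id.
    by rewrite b0 g0 normr1 add0r.
  by rewrite bS normrN ger0_norm// addr0.
move=> [|N]; first by rewrite /conv big_ord1 b0 mulr1.
have gN : conv g g N.+1 = 2 * g N.+1 - (N == 0%N)%:R by rewrite gS; field.
rewrite /conv big_ord_recl big_ord_recr /= subnn subn0 b0 bS.
move: gN; rewrite /conv big_ord_recl big_ord_recr /= subnn subn0 g0 mulr0 mul0r add0r addr0.
set x := \sum_(i < N) _ => xE; set y := \sum_(i < N) _.
have -> : y = x.
  apply: eq_bigr => -[m mN] _ /=; rewrite /bump /= add1n bS.
  rewrite (_ : (N.+1 - m.+1)%N = (N - m).-1.+1) ?bS ?mulrNN//; last by lia.
rewrite xE /szego_inv /= eqSS; case: (N == 0%N) => /=; ring.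
Qed.
End sqrt_coefficients.

(** * From quadratic forms to operators *)

Section quadratic_forms.
Context {R : realType} {H : hilbertType R}.
Implicit Types (f g d : H -> R) (x y z : H).
Local Notation "<< x , y >>" := (hdot _ x y) (at level 0, format "<< x ,  y >>").

Definition polar f x y : R[i] :=
  ((f (x + y) - f (x - y))%:C + 'i * (f (x + 'i *: y) - f (x - 'i *: y))%:C) / 4.

(* A quadratic form is encoded by the sesquilinearity of its polarization; the
   other two conditions make it the diagonal of that polarization. *)
Definition quadratic f : Prop :=
  [/\ forall a x y z, polar f (a *: x + y) z = a * polar f x z + polar f y z,
      forall x, f ('i *: x) = f x &
      forall x, f (x + x) = 4 * f x].

Lemma polar_linear a f g x y : polar (fun x => a * f x + g x) x y = a%:C * polar f x y + polar g x y.
Proof. rewrite /polar !rmorphB !rmorphD !rmorphM /=; ring. Qed.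

Lemma quadratic_linear a f g : quadratic f -> quadratic g -> quadratic (fun x => a * f x + g x).
Proof.
move=> [fP fi f2] [gP gi g2]; split=> [c x y z|x|x].
- rewrite !polar_linear fP gP; ring.
- by rewrite fi gi.
- by rewrite f2 g2; ring.
Qed.

Lemma quadratic0 : quadratic (fun=> 0).
Proof.
have p0 x y : polar (fun=> 0) x y = 0 by rewrite /polar subrr mulr0 addr0 mul0r.
by split=> [a x y z|//|x]; rewrite ?p0 ?mulr0 ?addr0.
Qed.

Lemma quadratic_comp f (s : H -> H) : linear s -> quadratic f -> quadratic (f \o s).
Proof.
move=> sL [fP fi f2].
have sZ a x : s (a *: x) = a *: s x.
  have s0 : s 0 = 0.
    by have := sL (-1) 0 0; rewrite scaler0 addr0 scaleN1r addNr.
  by rewrite -[a *: x]addr0 sL s0 addr0.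
have sD x y : s (x + y) = s x + s y by have := sL 1 x y; rewrite !scale1r.
have pE x y : polar (f \o s) x y = polar f (s x) (s y).
  have sB u v : s (u - v) = s u - s v by rewrite -[- v]scaleN1r sD sZ scaleN1r.
  by rewrite /polar /= !sB !sD !sZ.
split=> [a x y z|x|x].
- by rewrite !pE sL fP.
- by rewrite /= sZ fi.
- by rewrite /= sD f2.
Qed.

Lemma quadratic_cvg (f : nat -> H -> R) g : (forall N, quadratic (f N)) ->
  (forall x, (fun N => f N x) @ \oo --> (g x : R^o)) -> quadratic g.
Proof.
move=> fq fg.
have pc x y : (fun N => polar (f N) x y : R[i]^o) @ \oo --> (polar g x y : R[i]^o).
  have h u v : (fun N => (f N u - f N v)%:C : R[i]^o) @ \oo --> ((g u - g v)%:C : R[i]^o).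
    by apply: real_complex_cvg; apply: cvgB; exact: fg.
  apply: cvgMl; apply: cvgD; first exact: h.
  by apply: cvgMr; exact: h.
split=> [a x y z|x|x].
- have h : (fun N => polar (f N) (a *: x + y) z : R[i]^o) @ \oo -->
      (a * polar g x z + polar g y z : R[i]^o).
    under eq_fun do rewrite (let: And3 h _ _ := fq _ in h).
    by apply: cvgD; [apply: cvgMr|]; exact: pc.
  exact: norm_cvg_unique (pc _ _) h.
- have h : (fun N => f N ('i *: x) : R^o) @ \oo --> (g x : R^o).
    under eq_fun do rewrite (let: And3 _ h _ := fq _ in h); exact: fg.
  exact: norm_cvg_unique (fg _) h.
- have h : (fun N => f N (x + x) : R^o) @ \oo --> (4 * g x : R^o).
    under eq_fun do rewrite (let: And3 _ _ h := fq _ in h).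
    by apply: cvgMr; exact: fg.
  exact: norm_cvg_unique (fg _) h.
Qed.

Lemma polar_sqnorm x y : polar (@sqnorm R H) x y = <<x, y>>.
Proof.
rewrite /polar !rmorphB /= !sqnormE.
rewrite !(dotBl, dotBr); rewrite !(dotDl, dotDr) !(dotZl, dotZr) conjCi.
have i2 : 'i * 'i = -1 :> R[i] by rewrite -expr2 sqrCi.
by field: i2.
Qed.

Lemma quadratic_sqnorm : quadratic (@sqnorm R H).
Proof.
split=> [a x y z|x|x]; first by rewrite !polar_sqnorm dotP.
  by apply: complexI; rewrite sqnormZ normCi expr1n mul1r.
by apply: complexI; rewrite -mulr2n -scaler_nat sqnormZ normr_nat -natrX rmorphM /= rmorph_nat.
Qed.

(** Invariance under ['i] implies invariance under -1; the two together permute the four terms of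
    the polarization as conjugation does. *)
Lemma quadratic_polarC f x y : quadratic f -> polar f y x = (polar f x y)^*%R.
Proof.
move=> [_ fi _].
have fN u : f (- u) = f u.
  by rewrite -[RHS]fi -[RHS]fi scalerA -expr2 sqrCi scaleN1r.
have e1 : f (y - x) = f (x - y) by rewrite -fN opprB.
have e2 : f (y + 'i *: x) = f (x - 'i *: y).
  by rewrite -[f (x - _)]fi scalerBr scalerA -expr2 sqrCi scaleN1r opprK addrC.
have e3 : f (y - 'i *: x) = f (x + 'i *: y).
  by rewrite -[f (x + _)]fi scalerDr scalerA -expr2 sqrCi scaleN1r -fN opprB addrC.
have conjE (a b : R) : ((a%:C + 'i * b%:C) / 4)^*%R = (a%:C - 'i * b%:C) / 4 :> R[i].
  have e4 : (4^-1 : R[i])^*%R = 4^-1 by rewrite conj_Creal// realV realn.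
  rewrite (rmorphM (@Num.conj R[i])) /= e4; congr (_ * _).
  rewrite (rmorphD (@Num.conj R[i])) (rmorphM (@Num.conj R[i])) /= conjCi.
  by rewrite !(@conj_Creal _ _%:C) ?complex_real// mulNr.
by rewrite /polar conjE [y + x]addrC e1 e2 e3 -mulrN -(rmorphN (@real_complex R)) /= opprB.
Qed.

Lemma polar_self f x : quadratic f -> polar f x x = (f x)%:C.
Proof.
move=> [_ fi f2].
have f0 : f 0 = 0 by have := f2 0; rewrite addr0 => h; lra.
have e : f (x - 'i *: x) = f (x + 'i *: x).
  by rewrite -fi scalerBr scalerA -expr2 sqrCi scaleN1r opprK addrC.
rewrite /polar subrr f0 e subrr mulr0 addr0 subr0 f2 rmorphM /= rmorph_nat mulrAC mulfV ?mul1r//.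
Qed.

(** [A] is the identity minus the operator of [d]. This complement is the contraction to substitute
    into the series of sqrt (1 - z). *)
Lemma quadratic_operator d : quadratic d -> (forall x, 0 <= d x <= sqnorm x) ->
  exists A : H -> H, [/\ linear A, forall x y, <<A x, y>> = <<x, A y>>,
    forall x, `|A x| <= `|x| & forall x, <<A x, x>> = (sqnorm x - d x)%:C].
Proof.
move=> dq d01; have [dP _ _] := dq.
have dC x y := quadratic_polarC x y dq.
have d_ge0 x : 0 <= polar d x x by rewrite polar_self// lecR; case/andP: (d01 x).
have cs := cauchy_schwarz dP dC d_ge0.
have ex y : exists z, forall x, polar d x y = <<x, z>>.
  apply: (@riesz _ _ _ (complex.Re `|y|)) => [a u v|x x1]; first exact: dP.
  rewrite RRe_real ?normr_real// -(@ler_pXn2r _ 2) ?nnegrE// -sqnorm_norm.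
  apply: le_trans (cs _ _) _; rewrite !polar_self// -rmorphM lecR.
  have /andP[dx0 dx1] := d01 x; have /andP[dy0 dy1] := d01 y.
  by rewrite -[leRHS]mul1r ler_pM// (le_trans dx1).
have [D hD] := choice ex.
have DC x y : <<D x, y>> = <<x, D y>> by rewrite dotC -!hD -dC.
have DL : linear D by move=> a x y; apply: dot_inj => z; rewrite -DC !dotPr !DC.
pose A x := x - D x.
have AC x y : <<A x, y>> = <<x, A y>> by rewrite dotBl dotBr DC.
have AL : linear A.
  by move=> a x y; rewrite /A DL scalerBr opprD addrACA.
have Aq x : <<A x, x>> = (sqnorm x - d x)%:C.
  by rewrite dotBl DC -hD polar_self// rmorphB /= sqnormE.
exists A; split=> // x.
have cs' := @cauchy_schwarz _ _ (fun x y => <<A x, y>>) _ _ _ x (A x).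
(* Cauchy-Schwarz for the positive form of [A]. The right side is at most |x|^2 |A x|^2, and
   cancelling |A x|^2 gives the norm bound. *)
have : `|<<A x, A x>>| ^+ 2 <= <<A x, x>> * <<A (A x), A x>>.
  apply: cs' => [a u v w|u v|u]; first by rewrite AL dotP.
    by rewrite dotC -AC.
  by rewrite Aq lecR subr_ge0; case/andP: (d01 u).
rewrite !Aq -sqnormE norm_real_complex ger0_norm ?sqnorm_ge0// -rmorphXn -rmorphM lecR => h.
have [->|n0] := eqVneq (A x) 0; first by rewrite normr0.
have s0 : 0 < sqnorm (A x) by rewrite -ltcR sqnorm_norm exprn_gt0// normr_gt0.
have gen (s dx da sa : R) : 0 < sa -> 0 <= dx -> 0 <= da -> dx <= s -> sa ^+ 2 <= (s - dx) * (sa - da) -> sa <= s by nra.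
rewrite -(@ler_pXn2r _ 2) ?nnegrE// -!sqnorm_norm lecR.
have /andP[dx0 dx1] := d01 x; have /andP[da0 _] := d01 (A x).
exact: gen s0 dx0 da0 dx1 h.
Qed.

(** [L] is the norm-convergent series of the b_m A^m. Self-adjointness moves all powers of [A] to
    one side of the inner product, so the coefficients combine into the Cauchy square of [b], that
    is, into 1 - z. *)
Lemma operator_sqrt (A : H -> H) : linear A -> (forall x y, <<A x, y>> = <<x, A y>>) ->
  (forall x, `|A x| <= `|x|) -> exists L : H -> H, linear L /\
  forall x, <<L x, L x>> = <<x, x>> - <<A x, x>>.
Proof.
move=> AL AC Ac; have [b [S bS] bb] := @sqrt_coef R.
have itc m x : `|iter m A x| <= `|x| by elim: m => //= m; exact: le_trans.
have ex x : exists s, has_sum (fun m => (b m)%:C *: iter m A x) s.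
  apply: (complex_field_has_sum_dominated _ (has_sumZ (a := complex.Re `|x|) bS)) => m.
  by rewrite normrZ norm_real_complex mulrC rmorphM /= Re_norm ler_wpM2r// lecR.
have [L hL] := choice ex.
have AmC m x y : <<iter m A x, y>> = <<x, iter m A y>>.
  by elim: m x y => //= m ih x y; rewrite AC ih -iterSr.
exists L; split=> [a x y|x].
  apply: (has_sum_unique (hL _)).
  have := has_sumD (has_sumZ (a := a) (hL x)) (hL y); apply: eq_has_sum => m.
  have -> : iter m A (a *: x + y) = a *: iter m A x + iter m A y.
    by elim: m => //= m ->; rewrite AL.
  by rewrite scalerDr !scalerA mulrC.
pose F (p : nat * nat) : R[i]^o := (b p.1 * b p.2)%:C * <<iter (p.1 + p.2) A x, x>>.
have [s hs] : exists s : R[i]^o, has_sum F s.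
  have h := has_sumZ (a := sqnorm x) (has_sum_mul (fun m => normr_ge0 (b m)) (fun m => normr_ge0 (b m)) bS bS).
  apply: (@complex_field_has_sum_dominated R _ (complex_field R) _ _ _ _ h) => -[i j].
  rewrite [X in _ <= X](_ : _ = (`|b i| * `|b j|)%:C * (sqnorm x)%:C); last by rewrite -rmorphM [in RHS]mulrC.
  rewrite /F /= normrM norm_real_complex normrM ler_wpM2l//; first by rewrite lecR mulr_ge0.
  by rewrite sqnorm_norm expr2; apply: (le_trans (dot_le _ _)); rewrite ler_wpM2r.
have e1 : <<L x, L x>> = s.
  apply: (has_sum_unique (has_sum_dotl (x := L x) (hL x))).
  apply: has_sum_fubini hs _ => m.
  have := has_sumZ (a := (b m)%:C) (has_sum_conj (has_sum_dotl (x := iter m A x) (hL x))).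
  rewrite -dotC dotZl; apply: eq_has_sum => j.
  rewrite /F /= dotZl rmorphM /= conj_Creal ?complex_real// -dotC rmorphM -mulrA.
  by rewrite addnC iterD [<<iter j A _, x>>]AmC.
rewrite e1; apply: (has_sum_unique (has_sum_diagonal hs)).
have h := @has_sum_ord _ R[i]^o (fun N => (szego_inv N : R)%:C * <<iter N A x, x>>) 2.
rewrite !big_ord_recl big_ord0 /= addr0 !mul1r in h.
rewrite (_ : _ - _ = <<x, x>> + (-1)%:C * <<A x, x>>); last by rewrite rmorphN mulN1r.
apply: eq_has_sum (h _) => [N|[|[|m]]//= _]; last by rewrite mul0r.
rewrite -bb /conv rmorph_sum mulr_suml; apply: eq_bigr => m _.
by rewrite /F /= subnK// -ltnS.
Qed.

Lemma quadratic_sqrt d : quadratic d -> (forall x, 0 <= d x <= sqnorm x) ->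
  exists L : H -> H, linear L /\ forall x, sqnorm (L x) = d x.
Proof.
move=> dq d01; have [A [AL AC Ac Aq]] := quadratic_operator dq d01.
have [L [LL hL]] := operator_sqrt AL AC Ac; exists L; split=> // x.
by apply: complexI; rewrite sqnormE hL Aq -sqnormE -rmorphB /= opprB addrC subrK.
Qed.

End quadratic_forms.

(** * Hypercontractions are parts of the shift *)

(** Polarization: comparing the diagonals at [a *: x + y], the value a = 1 gives the sum of [b x y]
    and [b y x], and a = ['i] their difference. *)
Lemma sesquilinear_ext (R : realType) (V : lmodType R[i]) (D : set V) (b b' : V -> V -> R[i]) :
  (forall a x y, D x -> D y -> D (a *: x + y)) ->
  (forall a x y z, D x -> D y -> D z -> b (a *: x + y) z = a * b x z + b y z) ->
  (forall a x y z, D x -> D y -> D z -> b' (a *: x + y) z = a * b' x z + b' y z) ->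
  (forall x y, D x -> D y -> b y x = (b x y)^*%R) ->
  (forall x y, D x -> D y -> b' y x = (b' x y)^*%R) ->
  (forall x, D x -> b x x = b' x x) -> forall x y, D x -> D y -> b x y = b' x y.
Proof.
move=> DL bP bP' bC bC' bb' x y Dx Dy.
have expand (c : V -> V -> R[i]) a :
    (forall a x y z, D x -> D y -> D z -> c (a *: x + y) z = a * c x z + c y z) ->
    (forall x y, D x -> D y -> c y x = (c x y)^*%R) ->
    c (a *: x + y) (a *: x + y) = a * a^*%R * c x x + a * c x y + a^*%R * c y x + c y y.
  move=> cP cC; have Dxy := DL a _ _ Dx Dy.
  rewrite cP// (cC _ x Dxy Dx) (cC _ y Dxy Dy) !cP// !rmorphD !rmorphM /= -!cC//.
  ring.
have h a : a * b x y + a^*%R * b y x = a * b' x y + a^*%R * b' y x.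
  have := bb' _ (DL a _ _ Dx Dy); rewrite !expand// !bb'// => /addIr.
  by rewrite -!addrA => /addrI.
have h1 := h 1; have hi := h 'i.
rewrite conjC1 !mul1r in h1; rewrite conjCi !mulNr -!mulrBr in hi.
have {}hi : b x y - b y x = b' x y - b' y x by apply: mulfI hi; exact: neq0Ci.
apply: (@mulIf _ 2); first by rewrite pnatr_eq0.
transitivity (b x y + b y x + (b x y - b y x)); first by ring.
by rewrite h1 hi; ring.
Qed.

Lemma mpow_minc (n : nat) (X : Type) (s : 'I_n -> X -> X) i (al : mindex n) x :
  (forall i j x, s i (s j x) = s j (s i x)) ->
  mpow s (minc i al) x = mpow s al (s i x).
Proof.
elim: n s i al x => [|n ih] s i al x sC; first by case: i.
rewrite -(mcons_eta al).
set m := al ord0; set be : mindex n := [ffun _ => _].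
case: (unliftP ord0 i) => [j ->|->].
  have -> : minc (lift ord0 j) (mcons m be) = mcons m (minc j be).
    apply/ffunP => k; rewrite !ffunE; case: (unliftP ord0 k) => [l ->|->].
      by rewrite ?ffunE (inj_eq lift_inj).
    by rewrite addn0.
  by rewrite !mpow_mcons ih.
have -> : minc ord0 (mcons m be) = mcons m.+1 be.
  apply/ffunP => k; rewrite !ffunE; case: (unliftP ord0 k) => [l ->|->].
    by rewrite addn0.
  by rewrite addn1.
by rewrite !mpow_mcons iterSr mpow_comm.
Qed.

Lemma cvg_prodr (R : realType) (I : Type) (r : seq I) (f : I -> nat -> R^o) (l : I -> R) :
  (forall i, f i @ \oo --> (l i : R^o)) ->
  (fun N => \prod_(i <- r) f i N : R^o) @ \oo --> (\prod_(i <- r) l i : R^o).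
Proof.
move=> fl; elim: r => [|i r ih].
  by rewrite big_nil; under eq_fun do rewrite big_nil; exact: cvg_cst.
by rewrite big_cons; under eq_fun do rewrite big_cons; apply: cvgM.
Qed.

(** * Vanishing radii *)

Section boundary.
Context {R : realType}.

(** Hypercontractivity speaks of radii in the open interval, whereas the induction over the
    variables also uses radius 0. A zero radius is approximated by a decreasing sequence, whose
    first member provides the majorant; the others stay fixed. *)
Definition posr (r : R) (N : nat) : R := if r == 0 then N.+2%:R^-1 else r.

Lemma posr01 r N : 0 <= r < 1 -> 0 < posr r N < 1.
Proof.
rewrite /posr; case: eqVneq => [_ _|r0 /andP[rge ->]]; last by rewrite lt_def r0 rge.
by rewrite invr_gt0 ltr0n /= invf_lt1 ?ltr0n// ltr1n.
Qed.

Lemma posr_le r N : posr r N <= posr r 0.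
Proof. by rewrite /posr; case: ifP => // _; rewrite lef_pV2 ?posrE ?ltr0n// ler_nat. Qed.

Lemma posr_cvg r : posr r @ \oo --> (r : R^o).
Proof.
rewrite /posr; case: eqVneq => [->|_]; last exact: cvg_cst.
by have := @cvg_harmonic R; rewrite -(cvg_shiftS _); apply: cvg_trans.
Qed.

Lemma msum_ge0_boundary n (X : Type) (s : 'I_n -> X -> X) (B q : X -> R)
    (c : 'I_n -> nat -> R) (M : 'I_n -> R) x :
  multi_bound s B q -> (forall i m, `|c i m| <= M i) ->
  (forall r : 'I_n -> R, (forall i, 0 < r i < 1) ->
     0 <= msum s (fun i => scal (r i) (c i)) q x) ->
  forall r : 'I_n -> R, (forall i, 0 <= r i < 1) ->
     0 <= msum s (fun i => scal (r i) (c i)) q x.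
Proof.
move=> sB cM h r r01.
have p01 N i : 0 <= posr (r i) N < 1 by have /andP[/ltW -> ->] := posr01 N (r01 i).
have us N i := scal_bounded_summable (p01 N i) (cM i).
have us' i := scal_bounded_summable (r01 i) (cM i).
have [D hD] := prod_summable (us 0%N).
have sc i m : (fun N => scal (posr (r i) N) (c i) m : R^o) @ \oo --> (scal (r i) (c i) m : R^o).
  rewrite /scal; apply: cvgM; last exact: cvg_cst.
  by apply: cvg_exp; exact: posr_cvg.
have cv : (fun N => msum s (fun i => scal (posr (r i) N) (c i)) q x : R^o) @ \oo -->
    (msum s (fun i => scal (r i) (c i)) q x : R^o).
  apply: (@dominated_cvg_has_sum _ R R^o _ _ _ (fun N (al : mindex n) =>
     (\prod_(i < n) scal (posr (r i) N) (c i) (al i)) * q (mpow s al x)) _ _ _ _ _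
     (has_sumZ (a := B x) hD)).
  - apply: nearW => N al; rewrite normrM mulrC; apply: ler_pM => //.
      exact: multi_bound_mpow.
    rewrite normr_prod; apply: ler_prod => i _; rewrite normr_ge0 /scal !normrM !normrX.
    have /andP[a0 _] := p01 N i; have /andP[b0 _] := p01 0%N i.
    by rewrite ler_wpM2r// !ger0_norm// lerXn2r ?nnegrE// posr_le.
  - by move=> al; apply: cvgMl; apply: cvg_prodr => i; exact: sc.
  - by apply: nearW => N; exact: msum_has_sum (us N) sB.
  - exact: msum_has_sum us' sB.
apply: (cvg_ge0 _ cv); apply: nearW => N; apply: h => i; exact: posr01.
Qed.

End boundary.

Section A2_inequality.
Context {R : realType} {n : nat} (W : 'I_n -> nat -> R) (E : hilbertType R).
Hypothesis hW : forall i, weight_sequence (W i).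

Lemma A2_sub f g : A2 W E f -> A2 W E g -> A2 W E (f - g).
Proof. by move=> Af Ag; rewrite -scaleN1r addrC; exact: A2_linear. Qed.

Lemma A2dotPr c f g h : A2 W E f -> A2 W E g -> A2 W E h ->
  A2dot W E h (c *: f + g) = c^*%R * A2dot W E h f + A2dot W E h g.
Proof.
move=> Af Ag Ah; rewrite (A2dotC hW (A2_linear hW c Af Ag) Ah) (A2dotP hW c Af Ag Ah).
by rewrite rmorphD rmorphM /= -(A2dotC hW Af Ah) -(A2dotC hW Ag Ah).
Qed.

(** The parallelogram inequality, standing in for the triangle inequality on [A2], where only
    squared norms are at hand. *)
Lemma A2dotB_le f g : A2 W E f -> A2 W E g ->
  A2dot W E (f - g) (f - g) <= (A2dot W E f f + A2dot W E g g) *+ 2.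
Proof.
move=> Af Ag.
have expand c : A2dot W E (c *: g + f) (c *: g + f) =
    c * c^*%R * A2dot W E g g + c * A2dot W E g f + c^*%R * A2dot W E f g + A2dot W E f f.
  have Acf := A2_linear hW c Ag Af.
  rewrite (A2dotP hW c Ag Af Acf) (A2dotPr c Ag Af Ag) (A2dotPr c Ag Af Af); ring.
have h1 := A2dot_ge0 hW (A2_linear hW 1 Ag Af).
rewrite expand conjC1 !mul1r in h1.
rewrite (_ : f - g = (-1) *: g + f); last by rewrite scaleN1r addrC.
have cN1 : (-1 : R[i])^*%R = -1 by rewrite conj_Creal// realN realn.
rewrite expand cN1 mulrNN !mul1r !mulN1r -subr_ge0.
by apply: le_trans h1 _; rewrite le_eqVlt; apply/orP; left; apply/eqP; ring.
Qed.

End A2_inequality.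

(** * The isometric model and its closed range *)

Section model.
Context {R : realType} {n : nat} {H : hilbertType R}.
Variables (W : 'I_n -> nat -> R) (T : 'I_n -> {linear H -> H}).
Hypothesis hW : forall i, weight_sequence (W i).
Hypothesis Tc : forall i, contractive (T i).
Hypothesis TC : forall i j x, T i (T j x) = T j (T i x).
Hypothesis Tpure : forall i, pure_operator (T i).
Hypothesis Thyper : hypercontraction W T.
Local Notation S := (fun i => hadjoint (T i)).

Let SC i j x : S i (S j x) = S j (S i x).
Proof. by apply: hadjoint_comm => // y; exact: TC. Qed.

Let SL i : linear (S i).
Proof. exact: hadjoint_linear. Qed.

Let defect_form : exists d : H -> R,
  [/\ quadratic d, forall x, 0 <= d x <= sqnorm x &
      forall x, has_sum (fun al : mindex n => (mweight W al)^-1 * d (mpow S al x) : R^o) (sqnorm x)].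
Proof.
have [c hc] := choice (fun i => weight_sequence_pair (hW i)).
have cP i := (hc i).1.
(* A choice between [c i] and [szego_inv] for each index is the coefficient form of a choice of
   weights in S(W). *)
have weight_or_one i (c' : nat -> R) : c' = c i \/ c' = szego_inv ->
    exists w, (w = W i \/ w = (fun=> 1)) /\ (exists M, forall m, `|c' m| <= M) /\
      forall z : R[i], `|z| < 1 ->
        has_sum (fun m => (c' m)%:C * z ^+ m : R[i]^o) ((kfun w z)^-1 : R[i]^o).
  move=> [->|->].
    exists (W i); split; [by left|split; last exact: (hc i).2].
    exact: pair_bound (cP i).
  exists (fun=> 1); split; [by right|split; last exact: kfun1_inverse].
  by exists 1; exact: szego_inv_bound.
have [d [dq d01 ds]] : exists d : H -> R, [/\ quadratic d, forall x, 0 <= d x <= sqnorm x &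
    forall x, has_sum (fun al : mindex n => (\prod_(i < n) (W i (al i))^-1) * d (mpow S al x) : R^o) (sqnorm x)].
  apply: (@multi_defect R n H S (fun i m => (W i m)^-1) c (@sqnorm R H) (@sqnorm R H) quadratic cP SC).
  - exact: hadjoint_multi_bound.
  - move=> i x; have h : (fun k => iter k (S i) x) @ \oo --> (0 : H) by exact: Tpure.
    have h1 : (fun m => `|iter m (S i) x| : R[i]^o) @ \oo --> (0 : R[i]^o).
      by rewrite -[0 in X in _ --> X](normr0 H); exact: cvg_norm h.
    have h2 : (fun m => `|iter m (S i) x| ^+ 2 : R[i]^o) @ \oo --> (0 : R[i]^o).
      by rewrite -[0 in X in _ --> X](mulr0 (0 : R[i])); under eq_fun do rewrite expr2; exact: cvgM.
    rewrite (_ : (fun m => sqnorm _) = fun m => complex.Re (`|iter m (S i) x| ^+ 2)).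
      exact: (Re_cvg h2).
    by apply/funext => m; rewrite -sqnorm_norm.
  - move=> c' hc'.
    have [W' hW'] := choice (fun i => weight_or_one i _ (hc' i)).
    have [M hM] := choice (fun i => (hW' i).2.1).
    move=> r r01 x; apply: (@msum_ge0_boundary R n H S (@sqnorm R H) (@sqnorm R H) c' M x _ hM _ r r01).
      exact: hadjoint_multi_bound.
    move=> r' r'01; rewrite -lecR -(defectE Tc TC _ hM (fun i => (hW' i).2.2) r'01).
    by apply: Thyper => // i; exact: (hW' i).1.
  - exact: quadratic_linear.
  - exact: quadratic0.
  - by move=> i f; exact: quadratic_comp.
  - exact: quadratic_cvg.
  - exact: quadratic_sqnorm.
exists d; split=> // x; apply: eq_has_sum (ds x) => al.
by rewrite /mweight prodfV.
Qed.

Let model_map : exists U : H -> polydisc R n -> H,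
  [/\ linear U, forall x, A2 W H (U x),
      forall x y, A2dot W H (U x) (U y) = hdot H x y &
      forall i x, adjoint (A2 W H) (A2dot W H) (mul_coord H i) (U x) = U (S i x)].
Proof.
have [d [dq d01 ds]] := defect_form.
have [L [LL Ld]] := quadratic_sqrt dq d01.
pose coef x al := ((mweight W al)^-1)%:C *: L (mpow S al x).
have w0 al := mweight_gt0 hW al.
have cS x : has_sum (fun al => sqnorm (coef x al) * mweight W al : R^o) (sqnorm x).
  apply: eq_has_sum (ds x) => al; rewrite -Ld.
  have -> : sqnorm (coef x al) = (mweight W al)^-1 ^+ 2 * sqnorm (L (mpow S al x)).
    apply: complexI; rewrite sqnormZ norm_real_complex rmorphM rmorphXn /=.
    by rewrite ger0_norm// invr_ge0 ltW.
  by field; rewrite gt_eqF.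
have l2c x : l2 W (coef x) by exists (sqnorm x).
have [U hU] := choice (fun x => l2_has_taylor hW (l2c x)).
have UA x : A2 W H (U x) := l2_A2 hW (hU x) (l2c x).
have mL al : linear (mpow S al).
  move=> a x y; rewrite /mpow; elim: (index_enum _) => [|i r ih]; first by rewrite !big_nil.
  rewrite !big_cons /= ih; elim: (al i) => //= m ->; exact: SL.
have UL : linear U.
  move=> a x y; apply: has_taylor_eq (hU _) _.
  rewrite (_ : coef _ = fun al => a *: coef x al + coef y al); first exact: has_taylor_linear.
  by apply/funext => al; rewrite /coef mL LL scalerDr !scalerA mulrC.
exists U; split=> // [x y|i x].
  (* The expansion of the squared norm through [d] gives equality on the diagonal; polarization
     extends it to all pairs. *)
  apply: (@sesquilinear_ext R H setT (fun x y => A2dot W H (U x) (U y)) (hdot H)) => //.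
  - by move=> a u v z _ _ _ /=; rewrite UL (A2dotP hW).
  - by move=> a u v z _ _ _; rewrite dotP.
  - by move=> u v _ _ /=; rewrite (A2dotC hW).
  - by move=> u v _ _; rewrite -dotC.
  - move=> u _ /=; have [s hs ->] := A2dot_self hW (UA u).
    by rewrite -sqnormE; congr (_%:C); apply: has_sum_unique hs _; rewrite (taylorE (hU u)).
apply: (A2_ext hW) => //; first exact: A2_adj.
rewrite taylor_adj// !(taylorE (hU _)); apply/funext => al.
rewrite /adj_coef /coef scalerA mpow_minc// -rmorphM; congr (_%:C *: _).
by rewrite mulrC mulrA mulVf ?mul1r// gt_eqF.
Qed.

Lemma hypercontraction_is_part : is_part (A2 W H) (A2dot W H) T (mul_coord H).
Proof.
have [U [UL UA UI UM]] := model_map.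
pose Q := range U.
have QA : Q `<=` A2 W H by move=> _ [x _ <-].
have QL a f g : Q f -> Q g -> Q (a *: f + g).
  by move=> [x _ <-] [y _ <-]; exists (a *: x + y); rewrite ?UL.
pose Ulin : {linear H -> (polydisc R n -> H)} :=
  HB.pack U (GRing.isLinear.Build R[i] H (polydisc R n -> H) *:%R U UL).
exists Q; split; last 1 first.
- exists Ulin; split=> // i x; symmetry; apply: (orthoprojE hW) => //.
  + exact: A2_mul.
  + by exists (T i x).
  + move=> _ [y _ <-] /=.
    rewrite (_ : _ - _ = (-1) *: U (T i x) + mul_coord H i (U x)); last by rewrite scaleN1r addrC.
    rewrite (A2dotP hW (-1) (UA _) (A2_mul hW i (UA x)) (UA y)).
    by rewrite (A2dot_mul hW i (UA x) (UA y)) UM !UI mulN1r hadjointP// addNr.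
- split=> //; first by exists 0 => //; exact: (linear0 Ulin).
  (* The range is closed because [U] is isometric and [H] complete: preimages [x k] of a convergent
     sequence are Cauchy, and the image of their limit is at zero distance from [f]. *)
  move=> q f Qq Af qf; have [x hx] := choice (fun k => let: ex_intro2 x _ h := Qq k in ex_intro _ x h).
  have Aqf k : A2 W H (q k - f) by apply: A2_sub => //; exact: QA.
  pose e k := A2dot W H (q k - f) (q k - f).
  have e0 k : 0 <= e k by exact: (A2dot_ge0 hW).
  have Ux u v : U u - U v = U (u - v) by rewrite -[U]/(Ulin : _ -> _) linearB.
  have dist k l : `|x k - x l| ^+ 2 <= (e k + e l) *+ 2.
    rewrite hdotE -UI -Ux !hx.
    rewrite (_ : q k - q l = (q k - f) - (q l - f)); last by rewrite opprB addrA subrK.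
    exact: A2dotB_le.
  have xcvg : cvg (x @ \oo).
    apply/cauchy_cvgP/cauchy_ballP => r r0.
    have r2 : 0 < r ^+ 2 / 4 by rewrite divr_gt0// exprn_gt0.
    move/cvgrPdist_lt: (qf) => /(_ _ r2)[N _ hN].
    exists (x @` [set k | (N <= k)%N], x @` [set k | (N <= k)%N]).
      by split; exists N => // k Nk; exists k.
    move=> [_ _] [[k Nk <-] [l Nl <-]] /=; rewrite -ball_normE /=.
    rewrite -(@ltr_pXn2r _ 2) ?nnegrE ?(ltW r0)//; apply: le_lt_trans (dist k l) _.
    have {}hN m : (N <= m)%N -> e m < r ^+ 2 / 4.
      by move=> /hN; rewrite sub0r normrN ger0_norm//; exact: e0.
    have -> : r ^+ 2 = (r ^+ 2 / 4 + r ^+ 2 / 4) *+ 2 by field.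
    by rewrite ltrMn2r/= ltrD// hN.
  have /cvg_ex[y xy] := xcvg; exists y => //.
  have Ay := UA y.
  have Afy : A2 W H (f - U y) by exact: A2_sub.
  suff : A2dot W H (f - U y) (f - U y) = 0.
    by move=> /(A2dot_eq0 hW Afy)/subr0_eq.
  apply/eqP; rewrite eq_le (A2dot_ge0 hW)// andbT -oppr_ge0.
  have cv : (fun k => (`|x k - y| * `|x k - y| + e k) * 2 - A2dot W H (f - U y) (f - U y) : R[i]^o) @ \oo -->
      ((0 * 0 + 0) * 2 - A2dot W H (f - U y) (f - U y) : R[i]^o).
    apply: cvgB; last exact: cvg_cst.
    apply: cvgMl; apply: cvgD; last exact: qf.
    have h : (fun k => `|x k - y| : R[i]^o) @ \oo --> (0 : R[i]^o).
      rewrite -[0 in X in _ --> X](normr0 H) -(subrr y).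
      by apply: (@cvg_norm _ _ _ _ _ (fun k => x k - y)); apply: cvgB => //; exact: cvg_cst.
    exact: cvgM.
  have c0 : (0 * 0 + 0) * 2 - A2dot W H (f - U y) (f - U y) = - A2dot W H (f - U y) (f - U y).
    by rewrite mulr0 addr0 mul0r add0r.
  rewrite -c0.
  apply: (cvg_ge0 _ cv); apply: nearW => k.
  rewrite subr_ge0 -expr2 hdotE -UI -Ux hx mulr_natr.
  rewrite (_ : f - U y = (q k - U y) - (q k - f)); last by rewrite opprB [RHS]addrC addrA subrK.
  exact: (A2dotB_le hW (A2_sub hW (QA _ (Qq k)) Ay) (Aqf k)).
- by move=> i _ [x _ <-]; rewrite UM; exists (S i x).
Qed.

End model.

(** * Parts of the shift are hypercontractions *)

Section weighted_backward_shift.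
Context {R : realType} {n : nat} {X : Type} (W : 'I_n -> nat -> R).
Variables (s : 'I_n -> X -> X) (q : X -> R) (y : X -> mindex n -> R).
Hypothesis hW : forall i, weight_sequence (W i).
Hypothesis y_ge0 : forall x be, 0 <= y x be.
Hypothesis y_shift : forall i x be, y (s i x) be = y x (minc i be).
Hypothesis y_sum : forall x, has_sum (fun be => y x be / mweight W be : R^o) (q x).

Definition madd (al be : mindex n) : mindex n := [ffun j => (al j + be j)%N].
Definition msingle i m : mindex n := [ffun j => if j == i then m else 0%N].

Lemma madd_inj al : injective (madd al).
Proof.
move=> be be' e; apply/ffunP => j; move/ffunP/(_ j): e; rewrite !ffunE.
exact: addnI.
Qed.

Lemma mweight_madd al be : mweight W (madd al be) <= mweight W be.
Proof.
apply: ler_prod => j _; rewrite ffunE ltW ?weight_gt0//=.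
by apply: weight_nonincreasing => //; rewrite leq_addl.
Qed.

Lemma shift_iter i m x be : y (iter m (s i) x) be = y x (madd (msingle i m) be).
Proof.
elim: m be => [|m ih] be /=.
  by congr (y x _); apply/ffunP => j; rewrite !ffunE if_same.
rewrite y_shift ih; congr (y x _); apply/ffunP => j; rewrite !ffunE.
by case: eqP => //= _; rewrite ?addn0 ?addn1 ?addnS.
Qed.

Lemma shift_mpow al x be : y (mpow s al x) be = y x (madd al be).
Proof.
have h (r : seq 'I_n) ga : y ((\big[@comp X X X/id]_(i <- r) iter (al i) (s i)) x) ga =
    y x (madd [ffun j => \sum_(i <- r | i == j) al i]%N ga).
  elim: r ga => [|i r ih] ga.
    by rewrite big_nil; congr (y x _); apply/ffunP => j; rewrite !ffunE big_nil.
  rewrite big_cons /= shift_iter ih; congr (y x _); apply/ffunP => j.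
  rewrite !ffunE big_cons eq_sym; case: eqP => [->|_]; last by [].
  by rewrite addnCA addnA.
by rewrite /mpow h; congr (y x _); apply/ffunP => j; rewrite !ffunE big_pred1_eq.
Qed.

Let tail_sum x al : exists t : R,
  has_sum (fun be => y x (madd al be) / mweight W (madd al be) : R^o) t /\ t <= q x.
Proof.
have w0 := mweight_gt0 hW.
pose v ga := y x ga / mweight W ga.
have v0 ga : 0 <= v ga by rewrite divr_ge0// ltW.
apply: has_sum_bounded => [be|A]; first exact: v0.
have -> : \sum_(be <- A) y x (madd al be) / mweight W (madd al be) =
    \sum_(ga <- [fset madd al be | be in A]%fset) v ga.
  by rewrite big_imfset//= => be be' _ _; exact: madd_inj.
exact: (has_sum_ge_term _ v0 (@y_sum x)).
Qed.

Let row_le al x be : y x (madd al be) / mweight W be <= y x (madd al be) / mweight W (madd al be).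
Proof. by rewrite ler_wpM2l// lef_pV2 ?posrE ?mweight_gt0// mweight_madd. Qed.

Let row_sum al x : has_sum (fun be => y x (madd al be) / mweight W be : R^o) (q (mpow s al x)).
Proof. by apply: eq_has_sum (@y_sum _) => be; rewrite shift_mpow. Qed.

Lemma shift_multi_bound : multi_bound s q q.
Proof.
have q0 x : 0 <= q x.
  by apply: has_sum_ge0 (@y_sum x) => be; rewrite divr_ge0// ltW// mweight_gt0.
split=> [i x|x]; last by rewrite ger0_norm.
have [t [ht tq]] := tail_sum x (msingle i 1).
apply: le_trans tq; apply: has_sum_le (@y_sum (s i x)) ht => be.
by rewrite -[s i x]/(iter 1 (s i) x) shift_iter row_le.
Qed.

(** Monotonicity of the weights bounds [q (iter m (s i) x)] by the part of the series of [q x] with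
    [m <= ga i], which tends to 0 by dominated convergence. *)
Lemma shift_pure i x : (fun m => q (iter m (s i) x) : R^o) @ \oo --> (0 : R^o).
Proof.
have w0 := mweight_gt0 hW.
pose v ga := y x ga / mweight W ga.
have v0 ga : 0 <= v ga by rewrite divr_ge0// ltW.
pose z m (ga : mindex n) := if (m <= ga i)%N then v ga else 0.
have z0 m ga : 0 <= z m ga by rewrite /z; case: ifP.
have zs m : exists t : R^o, has_sum (z m : mindex n -> R^o) t.
  apply: (has_sum_dominated _ (@y_sum x)) => ga.
  by rewrite ger0_norm// /z; case: ifP => // _; exact: v0.
have [t ht] := choice zs.
have t0 : t @ \oo --> (0 : R^o).
  apply: (@dominated_cvg_has_sum _ R R^o _ _ _ z (fun=> 0) _ _ _ _ (@y_sum x)).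
  - apply: nearW => m ga; rewrite ger0_norm// /z; case: ifP => // _; exact: v0.
  - move=> ga; apply/cvgrPdist_lt => e e0; exists (ga i).+1 => // m /= gm.
    by rewrite /z leqNgt gm /= subrr normr0.
  - by apply: nearW => m; exact: ht.
  - exact: has_sum0.
have [sq qB] := shift_multi_bound.
apply: (@squeeze_cvgr _ _ _ _ (fun=> 0 : R^o) t); [|exact: cvg_cst|exact: t0].
apply: nearW => m; apply/andP; split.
  by apply: has_sum_ge0 (@y_sum _) => be; rewrite divr_ge0// ltW.
have := (@has_sum_reindex _ _ _ _ (madd (msingle i m)) (z m) (t m) (@madd_inj _) _).2 (ht m).
move=> h; apply: has_sum_le (@y_sum _) (h _) => [be|ga].
  by rewrite /= /z !ffunE eqxx leq_addr shift_iter row_le.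
rewrite /z; case: ifPn => [mg _|_ /eqP//].
exists [ffun j => (ga j - msingle i m j)%N]; apply/ffunP => j; rewrite !ffunE subnKC//.
by case: eqP => [->|].
Qed.

(* Grouping the terms by [ga = al + be], where [be] runs over the expansion of
   [q (mpow s al x)], turns the coefficients into Cauchy products. *)
Lemma shift_msum_ge0 (u : 'I_n -> nat -> R) x : (forall i, abs_summable (u i)) ->
  (forall i m, 0 <= conv (fun m => (W i m)^-1) (u i) m) -> 0 <= msum s u q x.
Proof.
move=> us cu; have w0 := mweight_gt0 hW.
have [D hD] := prod_summable us.
pose F (p : mindex n * mindex n) : R := (\prod_(i < n) u i (p.1 i)) * (y x (madd p.1 p.2) / mweight W p.2).
(* Absolute summability, needed before regrouping: the row of [al] sums to the modulus of its
   coefficient times [q (mpow s al x)], at most [q x]. *)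
have [S hS] : exists S : R, has_sum (fun p => `|F p| : R^o) S.
  pose g (al : mindex n) := (\prod_(i < n) `|u i (al i)|) * q (mpow s al x).
  have [t ht] : exists t : R^o, has_sum (g : mindex n -> R^o) t.
    apply: (has_sum_dominated _ (has_sumZ (a := q x) hD)) => al.
    rewrite /g normrM mulrC ler_pM//; first exact: multi_bound_mpow shift_multi_bound.
    by rewrite ger0_norm// prodr_ge0.
  exists t; apply: (has_sum_tonelli (g := g)) => // al.
  rewrite /g; apply: eq_has_sum (has_sumZ (a := \prod_(i < n) `|u i (al i)|) (@row_sum al x)) => be.
  by rewrite /F normrM normr_prod (ger0_norm (divr_ge0 _ _))// ltW.
have [t ht] : exists t : R^o, has_sum (F : _ -> R^o) t.
  by apply: (has_sum_dominated _ hS).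
have -> : msum s u q x = t.
  apply: (has_sum_unique (msum_has_sum us shift_multi_bound)).
  apply: has_sum_fubini ht _ => al; exact: has_sumZ (@row_sum al x).
pose G (p : mindex n * mindex n) : R := if [forall i, (p.2 i <= p.1 i)%N] then
  (\prod_(i < n) (u i (p.2 i) / W i (p.1 i - p.2 i)%N)) * y x p.1 else 0.
have hG : has_sum (G : _ -> R^o) t.
  apply/(@has_sum_reindex _ _ _ _ (fun p : mindex n * mindex n => (madd p.1 p.2, p.1))).
  - by move=> [al be] [al' be'] [e1 e2]; move: e1; rewrite e2 => /madd_inj ->.
  - move=> [ga al]; rewrite /G /=; case: ifPn => [/forallP h _|_ /eqP//].
    exists (al, [ffun j => (ga j - al j)%N]); congr (_, _); apply/ffunP => j.
    by rewrite !ffunE subnKC//; exact: h.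
  - apply: eq_has_sum ht => -[al be]; rewrite /G /F /= ifT; last first.
      by apply/forallP => j; rewrite ffunE leq_addr.
    rewrite big_split /= -[RHS]mulrA; congr (_ * _).
    rewrite mulrC; congr (_ * _); rewrite /mweight -prodfV; apply: eq_bigr => j _.
    by rewrite ffunE addKn.
have hrow ga : has_sum (fun al => G (ga, al) : R^o)
    ((\prod_(i < n) conv (fun m => (W i m)^-1) (u i) (ga i)) * y x ga).
  (* Extending the terms of the Cauchy product by 0 makes a product of finite sums a sum over all
     multi-indices, as [has_sum_prod] requires. *)
  pose b i m : R := if (m <= ga i)%N then u i m / W i (ga i - m)%N else 0.
  have b0 i m : ((ga i).+1 <= m)%N -> b i m = 0 by move=> gm; rewrite /b leqNgt gm.
  have bC i : has_sum (fun m => (b i m)%:C : R[i]^o) (\sum_(m < (ga i).+1) (b i m)%:C).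
    by apply: (@has_sum_ord _ R[i]^o) => m /b0 ->.
  have bR i : has_sum (fun m => `|b i m| : R^o) (\sum_(m < (ga i).+1) `|b i m|).
    by apply: (@has_sum_ord _ R^o) => m /b0 ->; rewrite normr0.
  have ble i m : `|(b i m)%:C : R[i]| <= (`|b i m|)%:C by rewrite norm_real_complex.
  have h := has_sum_prod ble bR bC.
  have h2 : has_sum (fun al : mindex n => \prod_(i < n) b i (al i) : R^o)
      (\prod_(i < n) conv (fun m => (W i m)^-1) (u i) (ga i)).
    apply/has_sum_real_complex; rewrite rmorph_prod.
    have e i : \sum_(m < (ga i).+1) (b i m)%:C = (conv (fun m => (W i m)^-1) (u i) (ga i))%:C :> R[i].
      rewrite /conv rmorph_sum; apply: eq_bigr => m _.
      by rewrite /b -ltnS ltn_ord mulrC.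
    rewrite (eq_bigr _ (fun i _ => e i)) in h.
    by apply: eq_has_sum h => al; rewrite rmorph_prod.
  rewrite mulrC; apply: eq_has_sum (has_sumZ (a := y x ga) h2) => al; rewrite /G /= mulrC.
  case: ifPn => [/forallP h3|]; first by congr (_ * _); apply: eq_bigr => i _; rewrite /b h3.
  rewrite negb_forall => /existsP[i /negPf gi].
  by rewrite (bigD1 i)//= /b gi mul0r scaler0.
apply: has_sum_ge0 (has_sum_fubini hG hrow) => ga.
by rewrite mulr_ge0// prodr_ge0.
Qed.

End weighted_backward_shift.

(** Beyond degree 0 the coefficient is 1/w_(m+1) - r/w_m, non-negative because the weights do not
    increase. *)
Lemma conv_szego_ge0 (R : realType) (w : nat -> R) (r : R) m : weight_sequence w -> 0 < r < 1 ->
  0 <= conv (fun m => (w m)^-1) (scal r szego_inv) m.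
Proof.
move=> hw /andP[r0 r1]; case: m => [|m].
  by rewrite /conv big_ord1 /scal /szego_inv /= !mulr1 invr_ge0 ltW// weight_gt0.
rewrite /conv big_ord_recl big_ord_recl big1 => [|i _]; last by rewrite /scal /szego_inv /= !mulr0.
rewrite /scal /szego_inv /= addr0 subn0 subn1 /= expr0 expr1 !mulr1 mulrN1 mulrN subr_ge0.
have w0 k : 0 < w k by exact: weight_gt0.
apply: (@le_trans _ _ (w m)^-1); first by rewrite ler_piMr ?invr_ge0 ?(ltW r1)// ltW.
by rewrite lef_pV2 ?posrE//; apply: weight_nonincreasing.
Qed.

(** * Transport of the backward shifts to the given space *)

Section part_of_shift.
Context {R : realType} {n : nat} {H E : hilbertType R}.
Variables (W : 'I_n -> nat -> R) (T : 'I_n -> {linear H -> H}).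
Hypothesis hW : forall i, weight_sequence (W i).
Hypothesis Tc : forall i, contractive (T i).
Hypothesis TC : forall i j x, T i (T j x) = T j (T i x).
Hypothesis Tpart : is_part (A2 W E) (A2dot W E) T (mul_coord E).
Local Notation S := (fun i => hadjoint (T i)).

Let backward_shift_model : exists y : H -> mindex n -> R,
  [/\ forall x be, 0 <= y x be,
      forall i x be, y (S i x) be = y x (minc i be) &
      forall x, has_sum (fun be => y x be / mweight W be : R^o) (sqnorm x)].
Proof.
have [Q [[QA _ QL _] QM [U [UQ UI UT]]]] := Tpart.
have w0 := mweight_gt0 hW.
have QU x : Q (U x) by rewrite -UQ; exists x.
have UA x : A2 W E (U x) by exact: QA.
have hB0 (p : 'I_n * H) : exists z, U z = adjoint (A2 W E) (A2dot W E) (mul_coord E p.1) (U p.2).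
  have : Q (adjoint (A2 W E) (A2dot W E) (mul_coord E p.1) (U p.2)) by exact: QM.
  by rewrite -UQ => -[z _ <-]; exists z.
(* [Q] is the range of [U] and is invariant under the adjoint shifts, so these pull back to
   operators [B i] on [H]. They will turn out to be the adjoints of the [T i]. *)
have [B0 hB] := choice hB0; pose B i x := B0 (i, x).
have UB i x : U (B i x) = adjoint (A2 W E) (A2dot W E) (mul_coord E i) (U x) by exact: hB.
have Bdot i z x : hdot H z (B i x) = A2dot W E (mul_coord E i (U z)) (U x).
  by rewrite -UI UB (A2dot_mul hW i (UA z) (UA x)).
have Uinj x x' : U x = U x' -> x = x'.
  by move=> e; apply: dot_inj => z; rewrite -!UI e.
have BL i : linear (B i).
  move=> a x x'; apply: dot_inj => z; rewrite dotPr !Bdot linearP.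
  exact: (A2dotPr hW a (UA x) (UA x') (A2_mul hW i (UA z))).
(* The square of the weight cancels the quotient of weights in [adj_coef], so that [B i] acts on [y]
   by a mere shift of the index. *)
pose y x be := sqnorm (taylor (U x) be) * mweight W be ^+ 2.
have y0 x be : 0 <= y x be by rewrite mulr_ge0 ?sqnorm_ge0 ?sqr_ge0.
have yB i x be : y (B i x) be = y x (minc i be).
  rewrite /y UB (taylor_adj hW i (UA x)).
  have -> : sqnorm (adj_coef W i (taylor (U x)) be) =
      (mweight W (minc i be) / mweight W be) ^+ 2 * sqnorm (taylor (U x) (minc i be)).
    apply: complexI; rewrite sqnormZ norm_real_complex rmorphM rmorphXn /=.
    by rewrite ger0_norm// divr_ge0// ltW.
  by field; rewrite gt_eqF.
have ysum x : has_sum (fun be => y x be / mweight W be : R^o) (sqnorm x).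
  have [s hs e] := A2dot_self hW (UA x).
  have -> : sqnorm x = s by apply: complexI; rewrite sqnormE -UI.
  by apply: eq_has_sum hs => be; rewrite /y; field; rewrite gt_eqF.
have [BS _] := shift_multi_bound hW y0 yB ysum.
pose Bl i : {linear H -> H} := HB.pack (B i) (GRing.isLinear.Build R[i] H H *:%R (B i) (BL i)).
have Bc i : contractive (Bl i).
  by move=> x; rewrite -(@ler_pXn2r _ 2) ?nnegrE// -!sqnorm_norm lecR; exact: BS.
(* The adjoint of [B i] satisfies the orthogonality that characterizes the compression of the
   coordinate multiplication, hence equals [T i]; taking adjoints again identifies the adjoint of
   [T i] with [B i]. *)
have TB i z : T i z = hadjoint (Bl i) z.
  apply: Uinj; rewrite UT; apply: (orthoprojE hW QA QL (A2_mul hW i (UA z)) (QU _)) => p.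
  rewrite -UQ => -[x _ <-].
  rewrite (_ : _ - _ = (-1) *: U (hadjoint (Bl i) z) + mul_coord E i (U z)); last first.
    by rewrite scaleN1r addrC.
  rewrite (A2dotP hW (-1) (UA _) (A2_mul hW i (UA z)) (UA x)) -Bdot UI mulN1r.
  by rewrite [hdot H (hadjoint _ _) _]dotC -hadjointP// -dotC addNr.
exists y; split=> // i x be; rewrite -yB; congr (y _ be).
by apply: adjointP => z; rewrite TB dotC -hadjointP// -dotC.
Qed.

Lemma part_pure_hypercontraction : pure_hypercontraction W T.
Proof.
have [y [y0 yS ysum]] := backward_shift_model; split=> [W' hW' r r01 x|i x].
  have ex i : exists c : nat -> R, [/\ exists M, forall m, `|c m| <= M,
      forall z : R[i], `|z| < 1 ->
        has_sum (fun m => (c m)%:C * z ^+ m : R[i]^o) ((kfun (W' i) z)^-1 : R[i]^o) &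
      forall m, 0 <= conv (fun m => (W i m)^-1) (scal (r i) c) m].
    have [->|->] := hW' i.
      have [c [ck hc]] := weight_sequence_pair (hW i); exists c; split=> //.
        exact: pair_bound ck.
      exact: pair_P1 ck _ (r01 i).
    exists szego_inv; split; [|exact: kfun1_inverse|].
      by exists 1; exact: szego_inv_bound.
    by move=> m; exact: conv_szego_ge0.
  have [c hc] := choice ex.
  have [M hM] := choice (fun i => let: And3 h _ _ := hc i in h).
  have hc2 i := let: And3 _ h _ := hc i in h.
  have hc3 i := let: And3 _ _ h := hc i in h.
  rewrite (defectE Tc TC x hM hc2 r01) lecR.
  apply: (shift_msum_ge0 hW y0 yS ysum) => // i.
  by apply: scal_bounded_summable (hM i); case/andP: (r01 i) => /ltW -> ->.
have h := shift_pure hW y0 yS ysum i x.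
apply/cvgrPdist_lt => e e0.
have e2 : 0 < complex.Re e ^+ 2 by rewrite exprn_gt0// -ltcR RRe_real ?gtr0_real.
move/cvgrPdist_lt: h => /(_ _ e2); apply: filterS => m.
rewrite !sub0r !normrN ger0_norm ?sqnorm_ge0// -ltcR sqnorm_norm rmorphXn /= RRe_real ?gtr0_real//.
by rewrite ltr_pXn2r ?nnegrE// ltW.
Qed.

End part_of_shift.
Theorem theorem1p2 (R : realType) (n : nat) (W : 'I_n -> nat -> R)
    (H : hilbertType R) (T : 'I_n -> {linear H -> H})
    (n_gt0 : (0 < n)%N)
    (weightW : forall i, weight_sequence (W i))
    (contractT : forall i, contractive (T i))
    (commT : forall i j x, T i (T j x) = T j (T i x)) :
  (exists E : hilbertType R,
     is_part (A2 W E) (A2dot W E) T (mul_coord E)) <->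
  pure_hypercontraction W T.
Proof.
split=> [[E]|[Th Tp]]; first exact: part_pure_hypercontraction.
by exists H; exact: hypercontraction_is_part.
Qed.
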